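(* Let $0<\gamma\le\infty$ and let $\psi:[0,\gamma)\to[0,\infty)$ be a non-zero increasing concave function, continuous on $(0,\gamma)$, with $\psi(0)=0$. The Marcinkiewicz space $M_\psi(0,\gamma)$ is a Grothendieck space if and only if either condition (A) or condition (B) is satisfied.
   Context: For $f\in L_0(0,\gamma)$ (Lebesgue measure $m$), $f^*(t)=\inf\{s\ge0: m(\{|f|>s\})\le t\}$. $M_\psi(0,\gamma)=\{f\in L_0(0,\gamma):\|f\|_{M_\psi}<\infty\}$ with $\|f\|_{M_\psi}=\sup_{0<t<\gamma}\frac{1}{\psi(t)}\int_0^t f^*(s)\,ds$. A Banach space $X$ is a Grothendieck space if every weak-$*$ convergent sequence in $X^*$ converges weakly. Condition (A): $\gamma=\infty$ and $\liminf_{t\downarrow0}\psi(2t)/\psi(t)>1$ and $\liminf_{t\to\infty}\psi(2t)/\psi(t)>1$. Condition (B): $\gamma<\infty$ and $\liminf_{t\downarrow0}\psi(2t)/\psi(t)>1$. *)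

(* Defs.v *)
From HB Require Import structures.
From mathcomp Require Import all_boot all_order all_algebra.
From mathcomp Require Import all_classical all_reals all_analysis.
Set Implicit Arguments. Unset Strict Implicit. Unset Printing Implicit Defensive.
Import Order.TTheory GRing.Theory Num.Theory.
Import numFieldNormedType.Exports.
Local Open Scope classical_set_scope.
Local Open Scope ring_scope.

Section Marcinkiewicz.
Variable R : realType.

Definition Ioo0 (gamma : \bar R) : set R := [set x | 0 < x /\ (x%:E < gamma)%E].

Definition distr_fun (gamma : \bar R) (f : R -> R) (s : R) : \bar R :=
  (@lebesgue_measure R) (Ioo0 gamma `&` [set x | s < `|f x|]).

(* decreasing rearrangement f^*(t) = inf{ s >= 0 : m(|f|>s) <= t } (in \bar R,
   equal to +oo when the set is empty) *)
Definition drearr (gamma : \bar R) (f : R -> R) (t : R) : \bar R :=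
  ereal_inf [set s%:E | s in [set s : R | 0 <= s /\ (distr_fun gamma f s <= t%:E)%E]].

Definition int_drearr (gamma : \bar R) (f : R -> R) (t : R) : \bar R := let I := `]0, t[%classic in
  (\int[@lebesgue_measure R]_(s in I) drearr gamma f s)%E.

Definition Mnorm_e (gamma : \bar R) (psi : R -> R) (f : R -> R) : \bar R :=
  ereal_sup [set ((psi t)^-1%:E * int_drearr gamma f t)%E | t in Ioo0 gamma].

Definition Mnorm (gamma : \bar R) (psi : R -> R) (f : R -> R) : R :=
  fine (Mnorm_e gamma psi f).

(* M_psi(0,gamma): (real-valued, hence a.e. finite) measurable functions on
   (0,gamma) with finite norm; values outside (0,gamma) are irrelevant. *)
Definition Mpsi (gamma : \bar R) (psi : R -> R) : set (R -> R) :=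
  [set f | measurable_fun (Ioo0 gamma) f /\ (Mnorm_e gamma psi f < +oo)%E].

(* Generic (semi)normed-space notions, for a subspace V of an lmodType T
   equipped with a seminorm nrm. *)
Definition dual_elem (T : lmodType R) (V : set T) (nrm : T -> R) (u : T -> R) :=
  (forall (a : R) (f g : T), V f -> V g -> u (a *: f + g) = a * u f + u g) /\
  exists C : R, forall f, V f -> `|u f| <= C * nrm f.

Definition dual_set (T : lmodType R) (V : set T) (nrm : T -> R) : set (T -> R) :=
  [set u | dual_elem V nrm u].

Definition dual_norm (T : lmodType R) (V : set T) (nrm : T -> R) (u : T -> R) : R :=
  sup [set `|u f| | f in [set f | V f /\ nrm f <= 1]].

Definition Grothendieck (T : lmodType R) (V : set T) (nrm : T -> R) : Prop :=
  forall (u : nat -> T -> R) (u0 : T -> R),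
    (forall n, dual_elem V nrm (u n)) -> dual_elem V nrm u0 ->
    (forall f, V f -> (fun n => u n f) @ \oo --> u0 f) ->
    forall Phi : (T -> R) -> R,
      dual_elem (dual_set V nrm) (dual_norm V nrm) Phi ->
      (fun n => Phi (u n)) @ \oo --> Phi u0.

End Marcinkiewicz.

(* Main.v *)
(** Sufficiency.  The conditions yield a constant A with 2 psi(t) <= psi(A t), and
    cutting functions at the levels A^k then exhibits M_psi as a quotient of an
    l^oo-sum of spaces L^1 /\ L^oo with rescaled norms.  If a sequence is weak-*
    null but not weakly null, Helly's theorem gives, after passing to a
    subsequence (v_j) and changing signs, points of a fixed ball at which
    v_0, ..., v_n are all at least e.  Gliding humps (Brooks-Jewett) show that all
    |v_j(F)| are small as soon as q_i(F) is small for finitely many i, where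
    q_i(F) is the sum of the suprema of v_i over {|H| <= F^2} and over the unit
    ball rescaled by the mean squares of the components of F.  The q_i satisfy the
    parallelogram inequality, so near-minimizers of their sum over the decreasing
    convex sets {v_0, ..., v_n >= e} differ by elements on which all v_j are small;
    this contradicts v_j(F) -> 0 at one of them.

    Necessity.  If a condition fails, M_psi contains a complemented copy of l^1:
    when psi(0+) > 0, resp. psi is bounded, it is spanned by normalized indicators
    of disjoint intervals; otherwise by series of blocks along a lacunary sequence
    of scales at which psi(m t) <= 2 psi(t) with m large, the coordinates being
    Banach limits of averages over the blocks.  In l^1 the partial sums of the
    coordinate functionals converge weak-* but not weakly. *)

Require Import Defs.
From HB Require Import structures.
From mathcomp Require Import all_boot all_order all_algebra.
From mathcomp Require Import all_classical all_reals all_analysis.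
From mathcomp Require Import ring lra measurable_realfun.
Set Implicit Arguments. Unset Strict Implicit. Unset Printing Implicit Defensive.
Import Order.TTheory GRing.Theory Num.Theory.
Import numFieldNormedType.Exports.
Local Open Scope classical_set_scope.
Local Open Scope ring_scope.

(** * Decreasing rearrangements *)

(** The obstacle is that the balls of the sum space are in general neither order intervals nor balls
    of a space C(K), so theorems on bounded finitely additive measures do not apply to them
    directly. Functions of a ball can be glued, within a ball of controlled radius, along unions of
    whole components, or inside one fixed set whose section in component n has measure at most a
    multiple of tau_n. The two suprema in q_i correspond to these two kinds of gluing, and
    Chebyshev's inequality for F^2 decides between them: either a component has a large mean square,
    or its large values occupy a small set. Small values of F are harmless because of dilation:
    lowering only the uniform bound of F by a factor eta replaces psi(t) by psi(eta t) in the
    estimate of its image. Squares make the control quadratic in F; the parallelogram law then does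
    for near-minimizers what weak compactness would do for nested convex sets. In the necessity part
    a single scale carries only a finite-dimensional l^1, with constants independent of the
    dimension; Banach limits put the scales together. *)

Section Rearrangement.
Variables (R : realType) (gamma : \bar R).
Local Notation mu := (@lebesgue_measure R).
Local Notation I := (Ioo0 gamma).
Implicit Types (f g : R -> R) (r s t y : R).

Lemma measurable_Ioo0 : measurable I.
Proof.
case: gamma => [r||].
- suff -> : Ioo0 r%:E = `]0, r[%classic by [].
  by apply/seteqP; split => x; rewrite /Ioo0/= in_itv/= lte_fin;
    [move=> [-> ->]|move=> /andP[]].
- suff -> : @Ioo0 R +oo%E = `]0, +oo[%classic by [].
  by apply/seteqP; split => x; rewrite /Ioo0/= in_itv/= andbT ltry; [move=> []|].
- suff -> : @Ioo0 R -oo%E = set0 by [].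
  by apply/seteqP; split => x //= [].
Qed.

Lemma integral_sectionC (X : set (R * R)) : measurable X ->
  (\int[mu]_x mu (xsection X x) = \int[mu]_y mu (ysection X y))%E.
Proof.
move=> mX; have := indic_fubini_tonelli mu mu mX.
by rewrite indic_fubini_tonelli_FE// indic_fubini_tonelli_GE.
Qed.

Lemma measurable_subgraph f : measurable_fun setT f ->
  measurable [set p : R * R | p.2 < f p.1].
Proof.
move=> mf; rewrite -[X in measurable X]setTI.
have := @measurable_fun_ltr _ _ _ setT (snd : R * R -> R) (f \o fst : R * R -> R).
move=> /(_ (@measurable_snd _ _ _ _)) /(_ (measurableT_comp mf measurable_fst)).
by move=> /(_ measurableT [set true]); apply.
Qed.

Lemma lebesgue_measure_itvoo (a b : R) : a <= b ->
  mu `]a, b[%classic = (b - a)%:E.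
Proof.
rewrite lebesgue_measure_itv/= lte_fin le_eqVlt => /predU1P[->|->].
  by rewrite ltxx subrr.
by rewrite EFinB.
Qed.

(** Tonelli for the region under the graph of f over D: vertical sections have length f x,
    horizontal ones are the superlevel sets. *)
Lemma layer_cake (D : set R) f : measurable D -> measurable_fun D f ->
  (forall x, D x -> 0 <= f x) ->
  (\int[mu]_(x in D) (f x)%:E =
   \int[mu]_(y in `]0%R, +oo[%classic) mu (D `&` [set x | y < f x]%R))%E.
Proof.
move=> mD mf f0.
pose fD := f \_ D.
have mfD : measurable_fun setT fD by apply/(measurable_restrictT _ mD).
have fD0 x : 0 <= fD x by rewrite /fD patchE; case: ifPn => // /set_mem /f0.
pose X := (setT `*` `]0, +oo[%classic) `&` [set p : R * R | p.2 < fD p.1].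
have mX : measurable X.
  by apply: measurableI; [exact: measurableX|exact: measurable_subgraph].
transitivity (\int[mu]_x mu (xsection X x))%E.
  rewrite integral_mkcond; apply: eq_integral => x _.
  have -> : ((fun x => (f x)%:E) \_ D) x = (fD x)%:E by rewrite /fD !patchE; case: ifP.
  rewrite (_ : xsection X x = `]0, fD x[%classic).
    by rewrite lebesgue_measure_itvoo// subr0.
  by apply/seteqP; split => y; rewrite /xsection/= inE/X/= !in_itv/= andbT;
    [move=> [[_ ->] ->]|move=> /andP[-> ->]].
rewrite integral_sectionC// [RHS]integral_mkcond; apply: eq_integral => y _.
rewrite patchE; case: ifPn => [|ny].
  rewrite inE/= in_itv/= andbT => y0; congr (mu _).
  apply/seteqP; split => x; rewrite /ysection/= inE/X/= !in_itv/= andbT.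
    move=> [_]; rewrite /fD patchE; case: ifPn => [/set_mem //|_].
    by move/(lt_trans y0); rewrite ltxx.
  by move=> [Dx yf]; split => //; rewrite /fD patchE mem_set.
rewrite (_ : ysection _ _ = set0) ?measure0//.
apply/seteqP; split => x //; rewrite /ysection/= inE/X/= => -[[_ Hy] _].
by move/negP: ny; apply; rewrite inE.
Qed.

Lemma distr_fun_ge0 f y : (0 <= distr_fun gamma f y)%E.
Proof. exact: measure_ge0. Qed.

Lemma measurable_level f y : measurable_fun I f ->
  measurable (I `&` [set x | y < `|f x|]).
Proof.
move=> mf.
have mf' : measurable_fun I (fun x => `|f x|) by exact: measurableT_comp.
have := @measurable_fun_ltr _ _ _ I (cst y) _ (@measurable_cst _ _ _ _ _ _) mf'.
by move=> /(_ measurable_Ioo0 [set true]); apply.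
Qed.

Lemma distr_fun_le f y z : measurable_fun I f -> y <= z ->
  (distr_fun gamma f z <= distr_fun gamma f y)%E.
Proof.
move=> mf yz; apply: le_measure; rewrite ?inE//; try exact: measurable_level.
by move=> x /= [? ?]; split => //; apply: le_lt_trans yz _.
Qed.

Lemma measurable_measure_level (D : set R) g : measurable D -> measurable_fun D g ->
  measurable_fun setT (fun y => mu (D `&` [set x | y < g x])).
Proof.
move=> mD mg.
pose X := (D `*` setT) `&` [set p : R * R | p.2 < (g \_ D) p.1].
have mX : measurable X.
  apply: measurableI; first exact: measurableX.
  by apply: measurable_subgraph; apply/(measurable_restrictT _ mD).
have := measurable_fun_ysection mu mX; congr (measurable_fun _ _).
apply/funext => y /=; congr (mu _).
apply/seteqP; split => x; rewrite /ysection/= inE/X/= patchE.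
  by move=> [[Dx _]]; rewrite mem_set.
by move=> [Dx ?]; split => //; rewrite mem_set.
Qed.

Lemma measurable_distr_fun f : measurable_fun I f ->
  measurable_fun setT (distr_fun gamma f).
Proof.
move=> mf; apply: measurable_measure_level; first exact: measurable_Ioo0.
exact: measurableT_comp.
Qed.

Lemma drearr_ge0 f t : (0 <= drearr gamma f t)%E.
Proof. by apply: le_ereal_inf_tmp => _ /= [s [s0 _] <-]; rewrite lee_fin. Qed.

(** The distribution function is nonincreasing, so the set measured on the left is an interval
    starting at 0, and the infimum defining f^* is its length. Measurability of f^* and the Tonelli
    arguments rest on this form. *)
Lemma drearrE f r : measurable_fun I f ->
  mu [set y | 0 < y /\ (r%:E < distr_fun gamma f y)%E] = drearr gamma f r.
Proof.
move=> mf.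
set S := [set y | _ /\ _].
have mS : measurable S.
  rewrite (_ : S = `]0, +oo[%classic `&` [set y | (r%:E < distr_fun gamma f y)%E]).
    apply: emeasurable_fun_o_infty => //.
    exact: measurable_funTS (measurable_distr_fun mf).
  by apply/seteqP; split => y; rewrite /S/= in_itv/= andbT.
apply/eqP; rewrite eq_le; apply/andP; split.
  apply: le_ereal_inf_tmp => _ /= [s [s0 ds] <-].
  rewrite -[s]subr0 -lebesgue_measure_itvoo//.
  apply: le_measure; rewrite ?inE// => y [y0 dy] /=; rewrite in_itv/= y0/=.
  rewrite ltNge; apply/negP => sy.
  by have := le_lt_trans (le_trans (distr_fun_le mf sy) ds) dy; rewrite ltxx.
have key (s : R) : (s%:E < drearr gamma f r)%E -> (s%:E <= mu S)%E.
  move=> sd; have [s0|s0] := leP s 0.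
    by apply: (@le_trans _ _ 0%E); [rewrite lee_fin|exact: measure_ge0].
  rewrite -[s]subr0 -lebesgue_measure_itvoo; last exact: ltW.
  apply: le_measure; rewrite ?inE// => y /=; rewrite in_itv/= => /andP[y0 ys].
  split => //; rewrite ltNge; apply/negP => dy.
  have : (drearr gamma f r <= y%:E)%E.
    by apply: ereal_inf_lbound; exists y => //=; split => //; exact: ltW.
  by move=> /(lt_le_trans sd); rewrite lte_fin => /(lt_trans ys); rewrite ltxx.
move: (drearr_ge0 f r) key; case: (drearr gamma f r) => [d| |] // d0 key.
  apply/lee_addgt0Pr => e e0.
  have := key (d - e); rewrite lte_fin => /(_ _)/leeD2r-/(_ e%:E).
  by rewrite -EFinD subrK; apply; rewrite ltrBlDr ltrDl.
have : forall s : R, (s%:E <= mu S)%E by move=> s; apply: key; rewrite ltry.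
case: (mu S) => [m|//|] H; last by have := H 0.
by have := H (m + 1); rewrite lee_fin leNgt ltrDl ltr01.
Qed.

(** Tonelli on the region r < distr_fun y, whose section at a fixed r has length f^*(r) by
    [drearrE]. The maximum with 0 covers negative t, for which the interval of integration is
    empty. *)
Lemma int_drearrE f t : measurable_fun I f ->
  (int_drearr gamma f t =
   \int[mu]_(y in `]0%R, +oo[%classic) Order.min (Num.max t 0)%:E (distr_fun gamma f y))%E.
Proof.
move=> mf.
pose X := (`]0, t[%classic `*` `]0, +oo[%classic) `&`
  [set p : R * R | (p.1%:E < distr_fun gamma f p.2)%E].
have mX : measurable X.
  apply: measurable_lte; first exact: measurableX.
    by apply: measurable_funTS; apply/measurable_EFinP; exact: measurable_fst.
  apply: measurable_funTS.
  exact: (measurableT_comp (measurable_distr_fun mf) measurable_snd).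
transitivity (\int[mu]_x mu (xsection X x))%E.
  rewrite /int_drearr integral_mkcond; apply: eq_integral => r _.
  rewrite patchE; case: ifPn => [|nr].
    rewrite inE/= => rt; rewrite -drearrE//; congr (mu _).
    by apply/seteqP; split => y; rewrite /xsection/= inE/X/= !in_itv/= andbT;
      [move=> [y0 ?]; split => // ;split |move=> [[_ ?] ?]].
  rewrite (_ : xsection _ _ = set0) ?measure0//.
  apply/seteqP; split => x //; rewrite /xsection/= inE/X/= => -[[Hy _] _].
  by move/negP: nr; apply; rewrite inE.
rewrite integral_sectionC// [RHS]integral_mkcond; apply: eq_integral => y _.
rewrite patchE; case: ifPn => [|ny]; last first.
  rewrite (_ : ysection _ _ = set0) ?measure0//.
  apply/seteqP; split => x //; rewrite /ysection/= inE/X/= => -[[_ Hy] _].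
  by move/negP: ny; apply; rewrite inE.
rewrite inE/= => y0.
have -> : ysection X y =
    [set r | 0 < r /\ r < t /\ (r%:E < distr_fun gamma f y)%E].
  apply/seteqP; split => r; rewrite /ysection/= inE/X/= !in_itv/= andbT.
    by move=> [[/andP[-> ->]]].
  by move=> [-> [-> ?]]; move: y0; rewrite in_itv/= andbT.
have := distr_fun_ge0 f y; case: (distr_fun gamma f y) => [d||//] d0.
- rewrite -EFin_min.
  rewrite (_ : [set _ | _] = `]0, Num.min (Num.max t 0) d[%classic).
    rewrite lebesgue_measure_itvoo ?subr0// le_min le_max lexx orbT.
    by rewrite -lee_fin.
  apply/seteqP; split => r /=; rewrite in_itv/= lte_fin lt_min lt_max.
    by move=> [r0 [-> ->]]; rewrite r0.
  by move=> /andP[r0 /andP[/orP[->|/(lt_trans r0)]]]; rewrite ?ltxx.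
- rewrite (_ : Order.min _ +oo%E = (Num.max t 0)%:E); last first.
    by apply/min_idPl; rewrite leey.
  rewrite (_ : [set _ | _] = `]0, Num.max t 0[%classic).
    by rewrite lebesgue_measure_itvoo ?subr0// le_max lexx orbT.
  apply/seteqP; split => r /=; rewrite in_itv/= ltry lt_max.
    by move=> [r0 [-> _]]; rewrite r0.
  by move=> /andP[r0 /orP[->|/(lt_trans r0)]]; rewrite ?ltxx.
Qed.

Lemma measurable_min_distr f (c : \bar R) : measurable_fun I f ->
  measurable_fun (`]0, +oo[%classic : set R) (fun y => Order.min c (distr_fun gamma f y)).
Proof.
move=> mf; apply: measurable_funTS; apply: measurable_mine => //.
exact: measurable_distr_fun.
Qed.

(** By the layer cake formula both sides are integrals over levels y, and a superlevel set within A
    has measure at most t and at most that of the full superlevel set. *)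
Lemma hardy_littlewood (A : set R) f t : measurable_fun I f -> measurable A ->
  A `<=` I -> 0 <= t -> (mu A <= t%:E)%E ->
  (\int[mu]_(x in A) `|f x|%:E <= int_drearr gamma f t)%E.
Proof.
move=> mf mA AI t0 At.
have mfA : measurable_fun A (fun x => `|f x|).
  by apply: measurableT_comp => //; apply: measurable_funS AI mf; exact: measurable_Ioo0.
rewrite layer_cake// int_drearrE// (max_idPl _)//.
apply: ge0_le_integral => //.
- by apply: measurable_funTS; exact: measurable_measure_level.
- exact: measurable_min_distr.
move=> y _; have mAy : measurable (A `&` [set x | y < `|f x|]).
  have := @measurable_fun_ltr _ _ _ A (cst y) _ (@measurable_cst _ _ _ _ _ _) mfA.
  by move=> /(_ mA [set true]); apply.
rewrite le_min; apply/andP; split.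
  by apply: le_trans At; apply: le_measure; rewrite ?inE//; exact: subIsetl.
apply: le_measure; rewrite ?inE//; first exact: measurable_level.
by apply: setSI.
Qed.

Lemma int_drearr_le_integral f t : measurable_fun I f ->
  (int_drearr gamma f t <= \int[mu]_(x in I) `|f x|%:E)%E.
Proof.
move=> mf; have mf' : measurable_fun I (fun x => `|f x|) by exact: measurableT_comp.
rewrite layer_cake//; last exact: measurable_Ioo0.
rewrite int_drearrE//; apply: ge0_le_integral => //.
- by move=> y _; rewrite le_min distr_fun_ge0 lee_fin le_max lexx orbT.
- exact: measurable_min_distr.
- exact: measurable_funTS (measurable_distr_fun mf).
- by move=> y _; rewrite ge_min lexx orbT.
Qed.

Lemma measurable_drearr f : measurable_fun I f ->
  measurable_fun (`]0, +oo[%classic : set R) (drearr gamma f).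
Proof.
move=> mf.
pose X := (setT `*` `]0, +oo[%classic) `&`
  [set p : R * R | (p.1%:E < distr_fun gamma f p.2)%E].
have mX : measurable X.
  apply: measurable_lte; first exact: measurableX.
    by apply: measurable_funTS; apply/measurable_EFinP; exact: measurable_fst.
  apply: measurable_funTS.
  exact: (measurableT_comp (measurable_distr_fun mf) measurable_snd).
apply: measurable_funTS; have := measurable_fun_xsection mu mX.
congr (measurable_fun _ _); apply/funext => r /=; rewrite -drearrE//; congr (mu _).
by apply/seteqP; split => y; rewrite /xsection/= inE/X/= !in_itv/= andbT;
  [move=> [[_ ?] ?]|move=> [y0 ?]; split].
Qed.

(** From |f| <= |g| + s follows f^* <= g^* + s; integrating gives the easy half of the formula for
    the K-functional of L^1 and L^oo. Upper bounds of norms come from such splittings. *)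
Lemma int_drearr_le f g s t : measurable_fun I f -> measurable_fun I g ->
  0 <= s -> 0 <= t -> (forall x, I x -> `|f x| <= `|g x| + s) ->
  (int_drearr gamma f t <= \int[mu]_(x in I) `|g x|%:E + (t * s)%:E)%E.
Proof.
move=> mf mg s0 t0 fg.
apply: (@le_trans _ _ (int_drearr gamma g t + (t * s)%:E)%E); last first.
  exact: leeD2r (int_drearr_le_integral _ mg).
have sub : `]0, t[ `<=` `]0, +oo[%classic.
  by move=> x /=; rewrite !in_itv/= andbT => /andP[].
have mdf : measurable_fun (`]0, t[%classic : set R) (drearr gamma f).
  exact: measurable_funS sub (measurable_drearr mf).
have mdg : measurable_fun (`]0, t[%classic : set R) (drearr gamma g).
  exact: measurable_funS sub (measurable_drearr mg).
have -> : (t * s)%:E = (\int[mu]_(x in `]0%R, t[%classic) cst s%:E x)%E.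
  by rewrite integral_cst//= lebesgue_measure_itvoo// subr0 -EFinM mulrC.
rewrite /int_drearr -ge0_integralD//=; first last.
- by move=> x _; exact: drearr_ge0.
apply: ge0_le_integral => //.
- by move=> x _; exact: drearr_ge0.
- exact: emeasurable_funD.
move=> r _ /=; rewrite -leeBlDr//; apply: le_ereal_inf_tmp => _ /= [y [y0 dy] <-].
rewrite EFinN leeBlDr//; apply: ereal_inf_lbound; exists (y + s) => //=.
split; first by rewrite addr_ge0.
apply: le_trans dy; apply: le_measure; rewrite ?inE//; try exact: measurable_level.
move=> x /= [Ix H]; split => //; rewrite -(ltrD2r s).
by apply: lt_le_trans H _; exact: fg.
Qed.

Lemma distr_fun_ae f g (N : set R) : measurable_fun I f -> measurable_fun I g ->
  measurable N -> mu N = 0%E -> (forall x, I x -> ~ N x -> f x = g x) ->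
  distr_fun gamma f =1 distr_fun gamma g.
Proof.
move=> mf mg mN N0.
wlog suff H : f g mf mg / (forall x, I x -> ~ N x -> f x = g x) ->
    forall y, (distr_fun gamma f y <= distr_fun gamma g y)%E.
  move=> fg y; apply/eqP; rewrite eq_le; apply/andP; split; apply: H => //.
  by move=> x Ix Nx; rewrite fg.
move=> fg y.
rewrite -[leRHS]adde0 -N0.
apply: le_trans (measureU2 mu (measurable_level y mg) mN).
apply: le_measure; rewrite ?inE//.
- exact: measurable_level.
- by apply: measurableU => //; exact: measurable_level.
move=> x /= [Ix yf]; have [Nx|nNx] := pselect (N x); [by right|left].
by split => //; rewrite -fg.
Qed.

Lemma Mnorm_e_ae psi f g (N : set R) : measurable_fun I f -> measurable_fun I g ->
  measurable N -> mu N = 0%E -> (forall x, I x -> ~ N x -> f x = g x) ->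
  Mnorm_e gamma psi f = Mnorm_e gamma psi g.
Proof.
move=> mf mg mN N0 fg; have D := distr_fun_ae mf mg mN N0 fg.
have E t : drearr gamma f t = drearr gamma g t.
  rewrite /drearr (_ : [set s | _] = [set s | 0 <= s /\ (distr_fun gamma g s <= t%:E)%E])//.
  by apply/seteqP; split => s /=; rewrite D.
have {}E t : int_drearr gamma f t = int_drearr gamma g t.
  by apply: eq_integral => x _; rewrite E.
by apply: (congr1 (@ereal_sup R)); apply: eq_imagel => t _; rewrite E.
Qed.

End Rearrangement.

Lemma nneseries_lty_cvg (R : realType) (u : nat -> R) : (forall n, 0 <= u n) ->
  (\sum_(0 <= n <oo) (u n)%:E < +oo)%E ->
  cvgn (series u) /\ (limn (series u))%:E = (\sum_(0 <= n <oo) (u n)%:E)%E.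
Proof.
move=> u0 uy.
have cu : cvgn (series u).
  apply: nondecreasing_is_cvgn.
    apply/nondecreasing_seqP => n; rewrite /series/= big_nat_recr//=.
    by rewrite lerDl.
  exists (fine (\sum_(0 <= n <oo) (u n)%:E)%E) => _ [n _ <-].
  rewrite -lee_fin fineK; last first.
    by rewrite ge0_fin_numE// nneseries_ge0// => n0 _ _; rewrite lee_fin.
  rewrite /series/= -sumEFin; apply: nneseries_lim_ge => k _ _.
  by rewrite lee_fin.
split=> //; rewrite -EFin_lim//; congr (limn _); apply/funext => n /=.
by rewrite /series/= sumEFin.
Qed.

Lemma nneseries_le (R : realType) (u : nat -> \bar R) (b : \bar R) :
  (forall n, 0 <= u n)%E -> (forall M, \sum_(0 <= n < M) u n <= b)%E ->
  (\sum_(0 <= n <oo) u n <= b)%E.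
Proof.
move=> u0 ub; apply: lime_le; last by near=> n; exact: ub.
by apply: is_cvg_nneseries => n _ _; exact: u0.
Unshelve. all: by end_near. Qed.

(** * The sum space and its quotient map *)

Section SeriesSpace.
Variables (R : realType) (gamma : \bar R) (w : nat -> R) (tau : nat -> \bar R).
Hypotheses (w0 : forall n, 0 <= w n) (tau0 : forall n, (0 <= tau n)%E).
Local Notation mu := (@lebesgue_measure R).
Local Notation I := (Ioo0 gamma).
Local Notation X := (nat * R)%type.
Implicit Types (F H : X -> R) (e c t : R).

(** Ball of an l^oo-sum of spaces L^1 /\ L^oo, with the L^1-norm of component n measured in units of
    [tau n]. Two radii are kept because shrinking the uniform one alone makes the image under [Qs]
    small once psi has the dilation property. *)
Definition Bset e c : set (X -> R) := [set F : X -> R | forall n : nat,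
  [/\ measurable_fun I (fun x => F (n, x)),
      (forall x, I x -> `|F (n, x)| <= e) &
      (\int[mu]_(x in I) `|F (n, x)|%:E <= c%:E * tau n)%E]].

Definition absum F (x : R) : \bar R :=
  (\sum_(0 <= n <oo) (w n * `|F (n, x)|)%:E)%E.

(* The value 0 is taken where the series does not converge absolutely. *)
Definition Qs F (x : R) : R :=
  if (absum F x < +oo)%E then limn (series (fun n => w n * F (n, x))) else 0.

Lemma absum_ge0 F x : (0 <= absum F x)%E.
Proof. by apply: nneseries_ge0 => n _ _; rewrite lee_fin mulr_ge0. Qed.

Lemma absum_cvg F x : (absum F x < +oo)%E ->
  cvgn (series (fun n => w n * F (n, x))) /\
  (`|limn (series (fun n => w n * F (n, x)))|%:E <= absum F x)%E.
Proof.
move=> /[dup] Fx; rewrite /absum => /nneseries_lty_cvg[n|c1 c2].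
  by rewrite mulr_ge0.
have E : [normed series (fun n => w n * F (n, x))] =
    series (fun n => w n * `|F (n, x)|).
  apply/funext => n; apply: eq_bigr => k _ /=.
  by rewrite normrM (ger0_norm (w0 _)).
have cn : cvgn [normed series (fun n => w n * F (n, x))] by rewrite E.
split; first exact: normed_cvg.
by rewrite -c2 lee_fin -E lim_series_norm.
Qed.

Lemma Qs_le F x : (`|Qs F x|%:E <= absum F x)%E.
Proof.
rewrite /Qs; case: ifPn => [/absum_cvg[]//|_].
by rewrite normr0; exact: absum_ge0.
Qed.

Lemma measurable_abs F n (D : set R) : measurable_fun D (fun x => F (n, x)) ->
  measurable_fun D (fun x => `|F (n, x)|).
Proof. by move=> mF; exact: measurableT_comp. Qed.

Lemma measurable_absum F (P : pred nat) :
  (forall n, measurable_fun I (fun x => F (n, x))) ->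
  measurable_fun I (fun x => \sum_(0 <= n <oo | n \in P) (w n * `|F (n, x)|)%:E)%E.
Proof.
move=> mF; apply: ge0_emeasurable_sum => [k x _ _|k _].
  by rewrite lee_fin mulr_ge0.
apply/measurable_EFinP; apply: measurable_funM => //.
exact: (measurable_abs (F := F)).
Qed.

Lemma measurable_Qs F : (forall n, measurable_fun I (fun x => F (n, x))) ->
  measurable_fun I (Qs F).
Proof.
move=> mF.
have mT : measurable_fun I (absum F) by exact: (@measurable_absum F predT).
pose N := I `&` [set x | (absum F x < +oo)%E].
have mN : measurable N.
  by apply: emeasurable_fun_infty_o => //; exact: measurable_Ioo0.
(* Multiplying by the indicator of the convergence set makes the partial sums converge to the
   default value 0 elsewhere. *)
apply: (@measurable_fun_cvg _ _ _ _
  (fun n x => (\sum_(0 <= k < n) w k * F (k, x)) * \1_N x)).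
  move=> n; apply: measurable_funM; last exact: measurable_indic.
  by apply: measurable_sum => k; apply: measurable_funM.
move=> x Ix; rewrite /Qs indicE; case: ifPn => Tx.
  rewrite mem_set// mulr1n.
  have [cF _] := absum_cvg Tx.
  by under eq_fun do rewrite mulr1.
rewrite memNset; last by case=> _ /=; move: Tx => /negP.
by under eq_fun do rewrite mulr0; exact: cvg_cst.
Qed.

Lemma integral_weight F n : measurable_fun I (fun x => F (n, x)) ->
  (\int[mu]_(x in I) (w n * `|F (n, x)|)%:E =
   (w n)%:E * \int[mu]_(x in I) `|F (n, x)|%:E)%E.
Proof.
move=> mF; under eq_integral do rewrite EFinM.
rewrite ge0_integralZl//; first exact: measurable_Ioo0.
  by apply/measurable_EFinP; exact: (measurable_abs (F := F)).
by rewrite lee_fin.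
Qed.

(** For a component with radii e and c, the integral of the rearrangement over (0,t) is at most
    min(e t, c tau_n); this sum is the resulting bound for the weighted series. *)
Definition wsum e c t : \bar R :=
  (\sum_(0 <= n <oo) (w n)%:E * Order.min (e * t)%:E (c%:E * tau n))%E.

(* Splits the series: the terms with [e t <= c tau_n] are bounded functions, the
   sum of the others is integrable. *)
Lemma split_absum F e c t : Bset e c F -> 0 <= e -> 0 <= c -> 0 < t ->
  (wsum e c t < +oo)%E ->
  exists g : R -> \bar R, exists s : R,
    [/\ 0 <= s, measurable_fun I g, (forall x, 0 <= g x <= absum F x)%E,
        (forall x, I x -> absum F x <= g x + s%:E)%E &
        (\int[mu]_(x in I) g x + (t * s)%:E <= wsum e c t)%E].
Proof.
move=> BF e0 c0 t0 Wy.
pose P : pred nat := fun n => (c%:E * tau n < (e * t)%:E)%E.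
pose g x := (\sum_(0 <= n <oo | n \in P) (w n * `|F (n, x)|)%:E)%E.
have wc0 n : (0 <= (w n)%:E * Order.min (e * t)%:E (c%:E * tau n))%E.
  rewrite mule_ge0 ?lee_fin// le_min lee_fin mulr_ge0 ?(ltW t0)//=.
  by rewrite mule_ge0 ?lee_fin.
have split_sum (h : nat -> \bar R) : (forall n, 0 <= h n)%E ->
   (\sum_(0 <= n <oo) h n = \sum_(0 <= n <oo | n \in P) h n +
    \sum_(0 <= n <oo | n \notin P) h n)%E.
  move=> h0; rewrite [in X in (_ = X + _)%E]eseries_mkcond.
  rewrite [in X in (_ = _ + X)%E]eseries_mkcond -nneseriesD.
  - by apply: eq_eseriesr => n _; case: ifP; rewrite ?adde0 ?add0e.
  - by move=> i _ _; case: ifP.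
  - by move=> i _ _; case: ifP.
have WE : wsum e c t = (\sum_(0 <= n <oo | n \in P) (w n)%:E * (c%:E * tau n) +
    t%:E * \sum_(0 <= n <oo | n \notin P) (w n * e)%:E)%E.
  rewrite /wsum split_sum//; congr (_ + _)%E.
    by apply: eq_eseriesr => n nP; congr (_ * _)%E; apply/min_idPr; exact: ltW.
  rewrite -nneseriesZl.
    apply: eq_eseriesr => n nP; rewrite (_ : Order.min _ _ = (e * t)%:E).
      by rewrite -!EFinM mulrA mulrC.
    by apply/min_idPl; rewrite leNgt.
  by move=> i _; rewrite lee_fin mulr_ge0.
have sF : (\sum_(0 <= n <oo | n \notin P) (w n * e)%:E)%E \is a fin_num.
  rewrite ge0_fin_numE; last by apply: nneseries_ge0 => i _ _; rewrite lee_fin mulr_ge0.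
  rewrite ltNge leye_eq; apply/negP => /eqP E.
  move: Wy; rewrite WE E gt0_muley ?lte_fin// addey// -ltNye.
  rewrite (lt_le_trans (ltNyr 0))//; apply: nneseries_ge0 => i _ _.
  by rewrite mule_ge0 ?lee_fin// mule_ge0// lee_fin.
exists g; exists (fine (\sum_(0 <= n <oo | n \notin P) (w n * e)%:E)%E).
have mF n : measurable_fun I (fun x => F (n, x)) by case: (BF n).
split.
- by apply: fine_ge0; apply: nneseries_ge0 => i _ _; rewrite lee_fin mulr_ge0.
- exact: measurable_absum.
- move=> x; apply/andP; split.
    by apply: nneseries_ge0 => i _ _; rewrite lee_fin mulr_ge0.
  rewrite /absum split_sum; last by move=> n; rewrite lee_fin mulr_ge0.
  by rewrite leeDl// nneseries_ge0// => i _ _; rewrite lee_fin mulr_ge0.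
- move=> x Ix; rewrite fineK// /absum split_sum.
    apply: leeD2l; apply: lee_nneseries => [i _ _|i _].
      by rewrite lee_fin mulr_ge0.
    by rewrite lee_fin ler_wpM2l//; case: (BF i) => _ + _; apply.
  by move=> n; rewrite lee_fin mulr_ge0.
rewrite EFinM fineK// WE leeD2r//.
rewrite /g (_ : (fun x => _) = fun x => (\sum_(0 <= n <oo)
   (if n \in P then (w n * `|F (n, x)|)%:E else 0))%E); last first.
  by apply/funext => x; rewrite eseries_mkcond.
rewrite integral_nneseries.
- rewrite [leRHS]eseries_mkcond; apply: lee_nneseries => n _.
    by move=> _; apply: integral_ge0 => x _; case: ifP => // _; rewrite lee_fin mulr_ge0.
  case: ifPn => nP; last by rewrite integral0.
  rewrite integral_weight//; apply: lee_wpmul2l; first by rewrite lee_fin.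
  by case: (BF n).
- exact: measurable_Ioo0.
- move=> n; case: (n \in P) => //; apply/measurable_EFinP; apply: measurable_funM => //.
  exact: (measurable_abs (F := F)).
- by move=> n x _; case: ifP => // _; rewrite lee_fin mulr_ge0.
Qed.

(** The majorant g + s of [split_absum] is an integrable function plus a constant, which is what
    [int_drearr_le] accepts. *)
Lemma int_drearr_Qs F e c t : Bset e c F -> 0 <= e -> 0 <= c -> 0 < t ->
  (int_drearr gamma (Qs F) t <= wsum e c t)%E.
Proof.
move=> BF e0 c0 t0.
have [Wy|] := ltP (wsum e c t) +oo%E; last by rewrite leye_eq => /eqP ->; rewrite leey.
have [g [s [s0 mg g0 Tg Ig]]] := split_absum BF e0 c0 t0 Wy.
apply: le_trans Ig.
have mF n : measurable_fun I (fun x => F (n, x)) by case: (BF n).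
have mQ := measurable_Qs mF.
pose g' x := fine (g x).
have mg' : measurable_fun I g' by exact: measurableT_comp mg.
apply: (le_trans (int_drearr_le (g := g') (s := s) mQ mg' s0 (ltW t0) _)).
  move=> x Ix; rewrite /Qs; case: ifPn => [Tx|_]; last by rewrite normr0 addr_ge0.
  have [_ H] := absum_cvg Tx.
  have /andP[gx0 gT] := g0 x.
  rewrite [X in _ <= X + _]ger0_norm ?fine_ge0// -lee_fin EFinD fineK.
    by apply: le_trans H _; exact: Tg.
  by rewrite ge0_fin_numE//; exact: le_lt_trans Tx.
apply: leeD2r; apply: ge0_le_integral => //; first exact: measurable_Ioo0.
- by apply/measurable_EFinP; exact: measurableT_comp.
- move=> x _; have /andP[gx0 _] := g0 x.
  rewrite /g'; case: (g x) gx0 => [r||]//; first by rewrite !lee_fin => r0; rewrite ger0_norm.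
  by rewrite /= normr0 leey.
Qed.

(** The integrable part g of the majorant is finite almost everywhere, and the series exceeds it by
    at most a constant. *)
Lemma absum_ae F e c t : Bset e c F -> 0 <= e -> 0 <= c -> 0 < t ->
  (wsum e c t < +oo)%E ->
  exists N : set R, [/\ measurable N, mu N = 0%E &
    forall x, I x -> ~ N x -> (absum F x < +oo)%E].
Proof.
move=> BF e0 c0 t0 Wy.
have [g [s [s0 mg g0 Tg Ig]]] := split_absum BF e0 c0 t0 Wy.
have ig : mu.-integrable I g.
  apply/integrableP; split => //.
  have -> : (\int[mu]_(x in I) `|g x| = \int[mu]_(x in I) g x)%E.
    by apply: eq_integral => x _; rewrite gee0_abs//; have /andP[] := g0 x.
  apply: le_lt_trans Wy; apply: le_trans Ig; rewrite leeDl// lee_fin.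
  by rewrite mulr_ge0// ltW.
have := @integrable_ae _ _ _ mu I (measurable_Ioo0 gamma) g ig => -[N [mN N0 sN]].
exists N; split => // x Ix Nx.
have : g x \is a fin_num.
  by apply: contrapT => gx; apply: Nx; apply: sN => /(_ Ix).
have /andP[gx0 _] := g0 x.
rewrite ge0_fin_numE// => gy; apply: le_lt_trans (Tg _ Ix) _.
by rewrite lte_add_pinfty// ltry.
Qed.

Lemma absum_lin F H a x : (absum F x < +oo)%E -> (absum H x < +oo)%E ->
  (absum (a *: F + H)%R x < +oo)%E.
Proof.
move=> Fx Hx.
apply: (@le_lt_trans _ _ (`|a|%:E * absum F x + absum H x)%E); last first.
  by rewrite lte_add_pinfty// lte_mul_pinfty// lee_fin.
rewrite /absum -nneseriesZl; last by move=> n _; rewrite lee_fin mulr_ge0.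
rewrite -nneseriesD; first last.
- by move=> n _ _; rewrite lee_fin mulr_ge0.
- by move=> n _ _; rewrite mule_ge0 ?lee_fin ?mulr_ge0.
apply: lee_nneseries => [n _ _|n _]; first by rewrite lee_fin mulr_ge0.
rewrite -EFinM -EFinD lee_fin mulrCA -mulrDr ler_wpM2l//.
by apply: le_trans (ler_normD _ _) _; rewrite normrM.
Qed.

Lemma Qs_lin F H a x : (absum F x < +oo)%E -> (absum H x < +oo)%E ->
  Qs (a *: F + H) x = a * Qs F x + Qs H x.
Proof.
move=> Fx Hx; rewrite /Qs absum_lin// Fx Hx.
have [cF _] := absum_cvg Fx; have [cH _] := absum_cvg Hx.
apply/cvg_lim => //.
rewrite (_ : series _ = fun n => a * series (fun n => w n * F (n, x)) n +
    series (fun n => w n * H (n, x)) n).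
  by apply: cvgD => //; apply: cvgMr.
apply/funext => n; rewrite /series/= mulr_sumr -big_split/=.
by apply: eq_bigr => k _; rewrite mulrDr mulrCA.
Qed.

Lemma BsetW e c e' c' : e <= e' -> c <= c' -> Bset e c `<=` Bset e' c'.
Proof.
move=> ee cc F BF n; have [mF Fe Fc] := BF n; split => //.
  by move=> x Ix; apply: le_trans (Fe _ Ix) ee.
by apply: le_trans Fc _; apply: lee_wpmul2r => //; rewrite lee_fin.
Qed.

Lemma BsetZ a e c F : Bset e c F -> Bset (`|a| * e) (`|a| * c) (a *: F).
Proof.
move=> BF n; have [mF Fe Fc] := BF n; split.
- exact: (@measurable_funM _ _ _ _ (cst a)).
- by move=> x Ix; rewrite normrM ler_wpM2l// Fe.
- under eq_integral do rewrite normrM EFinM.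
  rewrite ge0_integralZl//.
  + by rewrite EFinM -muleA lee_wpmul2l// lee_fin.
  + exact: measurable_Ioo0.
  + by apply/measurable_EFinP; exact: (measurable_abs (F := F)).
Qed.

Lemma BsetD e c e' c' F H : 0 <= c -> 0 <= c' -> Bset e c F -> Bset e' c' H ->
  Bset (e + e') (c + c') (F + H).
Proof.
move=> c0 c0' BF BH n; have [mF Fe Fc] := BF n; have [mH He Hc] := BH n; split.
- exact: measurable_funD.
- by move=> x Ix; apply: le_trans (ler_normD _ _) _; rewrite lerD ?Fe ?He.
have maF := measurable_abs mF; have maH := measurable_abs mH.
apply: (@le_trans _ _ (\int[mu]_(x in I) (`|F (n, x)|%:E + `|H (n, x)|%:E))%E).
  apply: ge0_le_integral => //; first exact: measurable_Ioo0.
  - by apply/measurable_EFinP; exact: (measurable_abs (F := F + H)) (measurable_funD mF mH).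
  - by apply: emeasurable_funD; apply/measurable_EFinP.
  - by move=> x _; rewrite -EFinD lee_fin ler_normD.
rewrite ge0_integralD//; first by rewrite EFinD ge0_muleDl ?lee_fin// leeD.
- exact: measurable_Ioo0.
- exact/measurable_EFinP.
- exact/measurable_EFinP.
Qed.

End SeriesSpace.

(** * Norm bounds in M_psi and functionals along the quotient map *)

Section MpsiBasics.
Variables (R : realType) (gamma : \bar R) (psi : R -> R).
Local Notation mu := (@lebesgue_measure R).
Local Notation I := (Ioo0 gamma).
Local Notation V := (Mpsi gamma psi).
Local Notation nrm := (Mnorm gamma psi).
Implicit Types (f g : R -> R) (r t : R).
Hypotheses (psi_gt0 : forall t, I t -> 0 < psi t) (I0 : I !=set0).

Lemma int_drearr_ge0 f t : (0 <= int_drearr gamma f t)%E.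
Proof. by apply: integral_ge0 => x _; exact: drearr_ge0. Qed.

Lemma Mnorm_e_ge0 f : (0 <= Mnorm_e gamma psi f)%E.
Proof.
have [t It] := I0; apply: (@le_trans _ _ ((psi t)^-1%:E * int_drearr gamma f t)%E).
  by rewrite mule_ge0 ?int_drearr_ge0// lee_fin invr_ge0 ltW// psi_gt0.
by apply: ereal_sup_ubound; exists t.
Qed.

Lemma Mnorm_ge0 f : 0 <= nrm f.
Proof. by rewrite fine_ge0// Mnorm_e_ge0. Qed.

Lemma MnormE f : V f -> Mnorm_e gamma psi f = (nrm f)%:E.
Proof. by move=> [_ fy]; rewrite /Mnorm fineK// ge0_fin_numE// Mnorm_e_ge0. Qed.

Lemma Mnorm_e_le f r :
  (forall t, I t -> int_drearr gamma f t <= (r * psi t)%:E)%E ->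
  (Mnorm_e gamma psi f <= r%:E)%E.
Proof.
move=> H; apply: ge_ereal_sup => _ [t It <-].
rewrite muleC -[leRHS]mule1 -lee_pdivlMr ?lte_fin ?invr_gt0 ?psi_gt0//.
by rewrite mule1 invrK -EFinM; exact: H.
Qed.

Lemma Mpsi_le f r : measurable_fun I f ->
  (forall t, I t -> int_drearr gamma f t <= (r * psi t)%:E)%E ->
  V f /\ nrm f <= r.
Proof.
move=> mf /Mnorm_e_le fr; have Vf : V f by split => //; exact: le_lt_trans fr (ltry _).
by split => //; rewrite -lee_fin -MnormE.
Qed.

Lemma int_drearr_le_Mnorm f t : V f -> I t ->
  (int_drearr gamma f t <= (nrm f * psi t)%:E)%E.
Proof.
move=> Vf It; rewrite EFinM -MnormE//.
rewrite -lee_pdivrMr ?lte_fin ?psi_gt0// muleC.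
by apply: ereal_sup_ubound; exists t.
Qed.

Lemma Mnorm_null f (N : set R) : measurable_fun I f -> measurable N ->
  mu N = 0%E -> (forall x, I x -> ~ N x -> f x = 0) -> V f /\ nrm f = 0.
Proof.
move=> mf mN N0 f0.
suff H : (Mnorm_e gamma psi f <= 0)%E.
  have Vf : V f by split => //; exact: le_lt_trans H (ltry _).
  by split => //; apply/eqP; rewrite eq_le Mnorm_ge0 andbT -lee_fin -MnormE.
rewrite (@Mnorm_e_ae R gamma psi f (cst 0) N)//.
apply: Mnorm_e_le => t It; rewrite mul0r.
apply: le_trans (int_drearr_le_integral _ (@measurable_cst _ _ _ _ _ _)) _.
by rewrite /cst normr0 integral0.
Qed.

(** Elements of [Mpsi] are functions, not classes. A bounded functional still ignores null sets,
    because the difference of f and g has seminorm 0. *)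
Lemma dual_ae u f g (N : set R) : dual_elem V nrm u -> V f -> measurable_fun I g ->
  measurable N -> mu N = 0%E -> (forall x, I x -> ~ N x -> f x = g x) ->
  V g /\ u f = u g.
Proof.
move=> [lu [C bu]] Vf mg mN N0 fg; have [mf fy] := Vf.
have E := Mnorm_e_ae psi mf mg mN N0 fg.
have Vg : V g by split; [exact: mg|rewrite -E].
split; first exact: Vg.
have [Vd nd] : V (-1 *: g + f) /\ nrm (-1 *: g + f) = 0.
  apply: (@Mnorm_null _ N _ mN N0).
    apply: measurable_funD mf.
    exact: (@measurable_funM _ _ _ _ (cst (-1)) g (@measurable_cst _ _ _ _ _ _) mg).
  move=> x Ix Nx. 
  change (-1 * g x + f x = 0).
  rewrite (fg x Ix Nx).
  rewrite mulN1r.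
  exact: addNr.
apply/eqP; rewrite -subr_eq0; apply/eqP.
have -> : u f - u g = -1 * u g + u f by rewrite mulN1r addrC.
rewrite -(lu (-1) g f Vg Vf); apply/eqP; rewrite -normr_le0.
by have := bu _ Vd; rewrite nd mulr0.
Qed.

Section QMap.
Variables (w : nat -> R) (tau : nat -> \bar R) (K : R).
Hypotheses (w0 : forall n, 0 <= w n) (tau0 : forall n, (0 <= tau n)%E).
Hypothesis HW : forall t, I t -> (wsum w tau 1 1 t <= (K * psi t)%:E)%E.
Local Notation B := (Bset gamma tau).
Local Notation Q := (Qs w).
Implicit Types F H : nat * R -> R.

Lemma wsumZ c eta t : 0 <= c -> 0 <= eta * t ->
  wsum w tau (c * eta) c t = (c%:E * wsum w tau 1 1 (eta * t)%R)%E.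
Proof.
move=> c0 et0; rewrite /wsum -nneseriesZl.
  apply: eq_eseriesr => n _; rewrite muleCA; congr (_ * _)%E.
  rewrite mul1e mul1r; move: c0; rewrite le_eqVlt => /predU1P[<-|c0].
    by rewrite !mul0r !mul0e minxx.
  by rewrite mine_pMr ?lee_fin ?ltW// -EFinM mulrA.
by move=> n _; rewrite mule_ge0 ?lee_fin// le_min lee_fin mul1r et0 mul1e tau0.
Qed.

(** Pulling c out of min(c eta t, c tau_n) leaves the unit bound at time eta t: reducing the uniform
    radius by eta dilates the argument of psi. This is the entry point of the dilation property. *)
Lemma int_drearr_QsK F c eta t : B (c * eta) c F -> 0 <= c -> 0 < eta <= 1 ->
  I t -> (int_drearr gamma (Q F) t <= (c * K * psi (eta * t))%:E)%E.
Proof.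
move=> BF c0 /andP[e0 e1] [t0 tg].
have Iet : I (eta * t).
  split; first exact: mulr_gt0.
  by apply: le_lt_trans tg; rewrite lee_fin ger_pMl.
have ce0 : 0 <= c * eta by rewrite mulr_ge0// ltW.
apply: le_trans (int_drearr_Qs w0 tau0 BF ce0 c0 t0) _.
rewrite wsumZ//; last by rewrite mulr_ge0 ?ltW.
rewrite -mulrA EFinM lee_wpmul2l ?lee_fin//.
exact: HW.
Qed.

Lemma Qs_small F c eta d : B (c * eta) c F -> 0 <= c -> 0 < eta <= 1 ->
  0 <= K -> (forall t, I t -> psi (eta * t) <= d * psi t) ->
  V (Q F) /\ nrm (Q F) <= c * K * d.
Proof.
move=> BF c0 e01 K0 Hd; apply: Mpsi_le.
  by apply: measurable_Qs => // n; case: (BF n).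
move=> t It; apply: le_trans (int_drearr_QsK BF c0 e01 It) _.
by rewrite lee_fin -(mulrA (c * K)) ler_wpM2l ?mulr_ge0// Hd.
Qed.

Lemma Qs_mem F c : B c c F -> 0 <= c -> V (Q F) /\ nrm (Q F) <= c * K.
Proof.
move=> BF c0; apply: Mpsi_le.
  by apply: measurable_Qs => // n; case: (BF n).
move=> t It; have := @int_drearr_QsK F c 1 t.
by rewrite mulr1 mul1r => /(_ BF c0); apply => //; rewrite ltr01 lexx.
Qed.

Lemma Qs_finite F c : B c c F -> 0 <= c ->
  exists N : set R, [/\ measurable N, mu N = 0%E &
    forall x, I x -> ~ N x -> (absum w F x < +oo)%E].
Proof.
move=> BF c0; have [t It] := I0; have [t0 _] := It.
apply: (absum_ae w0 tau0 BF c0 c0 t0).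
have := @wsumZ c 1 t c0; rewrite mulr1 mul1r => -> //; last exact: ltW.
rewrite lte_mul_pinfty ?lee_fin//.
exact: le_lt_trans (HW It) (ltry _).
Qed.

(** [Qs] is known to be linear where both series converge absolutely, that is off a null set;
    [dual_ae] makes the functional blind to that set. *)
Lemma dual_Qs u F H a c : dual_elem V nrm u -> 0 <= c -> B c c F -> B c c H ->
  u (Q (a *: F + H)) = a * u (Q F) + u (Q H).
Proof.
move=> du c0 BF BH.
have [N1 [mN1 N10 H1]] := Qs_finite BF c0.
have [N2 [mN2 N20 H2]] := Qs_finite BH c0.
have [VF _] := Qs_mem BF c0; have [VH _] := Qs_mem BH c0.
have ac : 0 <= `|a| * c by rewrite mulr_ge0.
have BaH := BsetD ac c0 (BsetZ a BF) BH.
have [VaH _] := Qs_mem BaH (addr_ge0 ac c0).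
have mN : measurable (N1 `|` N2) by exact: measurableU.
have N0 : mu (N1 `|` N2) = 0%E by exact: null_set_setU.
have mL : measurable_fun I (a *: Q F + Q H).
  have [mF _] := VF; have [mH _] := VH.
  apply: measurable_funD mH.
  exact: (@measurable_funM _ _ _ _ (cst a) (Q F) (@measurable_cst _ _ _ _ _ _) mF).
have E x : I x -> ~ (N1 `|` N2) x -> Q (a *: F + H) x = (a *: Q F + Q H) x.
  move=> Ix nN; apply: (Qs_lin w0).
    by apply: H1 => // ?; apply: nN; left.
  by apply: H2 => // ?; apply: nN; right.
have [_ ->] := dual_ae du VaH mL mN N0 E.
by have [lu _] := du; rewrite (lu a _ _ VF VH).
Qed.

End QMap.
End MpsiBasics.

(** While y_k = a_k the terms at least double; from the first y_k < a_k on they at least halve. The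
    sum is therefore controlled by its largest term, hence by P. *)
Lemma lacunary_sum (R : realFieldType) (P : R) (M : nat) (a y : nat -> R) :
  (forall k, 0 <= y k) -> (forall k, y k <= a k) -> (forall k, y k <= P) ->
  (forall k, 2 * a k <= a k.+1) -> (forall k, y k < a k -> 2 * y k.+1 <= y k) ->
  \sum_(0 <= k < M) y k <= 4 * P.
Proof.
move=> y0 ya yP aa yy.
(* Strengthened for the induction: the reserve -a_0 absorbs a new first term because a_0 + (4P -
   a_1) <= 4P - a_0 when 2 a_0 <= a_1. *)
suff [H1 H2] : (y 0%N = a 0%N -> \sum_(0 <= k < M) y k <= 4 * P - a 0%N) /\
    (y 0%N < a 0%N -> \sum_(0 <= k < M) y k <= 2 * y 0%N).
  have := ya 0%N; rewrite le_eqVlt => /predU1P[/[dup] E /H1|/H2] H.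
    by apply: le_trans H _; rewrite lerBlDr lerDl -E.
  by apply: le_trans H _; have := yP 0%N; have := y0 0%N; lra.
elim: M a y y0 ya yP aa yy => [|M IH] a y y0 ya yP aa yy.
  rewrite big_geq//; have := yP 0%N; have := y0 0%N.
  by split=> [<-|_]; lra.
rewrite big_nat_recl//.
have [//|//|//|//|k|H1 H2] := IH (fun k => a k.+1) (fun k => y k.+1).
  exact: yy.
have y00 := y0 0%N; have yP0 := yP 0%N; have y10 := y0 1%N; have yP1 := yP 1%N.
have aa0 := aa 0%N; have ya0 := ya 0%N.
split => [E|ya'].
  have := ya 1%N; rewrite le_eqVlt => /predU1P[/H1|/H2] H; lra.
have yy0 := yy 0%N ya'.
have /H2 : y 1%N < a 1%N by lra.
lra.
Qed.

(** * Complemented copies of l^1 *)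

Section BanachLimit.
Variable R : realType.
Implicit Types x y : nat -> R.

Definition bndseq : set (nat -> R) := [set x | exists M, forall n, `|x n| <= M].

(** The limit along an ultrafilter finer than \oo, which exists for bounded sequences by compactness
    of [-M, M]. *)
Lemma banach_limit : exists L : (nat -> R) -> R,
  [/\ forall a x y, bndseq x -> bndseq y -> L (a *: x + y) = a * L x + L y,
      forall x c, bndseq x -> (\forall n \near \oo, x n <= c) -> L x <= c &
      forall x c, (\forall n \near \oo, x n = c) -> L x = c].
Proof.
have [U [UU sU]] := @ultraFilterLemma nat \oo _.
have PU : ProperFilter U by exact: ultra_proper.
have cx x : bndseq x -> cvg (x n @[n --> U]).
  move=> [M xM].
  have cM := @segment_compact R (- M) M.
  have [|p [_ cp]] := cM (x n @[n --> U]) _.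
    apply: (@filterS _ U _ setT); last exact: filterT.
    by move=> n _ /=; rewrite in_itv/= -ler_norml.
  apply: (@cvgP _ _ p) => A pA.
  have [//|nA] := in_ultra_setVsetC (x @^-1` A) UU.
  by have [z []] := cp (~` A) A nA pA.
exists (fun x => lim (x n @[n --> U])); split.
- move=> a x y /cx ux /cx uy; apply: cvg_lim => //.
  by apply: cvgD uy; exact: cvgMl_tmp.
- by move=> x c /cx ux xc; apply: limr_le => //; exact: sU.
- by move=> x c xc; apply: lim_near_cst => //; exact: sU.
Qed.

End BanachLimit.

Section ComplementedL1.
Variables (R : realType) (T : lmodType R) (V : set T) (nrm : T -> R).
Variables (p : nat -> T -> R) (e : nat -> T) (C kappa : R).
Hypothesis plin : forall l a f g, V f -> V g -> p l (a *: f + g) = a * p l f + p l g.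
Hypothesis pbd : forall k f, V f -> \sum_(0 <= l < k) `|p l f| <= C * nrm f.
Hypothesis Ve : forall m, V (e m).
Hypothesis e1 : forall m, nrm (e m) <= 1.
Hypothesis pe : forall l m, p l (e m) = if l == m then kappa else 0.
Hypothesis kappa0 : 0 < kappa.
Hypothesis nrm0 : forall f, 0 <= nrm f.

(* The coordinate functionals p_l and the vectors e_m span a complemented copy
   of l^1; there the partial sums of the coordinates converge weak-* to the sum
   functional, but not weakly. *)
Lemma complemented_l1_not_Grothendieck : ~ Grothendieck V nrm.
Proof.
pose u n f := \sum_(0 <= l < n) p l f.
pose u0 f := limn (u^~ f).
have cu f : V f -> cvgn (u^~ f).
  move=> Vf; apply: (@normed_cvg _ R^o (p^~ f)).
  change (cvgn (series (fun l => `|p l f|))); apply: nondecreasing_is_cvgn.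
    by apply/nondecreasing_seqP => n; rewrite /series/= big_nat_recr//= lerDl.
  by exists (C * nrm f) => _ [n _ <-]; exact: pbd.
have ulin n a f g : V f -> V g -> u n (a *: f + g) = a * u n f + u n g.
  move=> Vf Vg; rewrite /u mulr_sumr -big_split/=.
  by apply: eq_bigr => l _; rewrite plin.
have ubd n f : V f -> `|u n f| <= C * nrm f.
  by move=> Vf; apply: le_trans (ler_norm_sum _ _ _) (pbd _ Vf).
have du n : dual_elem V nrm (u n).
  by split; [exact: ulin|exists C; exact: ubd].
have cu0 f : V f -> u n f @[n --> \oo] --> u0 f by move=> Vf; exact: cu.
have cL a f g : V f -> V g -> u n (a *: f + g) @[n --> \oo] --> a * u0 f + u0 g.
  move=> Vf Vg; rewrite (_ : (fun n => _) = (fun n => a * u n f + u n g)).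
    by apply: cvgD; [apply: cvgMl_tmp|]; exact: cu0.
  by apply/funext => n; exact: ulin.
have du0 : dual_elem V nrm u0.
  split=> [a f g Vf Vg|]; first by apply/cvg_lim => //; exact: cL.
  exists C => f Vf; rewrite -lim_norm; last exact: cu.
  apply: limr_le; first by apply: is_cvg_norm; exact: cu.
  by near=> n; exact: ubd.
have [L [Llin Lle Lcst]] := banach_limit R.
(* [Phi] separates the sequence from its limit: u n (e m) vanishes for m >= n, so Phi (u n) = 0 for
   every n, whereas u0 (e m) = kappa for all m. *)
pose Phi (v : T -> R) := L (fun m => v (e m)).
have bv v : dual_elem V nrm v -> forall m, `|v (e m)| <= dual_norm V nrm v.
  move=> [_ [D vD]] m; apply: sup_upper_bound; last by exists (e m).
  split; first by exists `|v (e m)|; exists (e m).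
  exists `|D| => _ [f [Vf f1] <-]; apply: le_trans (vD _ Vf) _.
  apply: (@le_trans _ _ (`|D| * nrm f)); first by rewrite ler_wpM2r// ler_norm.
  by rewrite ler_piMr.
have bb v : dual_elem V nrm v -> bndseq (fun m => v (e m)).
  by move=> dv; exists (dual_norm V nrm v); exact: bv.
have dPhi : dual_elem (dual_set V nrm) (dual_norm V nrm) Phi.
  split=> [a v v' dv dv'|]; first by rewrite /Phi -Llin//; exact: bb.
  exists 1 => v dv; rewrite mul1r ler_norml; apply/andP; split; last first.
    apply: Lle; first exact: bb.
    by near=> n; apply: le_trans (ler_norm _) (bv _ dv _).
  rewrite lerNl.
  have bz : bndseq (fun _ : nat => 0 : R) by exists 0 => n; rewrite normr0.
  have L0 : L (fun _ => 0) = 0 by apply: Lcst; near=> n.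
  have -> : - Phi v = L (-1 *: (fun m => v (e m)) + (fun _ => 0)).
    by rewrite Llin ?L0 ?addr0 ?mulN1r//; exact: bb.
  apply: Lle.
    exists (dual_norm V nrm v) => n.
    change (`|-1 * v (e n) + 0| <= dual_norm V nrm v).
    by rewrite addr0 normrM normrN1 mul1r bv.
  near=> n; change (-1 * v (e n) + 0 <= dual_norm V nrm v).
  rewrite addr0 mulN1r.
  by apply: le_trans (ler_norm _) _; rewrite normrN bv.
move=> G; have := G u u0 du du0 cu0 Phi dPhi.
have -> : (fun n => Phi (u n)) = cst 0.
  apply/funext => n; apply: Lcst; near=> m.
  rewrite /u big_nat big1// => l /andP[_ ln]; rewrite pe; case: eqP => // E.
  exfalso; have : (n <= m)%N by near: m; exact: nbhs_infty_ge.
  by rewrite leqNgt -E ln.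
have -> : Phi u0 = kappa.
  apply: Lcst; near=> m; apply/cvg_lim => //; apply: cvg_near_cst; near=> n.
  have mn : (m < n)%N by near: n; exact: nbhs_infty_gt.
  rewrite /u (bigD1_seq m)/= ?mem_index_iota ?iota_uniq//.
  rewrite pe eqxx big1 ?addr0// => l /negPf lm.
  by rewrite pe lm.
move=> H; have : (0 : R) = kappa by apply: (cvg_unique _ _ H) => //; exact: cvg_cst.
by move=> E; move: kappa0; rewrite -E ltxx.
Unshelve. all: by end_near. Qed.

End ComplementedL1.

(** * Concave weights and their liminf conditions *)

Section LimfEinf.
Variables (R : realType) (F : set_system R) (FF : Filter F).

Lemma limf_einf_gt1P (f : R -> R) :
  (1 < limf_einf (fun t => (f t)%:E) F)%E <->
  exists2 c, 1 < c & F [set t | c <= f t].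
Proof.
rewrite limf_einfE; split.
  move=> /ereal_sup_gt[_ [V FV <-]] H.
  have [c c1 cV] : exists2 c : R, 1 < c & (c%:E <= ereal_inf [set (f t)%:E | t in V])%E.
    move: H; case: (ereal_inf _) => [r||//].
      by rewrite lte_fin => r1; exists r.
    (* An infinite infimum means that V is empty; any constant above 1 will do. *)
    by move=> _; exists 2; [lra|rewrite leey].
  exists c => //; apply: filterS FV => t Vt /=; rewrite -lee_fin.
  by apply: le_trans cV _; apply: ereal_inf_lbound; exists t.
move=> [c c1 Fc]; apply: (@lt_le_trans _ _ c%:E); first by rewrite lte_fin.
apply: (@le_trans _ _ (ereal_inf [set (f t)%:E | t in [set t | c <= f t]])).
  by apply: le_ereal_inf_tmp => _ [t /= ct <-]; rewrite lee_fin.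
by apply: ereal_sup_ubound; exists [set t | c <= f t].
Qed.

End LimfEinf.

Record concave_weight (R : realType) (gamma : \bar R) (psi : R -> R) : Prop := ConcaveWeight {
  cw_ge0 : forall t, 0 <= t -> (t%:E < gamma)%E -> 0 <= psi t;
  cw_nz : exists t, 0 <= t /\ (t%:E < gamma)%E /\ psi t != 0;
  cw_mono : forall s t, 0 <= s -> s <= t -> (t%:E < gamma)%E -> psi s <= psi t;
  cw_conc : forall (l s t : R), 0 <= l <= 1 -> 0 <= s -> (s%:E < gamma)%E ->
    0 <= t -> (t%:E < gamma)%E ->
    l * psi s + (1 - l) * psi t <= psi (l * s + (1 - l) * t);
  cw_0 : psi 0 = 0 }.

Section PsiFacts.
Variables (R : realType) (gamma : \bar R) (psi : R -> R).
Local Notation I := (Ioo0 gamma).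
Hypothesis cw : concave_weight gamma psi.
Let psi_mono := cw_mono cw.
Let psi_conc := cw_conc cw.
Let psi0 := cw_0 cw.

Lemma Ioo0_le (s t : R) : 0 < s -> s <= t -> I t -> I s.
Proof. by move=> s0 st [_ tg]; split => //; apply: le_lt_trans tg; rewrite lee_fin. Qed.

(** Concavity between 0 and t, where psi 0 = 0: the quotient psi(t)/t is nonincreasing, written
    without division. *)
Lemma psi_star (s t : R) : 0 < s -> s <= t -> I t -> s * psi t <= t * psi s.
Proof.
move=> s0 st [t0 tg].
have st1 : 0 <= s / t <= 1.
  by rewrite divr_ge0 ?(ltW s0) ?(ltW t0)//= ler_pdivrMr// mul1r.
have g0 : (0%:E < gamma)%E by apply: lt_trans tg; rewrite lte_fin.
have := psi_conc st1 (ltW t0) tg (lexx 0) g0.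
rewrite psi0 !mulr0 !addr0 divfK ?gt_eqF// mulrAC ler_pdivrMr//.
by rewrite [psi s * t]mulrC.
Qed.

Lemma psi_gt0 (t : R) : I t -> 0 < psi t.
Proof.
move=> It; have [r [r0 [rg rn]]] := cw_nz cw.
have pr : 0 < psi r by rewrite lt_def rn (cw_ge0 cw).
have r1 : 0 < r.
  by rewrite lt_def r0 andbT; apply: contra_neq rn => ->.
have [rt|tr] := leP r t.
  by apply: lt_le_trans pr _; apply: psi_mono => //; case: It.
have [t0 _] := It.
have := @psi_star t r t0 (ltW tr) (conj r1 rg); have := mulr_gt0 t0 pr.
by move=> /lt_le_trans /[apply]; rewrite pmulr_rgt0.
Qed.

Lemma Ioo0_neq0 : I !=set0.
Proof.
have [t [t0 [tg pt]]] := cw_nz cw; exists t; split => //.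
by rewrite lt_def t0 andbT; apply: contra_neq pt => ->.
Qed.

(** 2t divides the segment from t to mt in the ratio 1 : m-2, so by concavity psi grows on it at
    most m-1 times as much as on [t, 2t]. A small doubling ratio thus bounds psi(mt), and conversely
    a large psi(mt) forces doubling at t. *)
Lemma psi_mult (m t : R) : 2 <= m -> 0 < t -> ((m * t)%:E < gamma)%E ->
  psi (m * t) <= psi t + (m - 1) * (psi (2 * t) - psi t).
Proof.
move=> m2 t0 mtg.
have m1 : 0 < m - 1 by lra.
have tg : (t%:E < gamma)%E.
  by apply: le_lt_trans mtg; rewrite lee_fin ler_peMl ?ltW//; lra.
have l01 : 0 <= (m - 1)^-1 <= 1.
  by rewrite invr_ge0 ltW//= invf_le1//; lra.
have mt0 : 0 <= m * t by rewrite mulr_ge0 ?ltW//; lra.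
have := psi_conc l01 mt0 mtg (ltW t0) tg.
have -> : (m - 1)^-1 * (m * t) + (1 - (m - 1)^-1) * t = 2 * t.
  by field; rewrite gt_eqF.
rewrite -(ler_pM2l m1) mulrDr mulrA divff ?gt_eqF// mul1r.
rewrite mulrA mulrBr mulr1 divff ?gt_eqF//; lra.
Qed.

End PsiFacts.

Lemma Qs_single (R : realType) (w : nat -> R) (F : nat * R -> R) (n : nat) (x : R) :
  (forall k, k != n -> F (k, x) = 0) -> Qs w F x = w n * F (n, x).
Proof.
move=> Fx.
have E (u : nat -> R) : (forall k, k != n -> u k = 0) -> series u @ \oo --> u n.
  move=> u0; apply: cvg_near_cst; near=> m.
  have nm : (n < m)%N by near: m; exact: nbhs_infty_gt.
  rewrite /series/= (bigD1_seq n)/= ?mem_index_iota ?iota_uniq//.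
  by rewrite big1 ?addr0// => k /u0.
rewrite /Qs ifT; last first.
  rewrite /absum (_ : (fun k => _) = fun m => (series (fun k => w k * `|F (k, x)|) m)%:E).
    rewrite (_ : limn _ = (w n * `|F (n, x)|)%:E) ?ltry//.
    apply/cvg_lim => //; apply/fine_cvgP; split; first by near=> m.
    by apply: E => k /Fx ->; rewrite normr0 mulr0.
  by apply/funext => m; rewrite /series/= sumEFin.
by apply/cvg_lim => //; apply: E => k /Fx ->; rewrite mulr0.
Unshelve. all: by end_near. Qed.

(** * Integrals over disjoint intervals *)

Section IntervalSums.
Variables (R : realType) (gamma : \bar R) (psi : R -> R).
Local Notation mu := (@lebesgue_measure R).
Local Notation I := (Ioo0 gamma).
Local Notation V := (Mpsi gamma psi).
Local Notation nrm := (Mnorm gamma psi).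
Hypotheses (psi_gt0 : forall t, I t -> 0 < psi t) (I0 : I !=set0).

Lemma measure_bigsetU_le (F : nat -> set R) (s : seq nat) :
  (forall n, measurable (F n)) ->
  (mu (\big[setU/set0]_(i <- s) F i) <= \sum_(i <- s) mu (F i))%E.
Proof.
move=> mF; elim: s => [|h s IH]; first by rewrite !big_nil measure0.
rewrite !big_cons; apply: le_trans (measureU2 mu (mF h) _) _.
  by apply: bigsetU_measurable => i _; exact: mF.
exact: leeD2l.
Qed.

Variables (a b : nat -> R) (k : nat) (t : R).
Hypotheses (ab : forall l, a l <= b l) (It : I t).
Hypothesis abI : forall l, (l < k)%N -> `]a l, b l[ `<=` I.
Hypothesis tab : trivIset [set l | (l < k)%N] (fun l => `]a l, b l[%classic).
Hypothesis abt : \sum_(0 <= l < k) (b l - a l) <= t.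

(** Hardy-Littlewood on the union of the intervals, which has measure at most t. With integrals over
    the intervals as coordinates, this is an l^1-bound. *)
Lemma sum_integral_le f : V f ->
  (\sum_(0 <= l < k) \int[mu]_(x in `]a l, b l[%classic) `|f x|%:E <=
   (nrm f * psi t)%:E)%E.
Proof.
move=> Vf; have [mf _] := Vf; have [t0 _] := It.
pose F l : set R := `]a l, b l[%classic.
have mF l : measurable (F l) by exact: measurable_itv.
pose D := \big[setU/set0]_(l <- index_iota 0 k) F l.
have DI : D `<=` I.
  move=> x; rewrite /D -bigcup_seq => -[l /=]; rewrite mem_index_iota => /andP[_ lk].
  exact: abI.
have mD : measurable D by apply: bigsetU_measurable => i _; exact: mF.
have Dt : (mu D <= t%:E)%E.
  apply: le_trans (measure_bigsetU_le _ mF) _.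
  rewrite (eq_bigr (fun l => (b l - a l)%:E)).
    by rewrite sumEFin lee_fin.
  by move=> l _; exact: lebesgue_measure_itvoo.
apply: le_trans (int_drearr_le_Mnorm psi_gt0 I0 Vf It).
apply: le_trans (hardy_littlewood mf mD DI (ltW t0) Dt).
rewrite le_eqVlt; apply/orP; left; apply/eqP/esym.
rewrite /D ge0_integral_bigsetU//.
- exact: iota_uniq.
- have -> : [set` index_iota 0 k] = [set l | (l < k)%N].
    by apply/seteqP; split => l /=; rewrite mem_index_iota.
  exact: tab.
- apply/measurable_EFinP; apply: measurableT_comp => //.
  by apply: measurable_funS DI mf; exact: measurable_Ioo0.
Qed.

Lemma integrable_itv f l : V f -> (l < k)%N ->
  mu.-integrable `]a l, b l[%classic (EFin \o f).
Proof.
move=> Vf lk; have [mf _] := Vf.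
apply/integrableP; split.
  apply/measurable_EFinP; apply: measurable_funS (abI lk) mf.
  exact: measurable_Ioo0.
apply: le_lt_trans (ltry (nrm f * psi t)).
apply: le_trans (sum_integral_le Vf).
rewrite (bigD1_seq l)/= ?mem_index_iota ?iota_uniq// leeDl//.
by apply: sume_ge0 => i _; exact: integral_ge0.
Qed.

Lemma sum_Rintegral_le f : V f ->
  \sum_(0 <= l < k) `|\int[mu]_(x in `]a l, b l[%classic) f x|%R <= nrm f * psi t.
Proof.
move=> Vf; rewrite -lee_fin; apply: le_trans (sum_integral_le Vf).
rewrite -sumEFin big_nat [leRHS]big_nat; apply: lee_sum => l /andP[_ lk].
have il := integrable_itv Vf lk.
have := @le_normr_Rintegral _ _ _ mu `]a l, b l[%classic f (measurable_itv _) il.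
rewrite -lee_fin => /le_trans; apply; rewrite /Rintegral fineK//.
rewrite ge0_fin_numE; last exact: integral_ge0.
by move/integrableP: il => [].
Qed.

End IntervalSums.

(** * Copies of l^1 spanned by indicators *)

Section NotGrothendieck.
Variables (R : realType) (gamma : \bar R) (psi : R -> R).
Local Notation mu := (@lebesgue_measure R).
Local Notation I := (Ioo0 gamma).
Local Notation V := (Mpsi gamma psi).
Local Notation nrm := (Mnorm gamma psi).
Hypotheses (psi_gt0 : forall t, I t -> 0 < psi t) (I0 : I !=set0).

Lemma Rintegral_lin (D : set R) a f g : measurable D ->
  mu.-integrable D (EFin \o f) -> mu.-integrable D (EFin \o g) ->
  \int[mu]_(x in D) (a *: f + g) x = a * (\int[mu]_(x in D) f x)%R +
  (\int[mu]_(x in D) g x)%R.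
Proof.
move=> mD fi gi.
have afi : mu.-integrable D (EFin \o (fun x => a * f x)).
  rewrite (_ : _ \o _ = (fun x => a%:E * (EFin \o f) x)%E).
    exact: integrableZl.
  by apply/funext => x /=; rewrite EFinM.
by rewrite -RintegralZl// -RintegralD.
Qed.

(** The vector e_m is kappa/|J_m| times the indicator of J_m = ]a m, b m[, and kappa min(1, t/|J_m|)
    dominates the integral of its rearrangement over (0,t); the last hypothesis thus puts e_m into
    the unit ball. The bound psi <= D at a point beyond the total length of k intervals makes the
    integrals over them l^1-bounded coordinates. *)
Lemma local_L1_not_Grothendieck (a b : nat -> R) (D kappa : R) :
  (forall l, a l < b l) -> (forall l, `]a l, b l[ `<=` I) ->
  trivIset setT (fun l => `]a l, b l[%classic) ->
  (forall k, exists t, [/\ I t, \sum_(0 <= l < k) (b l - a l) <= t & psi t <= D]) ->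
  0 < kappa ->
  (forall m t, I t -> kappa * Num.min 1 (t / (b m - a m)) <= psi t) ->
  ~ Grothendieck V nrm.
Proof.
move=> ab abI tab abt k0 Hk.
have ab' l : a l <= b l by exact: ltW.
have iV f l : V f -> mu.-integrable `]a l, b l[%classic (EFin \o f).
  move=> Vf; have [t [It st _]] := abt l.+1.
  apply: (@integrable_itv _ _ _ psi_gt0 I0 a b l.+1 t) => //.
  exact: sub_trivIset tab.
pose e m : R -> R := (fun x => kappa / (b m - a m) * \1_(`]a m, b m[%classic) x).
have e1 m : V (e m) /\ nrm (e m) <= 1.
  have bm : 0 < b m - a m by rewrite subr_gt0.
  have s0 : 0 <= kappa / (b m - a m) by rewrite divr_ge0// ltW.
  have me : measurable_fun I (e m).
    by apply: measurable_funM => //; exact: measurable_indic.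
  apply: Mpsi_le => // t It; have [t0 _] := It; rewrite mul1r.
  apply: (@le_trans _ _ (kappa * Num.min 1 (t / (b m - a m)))%:E); last first.
    by rewrite lee_fin Hk.
  rewrite minr_pMr ?(ltW k0)// mulr1 EFin_min le_min; apply/andP; split.
    apply: le_trans (int_drearr_le_integral _ me) _.
    have -> : (fun x => `|e m x|%:E) =
      (fun x => (kappa / (b m - a m))%:E * (\1_(`]a m, b m[%classic) x)%:E)%E.
      by apply/funext => x; rewrite /e ger0_norm ?EFinM// mulr_ge0.
    rewrite ge0_integralZl//; first last.
    - by apply/measurable_EFinP; exact: measurable_indic.
    - exact: measurable_Ioo0.
    rewrite integral_indic//; last exact: measurable_Ioo0.
    rewrite (_ : `]a m, b m[ `&` I = `]a m, b m[%classic); last first.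
      by apply/setIidPl; exact: abI.
    rewrite /= lebesgue_measure_itvoo// -EFinM lee_fin divfK//; first by rewrite gt_eqF.
  have := @int_drearr_le _ gamma (e m) (cst 0) _ t me (@measurable_cst _ _ _ _ _ _)
    s0 (ltW t0).
  move=> /(_ _)/le_trans; apply.
    move=> x _; rewrite /cst normr0 add0r /e normrM (ger0_norm s0).
    by rewrite ler_piMr// indicE; case: (_ \in _); rewrite ?normr1 ?normr0.
  by rewrite integral0_eq ?add0e ?lee_fin; [rewrite mulrCA|move=> x _; rewrite normr0].
apply: (@complemented_l1_not_Grothendieck R _ V nrm
  (fun l f => \int[mu]_(x in `]a l, b l[%classic) f x)%R e D kappa) => //.
- move=> l c f g Vf Vg; apply: Rintegral_lin => //; exact: iV.
- move=> k f Vf; have [t [It st tD]] := abt k.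
  apply: (@le_trans _ _ (nrm f * psi t)).
    apply: sum_Rintegral_le => //; exact: sub_trivIset tab.
  by rewrite mulrC ler_wpM2r// Mnorm_ge0.
- by move=> m; case: (e1 m).
- by move=> m; case: (e1 m).
- move=> l m; case: eqP => [<-|/eqP lm].
    rewrite (_ : (\int[mu]_(x in `]a l, b l[) e l x)%R =
      (\int[mu]_(x in `]a l, b l[) (kappa / (b l - a l)))%R).
      rewrite Rintegral_cst// (_ : fine _ = b l - a l).
        by rewrite divfK// subr_eq0 gt_eqF.
      by rewrite -[RHS]/(fine (b l - a l)%:E) -lebesgue_measure_itvoo.
    by apply: eq_Rintegral => x xl; rewrite /e indicE xl mulr1.
  rewrite (_ : (\int[mu]_(x in `]a l, b l[) e m x)%R =
      (\int[mu]_(x in `]a l, b l[) 0)%R); first by rewrite Rintegral_cst// mul0r.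
  apply: eq_Rintegral => x xl; rewrite /e indicE memNset ?mulr0// => xm.
  move/eqP: lm; apply; apply: (tab l m) => //.
  by exists x; split => //; exact: set_mem.
- by move=> f; exact: Mnorm_ge0.
Qed.

End NotGrothendieck.

(** * Copies of l^1 along lacunary scales *)

Section LacunaryNotGrothendieck.
Variables (R : realType) (gamma : \bar R) (psi : R -> R).
Local Notation mu := (@lebesgue_measure R).
Local Notation I := (Ioo0 gamma).
Local Notation V := (Mpsi gamma psi).
Local Notation nrm := (Mnorm gamma psi).
Hypotheses (psi_gt0 : forall t, I t -> 0 < psi t) (I0 : I !=set0).
Variable t : nat -> R.
Hypothesis t0 : forall n, 0 < t n.
Hypothesis tg : forall n, (((n%:R + 1) * t n)%:E < gamma)%E.
Hypothesis psit : forall n, psi ((n%:R + 1) * t n) <= 2 * psi (t n).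
Hypothesis tdisj : forall m n, m != n ->
  (m%:R + 1) * t m <= t n \/ (n%:R + 1) * t n <= t m.
Hypothesis tsum : forall M s, I s ->
  \sum_(0 <= n < M) psi (t n) / t n * Num.min s (t n) <= 4 * psi s.

(** The n-th block, from t_n to (n+1) t_n, is cut into the n intervals J n l, l < n, each of length
    t_n. *)
Let a n l : R := (l%:R + 1) * t n.
Let b n l : R := (l%:R + 2) * t n.
Let J n l : set R := `]a n l, b n l[%classic.

Let ab n l : a n l < b n l. Proof. by rewrite /a /b ltr_pM2r//; lra. Qed.

Let abE n l : b n l - a n l = t n. Proof. by rewrite /a /b; lra. Qed.

Let Jbound n l x : (l < n)%N -> J n l x -> t n < x < (n%:R + 1) * t n.
Proof.
move=> ln; rewrite /J/= in_itv/= => /andP[ax xb]; apply/andP; split.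
  by apply: le_lt_trans ax; rewrite /a ler_peMl ?(ltW (t0 _))// lerDr ler0n.
apply: (lt_le_trans xb); rewrite /b ler_wpM2r ?(ltW (t0 _))//.
have : (l.+1%:R : R) <= n%:R by rewrite ler_nat.
by rewrite -natr1; lra.
Qed.

Let JI n l : (l < n)%N -> J n l `<=` I.
Proof.
move=> ln x /(Jbound ln)/andP[tx xt]; split; first exact: lt_trans (t0 n) tx.
by apply: lt_trans (tg n); rewrite lte_fin.
Qed.

Let It n : I ((n%:R + 1) * t n).
Proof. by split; [rewrite mulr_gt0// ltr_wpDl|exact: tg]. Qed.

Let It' n : I (t n).
Proof.
split => //; apply: le_lt_trans (tg n).
by rewrite lee_fin ler_peMl ?(ltW (t0 _))// lerDr ler0n.
Qed.

Let trivJ n : trivIset setT (J n).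
Proof.
move=> l m _ _ [x []]; rewrite /J/= !in_itv/= /a /b => /andP[l1 l2] /andP[m1 m2].
have H (k k' : nat) : (k%:R + 1) * t n < x -> x < (k'%:R + 2) * t n -> (k <= k')%N.
  move=> h1 h2; rewrite -ltnS -(ltr_nat R) -natr1.
  have := lt_trans h1 h2; rewrite ltr_pM2r//; lra.
by apply/eqP; rewrite eqn_leq !H.
Qed.

(** Since psi((n+1) t_n) <= 2 psi(t_n), sums of absolute values over l <= n stay below twice the
    norm, whatever n. The value 0 for l >= n concerns finitely many n for each l and is invisible to
    a Banach limit. *)
Let x_ n l (f : R -> R) : R := if (l < n)%N then
  (psi (t n))^-1 * (\int[mu]_(x in J n l) f x)%R else 0.

Let x_bd n k f : V f -> (k <= n)%N ->
  \sum_(0 <= l < k) `|x_ n l f| <= 2 * nrm f.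
Proof.
move=> Vf kn.
have p0 := psi_gt0 (It' n).
have : \sum_(0 <= l < k) `|\int[mu]_(x in J n l) f x|%R <= nrm f * psi ((n%:R + 1) * t n).
  apply: (@sum_Rintegral_le _ _ _ psi_gt0 I0 (a n) (b n) k) => //.
  - by move=> l; exact: ltW.
  - by move=> l lk; apply: JI; exact: leq_trans kn.
  - by apply: sub_trivIset (@trivJ n).
  - under eq_bigr do rewrite abE.
    rewrite sumr_const_nat subn0 -[_ *+ _]mulr_natl ler_wpM2r ?(ltW (t0 _))//.
    have : (k%:R : R) <= n%:R by rewrite ler_nat.
    lra.
have -> : \sum_(0 <= l < k) `|x_ n l f| =
    (psi (t n))^-1 * \sum_(0 <= l < k) `|\int[mu]_(x in J n l) f x|%R.
  rewrite mulr_sumr big_nat [RHS]big_nat; apply: eq_bigr => l /andP[_ lk].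
  by rewrite /x_ (leq_trans lk kn) normrM gtr0_norm// invr_gt0.
move=> H; rewrite ler_pdivrMl//; apply: le_trans H _.
rewrite mulrC mulrA [psi (t n) * 2]mulrC ler_wpM2r//.
exact: Mnorm_ge0.
Qed.

Let x_lin n l c f g : V f -> V g -> x_ n l (c *: f + g) = c * x_ n l f + x_ n l g.
Proof.
move=> Vf Vg; rewrite /x_; case: ifPn => ln; last by rewrite mulr0 addr0.
have iV h : V h -> mu.-integrable (J n l) (EFin \o h).
  move=> Vh; apply: (@integrable_itv _ _ _ psi_gt0 I0 (a n) (b n) n ((n%:R + 1) * t n)) => //.
  - by move=> i; exact: ltW.
  - by move=> i ik; apply: JI.
  - by apply: sub_trivIset (@trivJ n).
  - under eq_bigr do rewrite abE.
    rewrite sumr_const_nat subn0 -[_ *+ _]mulr_natl ler_wpM2r ?(ltW (t0 _))//.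
    lra.
rewrite Rintegral_lin; [|exact: measurable_itv|exact: iV|exact: iV].
by rewrite mulrDr mulrCA.
Qed.

Let x_bseq l f : V f -> bndseq (fun n => x_ n l f).
Proof.
move=> Vf; exists (2 * nrm f) => n.
have [nl|ln] := leqP n l.
  by rewrite /x_ ltnNge nl/= normr0 mulr_ge0// Mnorm_ge0.
apply: le_trans (x_bd Vf ln).
rewrite big_nat_recr//= lerDr; apply: sumr_ge0 => i _; exact: normr_ge0.
Qed.

(** The vector e_m has height w_n on interval m of every block with n > m. It is written as a value
    of [Qs] so that [Qs_mem] bounds its norm; the factor 4 cancels the constant in [tsum], which
    gives norm at most 1. *)
Let w n := psi (t n) / (4 * t n).
Let tau n := (t n)%:E.
Let F m (p : nat * R) : R := if (m < p.1)%N then \1_(J p.1 m) p.2 else 0.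
Let e m := Qs w (F m).

Let w0 n : 0 <= w n.
Proof. by rewrite divr_ge0 ?mulr_ge0 ?(ltW (t0 _))// ltW// psi_gt0. Qed.

Let tau0 n : (0 <= tau n)%E. Proof. by rewrite lee_fin ltW. Qed.

Let HW s : I s -> (wsum w tau 1 1 s <= (1 * psi s)%:E)%E.
Proof.
move=> Is; rewrite mul1r; have [s0 _] := Is.
rewrite /wsum; apply: nneseries_le => [n|M].
  rewrite mule_ge0 ?lee_fin// le_min lee_fin mul1r mul1e (ltW s0)/=.
  exact: tau0.
rewrite (eq_bigr (fun n => (4^-1 * (psi (t n) / t n * Num.min s (t n)))%:E)).
  by rewrite sumEFin lee_fin -mulr_sumr ler_pdivrMl// tsum.
move=> n _; rewrite mul1r mul1e -EFin_min -EFinM; congr EFin.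
by rewrite /w invfM; lra.
Qed.

Let BF m : Bset gamma tau 1 1 (F m).
Proof.
move=> n; rewrite /F/=; case: (boolP (m < n)%N) => mn; split.
- by apply: measurable_indic; exact: measurable_itv.
- by move=> x _; rewrite indicE; case: (_ \in _); rewrite ?normr1 ?normr0.
- under eq_integral do rewrite ger0_norm//.
  rewrite integral_indic; [|exact: measurable_Ioo0|exact: measurable_itv].
  rewrite (_ : J n m `&` I = J n m); last by apply/setIidPl; exact: JI.
  by rewrite /= lebesgue_measure_itvoo ?abE ?mul1e// ltW.
- exact: measurable_cst.
- by move=> x _; rewrite normr0.
- by rewrite normr0 integral0 mul1e.
Qed.

Let eJ n l m x : (l < n)%N -> (m < n)%N -> J n l x ->
  e m x = if l == m then w n else 0.
Proof.
move=> ln mn Jx; rewrite /e (@Qs_single _ _ _ n).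
  rewrite /F/= mn indicE; case: eqP => [<-|lm]; first by rewrite mem_set// mulr1.
  rewrite memNset ?mulr0// => Jm; apply: lm; apply: (@trivJ n) => //.
  by exists x.
move=> k kn; rewrite /F/=; case: ifPn => // mk; rewrite indicE memNset// => Jk.
have /andP[h1 h2] := Jbound ln Jx; have /andP[h3 h4] := Jbound mk Jk.
have [H|H] := tdisj kn.
  by have := lt_trans (lt_le_trans h4 H) h1; rewrite ltxx.
by have := lt_trans (lt_le_trans h2 H) h3; rewrite ltxx.
Qed.

(** A single block carries only an n-dimensional l^1. Coordinate l is therefore the Banach limit
    over n of [x_ n l]; it is w_n t_n / psi(t_n) = 1/4 at e_l and 0 at the other e_m. *)
Lemma lacunary_not_Grothendieck : ~ Grothendieck V nrm.
Proof.
have [L [Llin Lle Lcst]] := banach_limit R.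
have Ve m : V (e m) /\ nrm (e m) <= 1.
  by have := Qs_mem psi_gt0 I0 w0 tau0 HW (BF m) ler01; rewrite mul1r.
apply: (@complemented_l1_not_Grothendieck R _ V nrm
  (fun l f => L (fun n => x_ n l f)) e 2 4^-1).
- move=> l c f g Vf Vg; rewrite -Llin; [|exact: x_bseq..].
  by congr L; apply/funext => n; exact: x_lin.
- move=> k f Vf.
  (* Multiplying by signs turns the sum of absolute values into one Banach limit, so that the bound
     [x_bd] at each scale n >= k passes to the limit. *)
  pose s l := Num.sg (L (fun n => x_ n l f)).
  have s1 l : `|s l| <= 1 by rewrite normr_sg; case: (_ != _).
  have bs : bndseq (fun n => \sum_(0 <= l < k) s l * x_ n l f) /\
      \sum_(0 <= l < k) `|L (fun n => x_ n l f)| =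
      L (fun n => \sum_(0 <= l < k) s l * x_ n l f).
    elim: k => [|k [[M IM] IE]].
      split; first by exists 0 => n; rewrite big_geq// normr0.
      by rewrite big_geq//; apply/esym/Lcst; near=> n; rewrite big_geq.
    have [N HN] := x_bseq k Vf.
    split.
      exists (M + N) => n; rewrite big_nat_recr//=.
      apply: le_trans (ler_normD _ _) _; apply: lerD; first exact: IM.
      by rewrite normrM; apply: le_trans (HN n); rewrite ler_piMl.
    rewrite big_nat_recr//= IE addrC normrEsg -Llin; [|exact: x_bseq|by exists M].
    congr L; apply/funext => n.
    by rewrite big_nat_recr//= addrC.
  have [b1 ->] := bs; apply: Lle => //; near=> n.
  apply: (@le_trans _ _ (\sum_(0 <= l < k) `|x_ n l f|)).
    apply: ler_sum => l _; apply: le_trans (ler_norm _) _.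
    by rewrite normrM ler_piMl.
  by apply: x_bd => //; near: n; exact: nbhs_infty_ge.
- by move=> m; case: (Ve m).
- by move=> m; case: (Ve m).
- move=> l m; apply: Lcst; near=> n.
  have ln : (l < n)%N by near: n; exact: nbhs_infty_gt.
  have mn : (m < n)%N by near: n; exact: nbhs_infty_gt.
  rewrite /x_ ln.
  rewrite (_ : (\int[mu]_(x in J n l) e m x)%R =
    (\int[mu]_(x in J n l) (if l == m then w n else 0))%R); last first.
    by apply: eq_Rintegral => x /set_mem /(eJ ln mn).
  rewrite Rintegral_cst; last exact: measurable_itv.
  rewrite (_ : fine _ = t n); last first.
    by rewrite -[RHS]/(fine (t n)%:E) -(abE n l) -lebesgue_measure_itvoo// ltW.
  case: eqP => _; last by rewrite mul0r mulr0.
  rewrite /w; field; rewrite ?gt_eqF ?psi_gt0//.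
- by rewrite invr_gt0.
- by move=> f; exact: Mnorm_ge0.
Unshelve. all: by end_near. Qed.

End LacunaryNotGrothendieck.

(** * Necessity of the conditions *)

Section Necessity.
Variables (R : realType) (gamma : \bar R) (psi : R -> R).
Local Notation I := (Ioo0 gamma).
Local Notation V := (Mpsi gamma psi).
Local Notation nrm := (Mnorm gamma psi).
Hypothesis cw : concave_weight gamma psi.
Let psi_mono := cw_mono cw.

Let psi_gt0 := psi_gt0 cw.

Let psi_star := psi_star cw.

Let I0 := Ioo0_neq0 cw.

(** The threshold 1 + 1/m is chosen so that the increase (m-1)/m psi(t) allowed by [psi_mult] stays
    below psi(t). *)
Lemma psi_mult_le2 (m t : R) : 2 <= m -> I (m * t) -> 0 < t ->
  psi (2 * t) < (1 + m^-1) * psi t -> psi (m * t) <= 2 * psi t.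
Proof.
move=> m2 [_ mtg] t0 H.
have It : I t.
  apply: (@Ioo0_le _ _ _ (m * t)) => //; last by split => //; rewrite mulr_gt0//; lra.
  by rewrite ler_peMl ?(ltW t0)//; lra.
have pt := psi_gt0 It.
apply: le_trans (psi_mult cw m2 t0 mtg) _.
have m0 : 0 < m by lra.
have mV : 0 < m^-1 by rewrite invr_gt0.
have E : m * m^-1 = 1 by rewrite divff// gt_eqF.
have : (m - 1) * (psi (2 * t) - psi t) <= (m - 1) * (m^-1 * psi t).
  rewrite ler_wpM2l//; first by lra.
  by apply: ltW; lra.
have -> : (m - 1) * (m^-1 * psi t) = psi t - m^-1 * psi t by rewrite mulrBl mul1r mulrA E mul1r.
have : 0 < m^-1 * psi t by exact: mulr_gt0.
lra.
Qed.

(** A term is the minimum of psi(t_n) and s psi(t_n)/t_n, and it is at most psi(s). Of these two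
    entries one at least doubles and the other at least halves along the sequence: the first
    alternative serves scales tending to 0, the second scales tending to infinity. *)
Lemma lacunary_bound (t : nat -> R) : (forall n, I (t n)) ->
  ((forall n, 2 * (psi (t n) / t n) <= psi (t n.+1) / t n.+1 /\ 2 * psi (t n.+1) <= psi (t n)) \/
   (forall n, 2 * psi (t n) <= psi (t n.+1) /\
     2 * (psi (t n.+1) / t n.+1) <= psi (t n) / t n)) ->
  forall M s, I s ->
  \sum_(0 <= n < M) psi (t n) / t n * Num.min s (t n) <= 4 * psi s.
Proof.
move=> It H M s Is; have [s0 sg] := Is.
have t0 n : 0 < t n by case: (It n).
have r0 n : 0 < psi (t n) / t n by rewrite divr_gt0// psi_gt0.
have y0 n : 0 <= psi (t n) / t n * Num.min s (t n).
  by rewrite mulr_ge0 ?(ltW (r0 _))// le_min !ltW.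
have rt n : psi (t n) / t n * t n = psi (t n) by rewrite divfK// gt_eqF.
have ys n : psi (t n) / t n * Num.min s (t n) <= psi s.
  have [st|ts] := leP s (t n).
    by rewrite mulrAC ler_pdivrMr// mulrC [_ * t n]mulrC psi_star.
  by rewrite rt; apply: psi_mono => //; exact: ltW.
have yle n : psi (t n) / t n * Num.min s (t n) <= psi (t n) / t n * s.
  by rewrite ler_wpM2l ?(ltW (r0 _))// ge_min lexx.
have yle' n : psi (t n) / t n * Num.min s (t n) <= psi (t n).
  by rewrite -[leRHS]rt ler_wpM2l ?(ltW (r0 _))// ge_min lexx orbT.
case: H => H.
  apply: (@lacunary_sum _ _ _ (fun n => psi (t n) / t n * s)) => //.
  - by move=> n; have [h _] := H n; rewrite mulrA ler_pM2r.
  - move=> n; rewrite ltr_pM2l// gt_min ltxx/= => ts; have [_ h] := H n.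
    rewrite [leRHS](_ : _ = psi (t n)).
      by apply: le_trans h; rewrite ler_pM2l.
    by rewrite (min_idPr (ltW ts)) rt.
apply: (@lacunary_sum _ _ _ (fun n => psi (t n))) => //.
- by move=> n; case: (H n).
- move=> n; rewrite -{2}rt ltr_pM2l// gt_min ltxx orbF => st; have [_ h] := H n.
  rewrite [leRHS](_ : _ = psi (t n) / t n * s); last by rewrite (min_idPl (ltW st)).
  apply: (@le_trans _ _ (2 * (psi (t n.+1) / t n.+1 * s))).
    by rewrite ler_pM2l.
  by rewrite mulrA ler_pM2r.
Qed.

Lemma near0_not_Grothendieck :
  ~ (1 < limf_einf (fun t : R => (psi (2 * t) / psi t)%:E) ((0:R)^'+))%E ->
  ~ Grothendieck V nrm.
Proof.
move=> nC.
have key (m d : R) : 2 <= m -> I d ->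
    exists t, [/\ 0 < t, m * t <= d & psi (m * t) <= 2 * psi t].
  move=> m2 Id; have m0 : 0 < m by lra.
  have [d0 _] := Id.
  apply: contrapT => nt; apply: nC; apply/limf_einf_gt1P.
  exists (1 + m^-1); first by rewrite ltrDl invr_gt0.
  near=> t.
  have t0 : 0 < t by near: t; exact: nbhs_right_gt.
  have mtd : m * t <= d.
    rewrite -ler_pdivlMl// mulrC; near: t; apply: nbhs_right_le.
    exact: divr_gt0.
  have Imt : I (m * t) by apply: Ioo0_le mtd Id; rewrite mulr_gt0.
  have It : I t.
    by apply: (@Ioo0_le _ _ _ (m * t)) => //; rewrite ler_peMl ?(ltW t0)//; lra.
  rewrite /= leNgt; apply/negP; rewrite ltr_pdivrMr ?psi_gt0// => H.
  by apply: nt; exists t; split => //; exact: psi_mult_le2.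
(* If psi stays above some k > 0, dyadic intervals shrinking to 0 span a copy of l^1; otherwise psi
   tends to 0, and scales can be chosen along which it halves. *)
have [[k [k0 Hk]]|small] := pselect (exists k, 0 < k /\ forall t, I t -> k <= psi t).
  have [r Ir] := I0; have [r0 rg] := Ir.
  apply: (@local_L1_not_Grothendieck _ _ _ psi_gt0 I0
    (fun l => r * 2^-1 ^+ l.+1) (fun l => r * 2^-1 ^+ l) (psi r) k) => //.
  - by move=> l; rewrite ltr_pM2l// exprS gtr_pMl ?exprn_gt0//; lra.
  - move=> l x /=; rewrite in_itv/= => /andP[h1 h2]; split.
      by apply: lt_trans h1; rewrite mulr_gt0// exprn_gt0.
    apply: lt_trans rg; rewrite lte_fin; apply: (lt_le_trans h2).
    by rewrite ler_piMr ?(ltW r0)// exprn_ile1//; lra.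
  - move=> l m _ _ [x []] /=; rewrite !in_itv/= => /andP[l1 l2] /andP[m1 m2].
    have H (i j : nat) : r * 2^-1 ^+ i.+1 < x -> x < r * 2^-1 ^+ j -> (j <= i)%N.
      move=> h1 h2; have := lt_trans h1 h2; rewrite ltr_pM2l// => h.
      rewrite leqNgt; apply/negP => ij; move: h; apply/negP; rewrite -leNgt.
      by rewrite ler_wiXn2l//; lra.
    by apply/eqP; rewrite eqn_leq !H.
  - move=> n; exists r; split => //.
    have -> : \sum_(0 <= l < n) (r * 2^-1 ^+ l - r * 2^-1 ^+ l.+1) = r - r * 2^-1 ^+ n.
      elim: n => [|n IH]; first by rewrite big_geq// expr0 mulr1 subrr.
      by rewrite big_nat_recr//= IH addrA subrK.
    by rewrite lerBlDr lerDl mulr_ge0 ?(ltW r0)// exprn_ge0.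
  - move=> m t It; apply: le_trans (Hk _ It).
    by rewrite ler_piMr ?(ltW k0)// ge_min lexx.
have step (p : nat * R) : exists t', I p.2 ->
    [/\ I t', I ((p.1.+1%:R + 1) * t'), psi ((p.1.+1%:R + 1) * t') <= 2 * psi t',
        (p.1.+1%:R + 1) * t' <= p.2 &
        2 * (psi p.2 / p.2) <= psi t' / t' /\ 2 * psi t' <= psi p.2].
  case: p => n t /=; have [It|] := pselect (I t); last by exists 0.
  have pt := psi_gt0 It; have [t0 _] := It.
  have [s [Is ps]] : exists s, I s /\ 2 * psi s <= psi t.
    apply: contrapT => ns; apply: small; exists (psi t / 2); split; first by lra.
    move=> s Is; rewrite leNgt; apply/negP => ps; apply: ns; exists s; split => //; lra.
  (* By [psi_star], m t' psi(t) <= t psi(m t') <= 2 t psi(t'), so m >= 4 doubles psi(t)/t. The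
     summand n+1 leaves room below t for block n+1. *)
  pose m : R := n.+1%:R + 4.
  have n0 : 0 <= (n.+1%:R : R) by rewrite ler0n.
  have m2 : 2 <= m by rewrite /m; lra.
  have m0 : 0 < m by lra.
  have Id : I (Num.min s t).
    by apply: (@Ioo0_le _ _ _ t) => //; [rewrite lt_min t0; case: Is => ->|rewrite ge_min lexx orbT].
  have [t' [t'0 mt' pm]] := key m _ m2 Id.
  have mts : m * t' <= s by apply: le_trans mt' _; rewrite ge_min lexx.
  have mtt : m * t' <= t by apply: le_trans mt' _; rewrite ge_min lexx orbT.
  have Imt : I (m * t') by apply: Ioo0_le mtt It; rewrite mulr_gt0.
  have kt : (n.+1%:R + 1) * t' <= m * t' by rewrite ler_pM2r// /m; lra.
  have k0 : 0 < (n.+1%:R + 1) * t' by rewrite mulr_gt0//; lra.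
  have tk : t' <= m * t' by rewrite ler_peMl ?(ltW t'0)//; lra.
  exists t' => _; split.
  - exact: Ioo0_le tk Imt.
  - exact: Ioo0_le kt Imt.
  - by apply: le_trans pm; apply: psi_mono => //; [exact: ltW|case: Imt].
  - exact: le_trans mtt.
  split; last first.
    apply: le_trans ps; rewrite ler_pM2l//; apply: psi_mono; first exact: ltW.
      exact: le_trans mts.
    by case: Is.
  rewrite mulrA ler_pdivrMr// mulrAC ler_pdivlMr//.
  have H := psi_star (mulr_gt0 m0 t'0) mtt It.
  have H4 : 4 * (t' * psi t) <= m * (t' * psi t).
    by rewrite ler_wpM2r ?mulr_ge0 ?(ltW pt) ?(ltW t'0)// /m; lra.
  have H5 : t * psi (m * t') <= t * (2 * psi t') by rewrite ler_pM2l.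
  have -> : psi t' * t = t * psi t' by rewrite mulrC.
  have -> : 2 * psi t * t' = 2 * (t' * psi t) by ring.
  have E : m * t' * psi t = m * (t' * psi t) by ring.
  have E2 : t * (2 * psi t') = 2 * (t * psi t') by ring.
  lra.
have [nx Hnx] := choice step.
have [r Ir] := I0.
pose t_ := fix t_ n : R := if n is k.+1 then nx (k, t_ k) else r.
have It n : I (t_ n).
  by elim: n => [//|n IH]; have [] := Hnx (n, t_ n) IH.
have tS n : t_ n.+1 = nx (n, t_ n) by [].
have H n := Hnx (n, t_ n) (It n).
have dec m n : (m < n)%N -> (n%:R + 1) * t_ n <= t_ m.
  elim: n => // n IH; rewrite ltnS leq_eqVlt => /predU1P[->|/IH mn].
    by have [_ _ _ + _] := H n.
  have [_ _ _ h _] := H n; apply: le_trans h _; apply: le_trans mn.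
  by rewrite ler_peMl ?lerDr ?ler0n//; case: (It n) => /ltW.
apply: (@lacunary_not_Grothendieck _ _ _ psi_gt0 I0 t_).
- by move=> n; case: (It n).
- case=> [|n]; first by rewrite add0r mul1r; case: (It 0%N).
  by have [_ [_ +] _ _ _] := H n; rewrite -tS.
- case=> [|n]; last by have [_ _ + _ _] := H n; rewrite -tS.
  by rewrite add0r mul1r; have := psi_gt0 (It 0%N); lra.
- move=> m n; rewrite neq_ltn => /orP[mn|nm]; [right|left]; exact: dec.
- apply: lacunary_bound => //; left => n.
  by have [_ _ _ _ +] := H n; rewrite -tS.
Unshelve. all: by end_near. Qed.

Lemma infty_not_Grothendieck : gamma = +oo%E ->
  ~ (1 < limf_einf (fun t : R => (psi (2 * t) / psi t)%:E) (pinfty_nbhs R))%E ->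
  ~ Grothendieck V nrm.
Proof.
move=> gy nC.
have IE t : 0 < t -> I t by move=> t0; split => //; rewrite gy ltry.
have key (m T : R) : 2 <= m -> exists t, [/\ 0 < t, T < t & psi (m * t) <= 2 * psi t].
  move=> m2; have m0 : 0 < m by lra.
  apply: contrapT => nt; apply: nC; apply/limf_einf_gt1P.
  exists (1 + m^-1); first by rewrite ltrDl invr_gt0.
  near=> t.
  have t0 : 0 < t by near: t; exact: nbhs_pinfty_gt.
  have tT : T < t by near: t; apply: nbhs_pinfty_gt; rewrite num_real.
  rewrite /= leNgt; apply/negP; rewrite ltr_pdivrMr ?psi_gt0//; last exact: IE.
  move=> H; apply: nt; exists t; split => //; apply: psi_mult_le2 => //.
  by apply: IE; rewrite mulr_gt0.
(* A bounded psi makes the intervals ]l, l+1[ span a copy of l^1; an unbounded one allows scales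
   along which psi doubles. *)
have [[D HD]|unb] := pselect (exists D, forall t, 0 < t -> psi t <= D).
  apply: (@local_L1_not_Grothendieck _ _ _ psi_gt0 I0
    (fun l => l%:R) (fun l => l%:R + 1) D (psi 1)).
  - by move=> l; lra.
  - move=> l x /=; rewrite in_itv/= => /andP[h1 _]; apply: IE.
    exact: le_lt_trans h1.
  - move=> l m _ _ [x []] /=; rewrite !in_itv/= => /andP[l1 l2] /andP[m1 m2].
    have H (i j : nat) : i%:R < x -> x < j%:R + 1 -> (i <= j)%N.
      by move=> h1 h2; have := lt_trans h1 h2; rewrite natr1 ltr_nat ltnS.
    by apply/eqP; rewrite eqn_leq !H.
  - move=> n; exists (n%:R + 1).
    have n0 : 0 < (n%:R : R) + 1 by rewrite ltr_wpDl.
    split; [exact: IE| |exact: HD].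
    under eq_bigr do rewrite addrAC subrr add0r.
    by rewrite sumr_const_nat subn0 lerDl.
  - by apply: psi_gt0; exact: IE.
  - move=> m t It; have [t0 tg] := It; rewrite addrAC subrr add0r divr1.
    have p1 : 0 <= psi 1 by apply: ltW; apply: psi_gt0; exact: IE.
    have [t1|t1] := leP t 1.
      have := psi_star t0 t1 (IE _ ltr01); rewrite mul1r => H.
      by rewrite mulrC (le_trans _ H)// ler_wpM2r// ge_min lexx orbT.
    rewrite (le_trans (_ : _ <= psi 1))//; first by rewrite ler_piMr// ge_min lexx.
    exact: (psi_mono ler01 (ltW t1) tg).
have step (p : nat * R) : exists t', I p.2 ->
    [/\ I t', I ((p.1.+1%:R + 1) * t'), psi ((p.1.+1%:R + 1) * t') <= 2 * psi t',
        (p.1%:R + 1) * p.2 <= t' &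
        2 * psi p.2 <= psi t' /\ 2 * (psi t' / t') <= psi p.2 / p.2].
  case: p => n t /=; have [It|] := pselect (I t); last by exists 0.
  have pt := psi_gt0 It; have [t0 _] := It.
  have [z [z0 pz]] : exists z, 0 < z /\ 2 * psi t < psi z.
    apply: contrapT => nz; apply: unb; exists (2 * psi t) => z z0.
    by rewrite leNgt; apply/negP => pz; apply: nz; exists z.
  (* An intermediate scale halves psi(t)/t: for t' > 4s, [psi_star] gives psi(t')/t' <= psi(4s)/(4s)
     <= psi(s)/(2s) <= psi(t)/(2t). *)
  have [s [s0 ts ps]] := key 4 t ltac:(lra).
  pose m : R := n.+1%:R + 4.
  have n0 : 0 <= (n.+1%:R : R) by rewrite ler0n.
  have m2 : 2 <= m by rewrite /m; lra.
  have [t' [t'0 Tt' pt']] := key m (Num.max (4 * s) (Num.max z ((n%:R + 1) * t))) m2.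
  move: Tt'; rewrite !gt_max => /and3P[st' zt' ntt'].
  have k0 : 0 < (n.+1%:R + 1) * t' by rewrite mulr_gt0//; lra.
  exists t' => _; split.
  - exact: IE.
  - exact: IE.
  - apply: le_trans pt'; apply: psi_mono; first exact: ltW.
      by rewrite ler_pM2r// /m; lra.
    by rewrite gy ltry.
  - exact: ltW.
  split.
    apply: (le_trans (ltW pz)); apply: psi_mono; [exact: ltW|exact: ltW|].
    by rewrite gy ltry.
  rewrite mulrA ler_pdivrMr// mulrAC ler_pdivlMr//.
  have H1 := psi_star (mulr_gt0 (ltr0Sn _ 3) s0) (ltW st') (IE _ t'0).
  have H2 := psi_star t0 (ltW ts) (IE _ s0).
  have H3 : t' * psi (4 * s) <= t' * (2 * psi s) by rewrite ler_pM2l.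
  have H4 : 2 * s * psi t' <= t' * psi s.
    have E1 : 4 * s * psi t' = 2 * (2 * s * psi t') by ring.
    have E2 : t' * (2 * psi s) = 2 * (t' * psi s) by ring.
    by lra.
  have H5 : t * (2 * s * psi t') <= t * (t' * psi s) by rewrite ler_pM2l.
  have H6 : t' * (t * psi s) <= t' * (s * psi t) by rewrite ler_pM2l.
  rewrite -(ler_pM2l s0).
  have E1 : t * (2 * s * psi t') = s * (2 * psi t' * t) by ring.
  have E2 : t * (t' * psi s) = t' * (t * psi s) by ring.
  have E3 : t' * (s * psi t) = s * (psi t * t') by ring.
  lra.
have [nx Hnx] := choice step.
have [r Ir] := I0.
pose t_ := fix t_ n : R := if n is k.+1 then nx (k, t_ k) else r.
have It n : I (t_ n).
  by elim: n => [//|n IH]; have [] := Hnx (n, t_ n) IH.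
have tS n : t_ n.+1 = nx (n, t_ n) by [].
have H n := Hnx (n, t_ n) (It n).
have inc m n : (m < n)%N -> (m%:R + 1) * t_ m <= t_ n.
  elim: n => // n IH; rewrite ltnS leq_eqVlt => /predU1P[->|/IH mn].
    by have [_ _ _ + _] := H n.
  have [_ _ _ h _] := H n; apply: le_trans h; apply: le_trans mn _.
  by rewrite ler_peMl ?lerDr ?ler0n//; case: (It n) => /ltW.
apply: (@lacunary_not_Grothendieck _ _ _ psi_gt0 I0 t_).
- by move=> n; case: (It n).
- by move=> n; rewrite gy ltry.
- case=> [|n]; last by have [_ _ + _ _] := H n; rewrite -tS.
  by rewrite add0r mul1r; have := psi_gt0 (It 0%N); lra.
- move=> m n; rewrite neq_ltn => /orP[mn|nm]; [left|right]; exact: inc.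
- apply: lacunary_bound => //; right => n.
  by have [_ _ _ _ +] := H n; rewrite -tS.
Unshelve. all: by end_near. Qed.

End Necessity.

(** * Subsequences *)

Definition incr (s : nat -> nat) := {homo s : m n / (m < n)%N}.

Lemma incr_ge (s : nat -> nat) : incr s -> forall n, (n <= s n)%N.
Proof. by move=> si; elim=> // n /leq_ltn_trans; apply; exact: si. Qed.

Lemma incr_inj (s : nat -> nat) : incr s -> injective s.
Proof. by move=> si m n E; case: (ltngtP m n) => // /si; rewrite E ltnn. Qed.

Lemma incr_ltn (s : nat -> nat) : (forall n, s n < s n.+1)%N -> incr s.
Proof.
move=> sS m n; elim: n => // n IH; rewrite ltnS leq_eqVlt => /predU1P[->//|/IH mn].
exact: ltn_trans (sS n).
Qed.

Lemma infinitely_incr (P : nat -> Prop) : (forall N, exists2 n, (N <= n)%N & P n) ->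
  exists2 s, incr s & forall k, P (s k).
Proof.
move=> HP.
have /choice[g Hg] : forall N, exists n, (N <= n)%N /\ P n.
  by move=> N; have [n Nn Pn] := HP N; exists n.
pose s := fix s k := if k is k'.+1 then g (s k').+1 else g 0%N.
exists s; first by apply: incr_ltn => n /=; have [] := Hg (s n).+1.
by case=> [|k] /=; [have [] := Hg 0%N|have [] := Hg (s k).+1].
Qed.

Lemma cvg_incr (R : realType) (x : nat -> R) (l : R) (s : nat -> nat) : incr s ->
  x n @[n --> \oo] --> l -> x (s n) @[n --> \oo] --> l.
Proof.
move=> si xl; apply: (cvg_comp _ _ _ xl) => A [N _ NA]; exists N => // n /= Nn.
by apply: NA => /=; exact: leq_trans (incr_ge si n).
Qed.

(** * Gliding humps *)

Section BrooksJewett.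
Variables (R : realType) (X : Type) (AA : set (set X)) (B : set (X -> R)).
Implicit Types (A : set X) (F H : X -> R) (u : (X -> R) -> R).
Hypothesis AA0 : AA set0.
Hypothesis AAU : forall A : nat -> set X, (forall n, AA (A n)) -> AA (\bigcup_n A n).
Hypothesis AAD : forall A A', AA A -> AA A' -> AA (A `\` A').
Hypothesis B0 : B (fun=> 0).
Hypothesis glue : forall (A : nat -> set X) (F : nat -> X -> R) H,
  (forall k, AA (A k)) -> trivIset setT A -> (forall k, B (F k)) ->
  (forall k x, A k x -> H x = F k x) -> (forall x, (forall k, ~ A k x) -> H x = 0) ->
  B H.

(** For H in B, the map sending A to u(H restricted to A) is then a bounded finitely additive
    measure on AA. [small] asks for smallness uniformly in H, so the classical theorems on sequences
    of such measures are proved here for all H at once. *)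
Definition fadd u := [/\ forall F H, B F -> B H -> u (F + H) = u F + u H,
  forall F, B F -> B (- F) /\ u (- F) = - u F & exists M, forall F, B F -> `|u F| <= M].

Definition small u A (d : R) := forall H, B H -> `|u (H \_ A)| <= d.

Lemma AA_bigcup (P : set nat) (A : nat -> set X) : (forall n, AA (A n)) ->
  AA (\bigcup_(n in P) A n).
Proof.
move=> HA; rewrite bigcup_mkcond; apply: AAU => n.
by case: ifP.
Qed.

Lemma AAI A A' : AA A -> AA A' -> AA (A `&` A').
Proof. by move=> HA HA'; rewrite -setDD; apply: AAD => //; exact: AAD. Qed.

Lemma glue2 A A' F F' : AA A -> AA A' -> A `&` A' = set0 -> B F -> B F' ->
  B (F \_ A + F' \_ A').
Proof.
move=> HA HA' AA'0 BF BF'.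
apply: (@glue (bigcup2 A A') (fun k => if k is 0%N then F else F')).
- by move=> n; rewrite /bigcup2; case: ifP => // _; case: ifP.
- by rewrite -trivIset_bigcup2 //.
- by case.
- have H x : (F \_ A + F' \_ A') x = (F \_ A) x + (F' \_ A') x by [].
  case=> [|[|k]] x; rewrite /bigcup2/= H !patchE// => Ax.
    rewrite mem_set// memNset ?addr0// => A'x.
    by have : (A `&` A') x by []; rewrite AA'0.
  rewrite [x \in A']mem_set// memNset ?add0r// => A'x.
  by have : (A `&` A') x by []; rewrite AA'0.
- move=> x nA.
  have H : (F \_ A + F' \_ A') x = (F \_ A) x + (F' \_ A') x by [].
  rewrite H !patchE !memNset ?addr0//.
    exact: (nA 1%N).
  exact: (nA 0%N).
Qed.

Lemma B_restr A F : AA A -> B F -> B (F \_ A).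
Proof.
move=> HA BF; have := @glue2 A set0 F F HA AA0 (setI0 _) BF BF.
by congr B; apply/funext => x; rewrite /GRing.add/= restrict_set0 addr0.
Qed.

Lemma restr_restr A A' F : A `<=` A' -> (F \_ A) \_ A' = F \_ A.
Proof.
move=> AA'; apply/funext => x; rewrite !patchE.
case: (boolP (x \in A)) => [/set_mem/AA' Ax|]; last by case: ifP.
by rewrite mem_set.
Qed.

Lemma restrU A A' F : A `&` A' = set0 -> F \_ (A `|` A') = F \_ A + F \_ A'.
Proof.
move=> AA'0; apply/funext => x; change ((F \_ (A `|` A')) x = (F \_ A) x + (F \_ A') x).
rewrite !patchE.
have [Ax|nAx] := pselect (A x).
  rewrite mem_set; last by left.
  rewrite mem_set// memNset ?addr0// => A'x.
  by have : (A `&` A') x by []; rewrite AA'0.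
rewrite [x \in A]memNset// add0r.
have [A'x|nA'x] := pselect (A' x); first by rewrite !mem_set//; right.
by rewrite !memNset// => -[].
Qed.

Lemma fadd0 u : fadd u -> u (fun=> 0) = 0.
Proof.
move=> [uD _ _]; have := uD _ _ B0 B0.
have -> : (fun=> 0) + (fun=> 0) = (fun=> 0) :> (X -> R).
  by apply/funext => x; change (0 + 0 = 0 :> R); rewrite addr0.
by move/eqP; rewrite addrC -subr_eq subrr eq_sym => /eqP.
Qed.

Lemma fadd_restrU u A A' F : fadd u -> AA A -> AA A' -> A `&` A' = set0 -> B F ->
  u (F \_ (A `|` A')) = u (F \_ A) + u (F \_ A').
Proof.
by move=> [uD _ _] HA HA' AA'0 BF; rewrite restrU// uD//; exact: B_restr.
Qed.

Lemma small0 u d : fadd u -> 0 <= d -> small u set0 d.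
Proof. by move=> fu d0 H _; rewrite restrict_set0 fadd0// normr0. Qed.

Lemma smallS u A A' d : AA A -> A `<=` A' -> small u A' d -> small u A d.
Proof.
move=> HA AA' sA H BH; rewrite -(restr_restr H AA'); apply: sA.
exact: B_restr.
Qed.

Lemma smallW u A d d' : d <= d' -> small u A d -> small u A d'.
Proof. by move=> dd sA H BH; exact: le_trans (sA _ BH) dd. Qed.

Lemma smallU u A A' d d' : fadd u -> AA A -> AA A' ->
  small u A d -> small u A' d' -> small u (A `|` A') (d + d').
Proof.
move=> fu HA HA' sA sA' H BH.
have -> : A `|` A' = A `|` (A' `\` A).
  apply/seteqP; split => x [Ax|Ax]; [by left| |by left|by right; case: Ax].
  by have [?|?] := pselect (A x); [left|right].
rewrite fadd_restrU//; last by rewrite setDIK.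
  apply: le_trans (ler_normD _ _) _; apply: lerD; first exact: sA.
  have : A' `\` A `<=` A' by move=> x [].
  by move=> /(smallS (AAD HA' HA))/(_ sA'); apply.
exact: AAD.
Qed.

Lemma small_bigcup u (E : nat -> set X) (d : nat -> R) n : fadd u ->
  (forall l, AA (E l)) -> (forall l, (l < n)%N -> small u (E l) (d l)) ->
  small u (\bigcup_(l in [set l | (l < n)%N]) E l) (\sum_(0 <= l < n) d l).
Proof.
move=> fu HE; elim: n => [|n IH] sE.
  rewrite big_geq// (_ : \bigcup_(l in _) _ = set0); first exact: small0.
  by apply/seteqP; split => x // [].
rewrite big_nat_recr//=.
rewrite (_ : \bigcup_(l in _) _ =
  (\bigcup_(l in [set l | (l < n)%N]) E l) `|` E n); last first.
  apply/seteqP; split => x.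
    move=> [l /=]; rewrite ltnS leq_eqVlt => /predU1P[->|ln Ex]; [by right|left].
    by exists l.
  by move=> [[l /= ln Ex]|Ex]; [exists l => //=; exact: ltnW|exists n => /=].
apply: smallU => //; first exact: AA_bigcup.
  by apply: IH => l ln; apply: sE; exact: ltnW.
exact: sE.
Qed.

(** Otherwise, split the indices into even and odd ones again and again: every subsequence carries a
    value above d, the pieces can be glued, and after N splittings u reaches N d, against
    boundedness. *)
Lemma tail_small u (A : nat -> set X) (d : R) : fadd u -> (forall k, AA (A k)) ->
  trivIset setT A -> 0 < d ->
  exists2 r, incr r & small u (\bigcup_k A (r k)) d.
Proof.
move=> fu HA tA d0; apply: contrapT => nr.
have nr' r : incr r -> exists2 H, B H & d < `|u (H \_ (\bigcup_k A (r k)))|.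
  move=> ri; apply: contrapT => nH; apply: nr; exists r => // H BH.
  by rewrite leNgt; apply/negP => uH; apply: nH; exists H.
have HU (r : nat -> nat) : AA (\bigcup_k A (r k)).
  by apply: (AAU (A := fun k => A (r k))) => k.
have [uD uN [M uM]] := fu.
have S N : forall r, incr r -> exists2 H, B H & N%:R * d <= u (H \_ (\bigcup_k A (r k))).
  elim: N => [|N IH] r ri.
    exists (fun=> 0); first exact: B0.
    rewrite mul0r (_ : _ \_ _ = fun=> 0) ?fadd0//.
    by apply/funext => x; rewrite patchE; case: ifP.
  pose r1 k := r k.*2; pose r2 k := r k.*2.+1.
  have r1i : incr r1 by move=> m n mn; apply: ri; rewrite ltn_double.
  have r2i : incr r2 by move=> m n mn; apply: ri; rewrite ltnS ltn_double.
  have inj m n : r m = r n -> m = n.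
    exact: incr_inj.
  set U1 := \bigcup_k A (r1 k); set U2 := \bigcup_k A (r2 k).
  have U12 : U1 `&` U2 = set0.
    apply/seteqP; split => x // [[k _ h1] [j _ h2]].
    have : r1 k = r2 j by apply: tA => //; exists x.
    by move/inj/(congr1 odd); rewrite /= !odd_double.
  have UE : \bigcup_k A (r k) = U1 `|` U2.
    apply/seteqP; split => x.
      move=> [k _ Ax]; rewrite -[k]odd_double_half in Ax.
      by case: (odd k) Ax => Ax; [right|left]; exists k./2.
    by move=> [] [k _ Ax]; [exists k.*2|exists k.*2.+1].
  have [H1 BH1 h1] := IH _ r1i.
  have [H2 BH2 h2] : exists2 H, B H & d < u (H \_ U2).
    have [H BH] := nr' _ r2i; rewrite ltr_normr => /orP[h|h]; first by exists H.
    have [BN _] := uN _ BH; exists (- H) => //.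
    have [_ E] := uN _ (B_restr (HU r2) BH); rewrite -E in h.
    rewrite (_ : (- H) \_ U2 = - (H \_ U2))//.
    apply/funext => x; change (((- H) \_ U2) x = - (H \_ U2) x).
    by rewrite !patchE; case: ifP => // _; rewrite oppr0.
  have BH := glue2 (HU r1) (HU r2) U12 BH1 BH2.
  exists (H1 \_ U1 + H2 \_ U2) => //.
  rewrite (_ : _ \_ _ = H1 \_ U1 + H2 \_ U2).
    rewrite uD; [|exact: B_restr (HU r1) BH1|exact: B_restr (HU r2) BH2].
    by rewrite -natr1 mulrDl mul1r; apply: lerD; [exact: h1|exact: ltW].
  apply/funext => x; rewrite patchE; case: ifPn => // /negP nU.
  change (0 = (H1 \_ U1) x + (H2 \_ U2) x).
  rewrite !patchE !memNset ?addr0// => Ux; apply: nU; apply/mem_set; rewrite UE.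
    by right.
  by left.
have [N HN] : exists N : nat, M < N%:R * d.
  exists (Num.bound `|M / d|); rewrite -ltr_pdivrMr//.
  exact: le_lt_trans (ler_norm _) (archi_boundP (normr_ge0 _)).
have [H BH h] := S N id (fun _ _ => id).
have := uM _ (B_restr (HU id) BH); have := le_trans h (ler_norm _).
by move=> /le_trans /[apply]; rewrite leNgt HN.
Qed.

(** A form of Phillips' lemma. Indices n_k are picked so that v at n_k is small on the earlier
    pieces, by pointwise convergence, and on all later ones, by [tail_small]. On the glued function
    H its modulus then stays at least eps/2, although v n H tends to 0. *)
Lemma phillips (v : nat -> (X -> R) -> R) (A : nat -> set X) (F : nat -> X -> R)
    (eps : R) : (forall n, fadd (v n)) ->
  (forall H, B H -> v n H @[n --> \oo] --> 0) -> (forall k, AA (A k)) ->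
  trivIset setT A -> (forall k, B (F k)) -> 0 < eps ->
  exists k, `|v k (F k \_ (A k))| < eps.
Proof.
move=> fv v0 HA tA BF e0; apply: contrapT => nk.
have big k : eps <= `|v k (F k \_ (A k))|.
  by rewrite leNgt; apply/negP => h; apply: nk; exists k.
have e4 : 0 < eps / 4 by lra.
(* A state holds the subsequence still available and the indices already chosen; a step picks n from
   the former and thins it until its union is eps/4-small for v n. *)
pose Rel (p q : (nat -> nat) * seq nat) := incr p.1 -> exists n,
  [/\ q.2 = n :: p.2, (exists m, n = p.1 m),
      \sum_(l <- p.2) `|v n (F l \_ (A l))| <= eps / 4,
      incr q.1 /\ (forall k, exists j, q.1 k = p.1 j /\ (n < p.1 j)%N) &
      small (v n) (\bigcup_k A (q.1 k)) (eps / 4)].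
have step p : {q | Rel p q}.
  apply: cid; case: p => s l; have [si|] := pselect (incr s); last by exists (s, l).
  have cl : (fun n => \sum_(l <- l) `|v n (F l \_ (A l))|) @ \oo --> 0.
    elim: l => [|h l IH].
      by under eq_fun do rewrite big_nil; exact: cvg_cst.
    under eq_fun do rewrite big_cons.
    have h0 : (fun n => `|v n (F h \_ (A h))|) @ \oo --> 0.
      by rewrite -(@normr0 _ R); apply: cvg_norm; apply: v0; exact: B_restr.
    have := cvgD h0 IH; rewrite addr0; exact.
  have /cvgr_le/(_ _ e4)[N _ HN] := cl.
  pose n := s N.
  have tr : trivIset setT (fun k => A (s (N.+1 + k)%N)).
    move=> i j _ _ [x [Ai Aj]].
    have E : s (N.+1 + i)%N = s (N.+1 + j)%N by apply: tA => //; exists x.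
    by apply/eqP; rewrite -(eqn_add2l N.+1); apply/eqP; exact: incr_inj E.
  have [r ri sr] := tail_small (fv n) (fun k => HA (s (N.+1 + k)%N)) tr e4.
  exists (fun k => s (N.+1 + r k)%N, n :: l) => _; exists n; split => //=.
  - by exists N.
  - by apply: HN => /=; exact: (incr_ge si N).
  - split=> [a b ab|k]; first by apply: si; rewrite ltn_add2l; exact: ri.
    by exists (N.+1 + r k)%N; split => //; apply: si; rewrite addSn ltnS leq_addr.
have [f [f0 Hf]] := dependent_choice step (id, [::]).
have fi k : incr (f k).1.
  elim: k => [|k IH]; first by rewrite f0.
  by have [n [_ _ _ [] ]] := Hf k IH.
have /choice[n_ Hn] := fun k => Hf k (fi k).
have rng k j i : (k <= j)%N -> exists i', (f j).1 i = (f k).1 i'.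
  move=> kj; rewrite -(subnK kj); elim: (j - k)%N i => [|d IH] i; first by exists i.
  have [_ _ _ [_ /(_ i)[i' [-> _]]] _] := Hn (d + k)%N; exact: IH.
have nrng k j : (k < j)%N -> exists i, n_ j = (f k.+1).1 i.
  move=> kj; have [_ [m ->] _ _ _] := Hn j; exact: rng.
have ni : incr n_.
  move=> k j /nrng[i ->]; have [_ _ _ [_ /(_ i)[i' [-> //]]] _] := Hn k.
have ninj i j : n_ i = n_ j -> i = j.
  exact: incr_inj.
have tn : trivIset setT (fun k => A (n_ k)).
  by move=> i j _ _ h; apply: ninj; exact: tA h.
pose P x (y : R) := (forall k, A (n_ k) x -> y = F (n_ k) x) /\
  ((forall k, ~ A (n_ k) x) -> y = 0).
have /choice[H HH] : forall x, exists y, P x y.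
  move=> x; have [[k Ak]|nA] := pselect (exists k, A (n_ k) x).
    exists (F (n_ k) x); split => [j Aj|/(_ k)//].
    by have -> : j = k by apply: tn => //; exists x.
  by exists 0; split => // k Ak; exfalso; apply: nA; exists k.
have BH : B H.
  apply: (@glue (fun k => A (n_ k)) (fun k => F (n_ k))) => //.
    by move=> k x Ax; have [+ _] := HH x; apply.
  by move=> x nA; have [_] := HH x; apply.
have HA' k : H \_ (A (n_ k)) = F (n_ k) \_ (A (n_ k)).
  apply/funext => x; rewrite !patchE; case: ifPn => // /set_mem Ax.
  by have [+ _] := HH x; apply.
pose T k := \bigcup_(l in [set l | (k <= l)%N]) A (n_ l).
have AAT k : AA (T k) by exact: AA_bigcup.
have TE k : T k = A (n_ k) `|` T k.+1.
  apply/seteqP; split => x.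
    move=> [l /=]; rewrite leq_eqVlt => /predU1P[<-|kl Ax]; [by left|right].
    by exists l.
  by move=> [Ax|[l /= kl Ax]]; [exists k => /=|exists l => //=; exact: ltnW].
have TD k : A (n_ k) `&` T k.+1 = set0.
  apply/seteqP; split => x // [Ax [l /= kl Al]].
  have : n_ k = n_ l by apply: tA => //; exists x.
  by move/ninj => E; rewrite E ltnn in kl.
have HT0 : H = H \_ (T 0%N).
  apply/funext => x; rewrite patchE; case: ifPn => // /negP nT.
  have [_] := HH x; apply => k Ak; apply: nT; apply/mem_set.
  by exists k.
have dec j k : v j (H \_ (T 0%N)) =
    \sum_(l <- (f k).2) v j (F l \_ (A l)) + v j (H \_ (T k)).
  elim: k => [|k IH]; first by rewrite f0 big_nil add0r.
  have [-> _ _ _ _] := Hn k; rewrite big_cons IH {1}TE fadd_restrU//.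
  by rewrite HA' addrCA addrA.
have bigk k : eps / 2 <= `|v (n_ k) H|.
  have [E _ sl _ sm] := Hn k.
  rewrite HT0 (dec _ k.+1) E big_cons.
  have h1 : `|\sum_(l <- (f k).2) v (n_ k) (F l \_ (A l))| <= eps / 4.
    exact: le_trans (ler_norm_sum _ _ _) sl.
  have h2 : `|v (n_ k) (H \_ (T k.+1))| <= eps / 4.
    apply: (smallS (AAT _) _ sm) => //.
    move=> x [l /= kl Al]; have [i E'] := nrng k l kl.
    by exists i => //; rewrite -E'.
  have := big (n_ k).
  set p := v (n_ k) (F (n_ k) \_ _); set q := \sum_(l <- _) _; set r := v _ (H \_ _).
  move=> h3; have := ler_normB (p + (q + r)) (q + r).
  have := ler_normD q r; rewrite addrK -addrA; rewrite -/q -/r in h1 h2.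
  by lra.
have := cvg_incr ni (v0 _ BH).
move=> /cvgr0_norm_lt/(_ (eps / 2)) [|N _ /(_ N (leqnn N))]; first by lra.
by rewrite ltNge bigk.
Qed.

Lemma sum_half_le (m n : nat) : \sum_(m <= l < n) (2^-1 ^+ l : R) <= 2 * 2^-1 ^+ m.
Proof.
have p0 k : 0 < (2^-1 ^+ k : R) by rewrite exprn_gt0.
have [nm|mn] := leqP n m; first by rewrite big_geq// mulr_ge0// ltW.
suff : \sum_(m <= l < n) (2^-1 ^+ l : R) <= 2 * 2^-1 ^+ m - 2 * 2^-1 ^+ n.
  by have := p0 n; lra.
elim: n mn => // n IH; rewrite ltnS leq_eqVlt => /predU1P[->|/[dup] mn /IH H].
  by rewrite big_nat1 exprS; lra.
by rewrite big_nat_recr ?exprS/=; [lra|exact: ltnW].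
Qed.

(** Smallness on each A l does not pass to infinite unions, as the v n are only finitely additive;
    so finite unions C n stand in for the tails, up to small errors. On the decreasing intersections
    D n some v n must be small, since the differences are disjoint, and A n exceeds D n only by
    those errors. *)
Lemma brooks_jewett_ex (v : nat -> (X -> R) -> R) (A : nat -> set X) (eps : R) :
  (forall n, fadd (v n)) -> (forall H, B H -> v n H @[n --> \oo] --> 0) ->
  (forall k, AA (A k)) ->
  (forall m n, (m < n)%N -> small (v m) (A n) (2^-1 ^+ n)) -> 0 < eps ->
  exists n, small (v n) (A n) eps.
Proof.
move=> fv v0 HA sA e0; apply: contrapT => nn.
have p0 k : 0 < (2^-1 ^+ k : R) by rewrite exprn_gt0.
pose U n m := \bigcup_(l in [set l | (n <= l <= m)%N]) A l.
have AAUn n m : AA (U n m) by exact: AA_bigcup.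
have US n m m' : (m <= m')%N -> U n m `<=` U n m'.
  move=> mm x [l /= /andP[nl lm] Ax]; exists l => //=.
  by rewrite nl (leq_trans lm).
(* Beyond some m the unions U n m' gain only sets on which v m' is small: otherwise successive gains
   would be disjoint sets contradicting [phillips]. *)
have step1 n (d : R) : 0 < d -> exists m, (n <= m)%N /\
    forall m', (m <= m')%N -> small (v m') (U n m' `\` U n m) d.
  move=> d0; apply: contrapT => nm.
  have /choice[nx Hnx] : forall m, exists p : nat * (X -> R), (n <= m)%N ->
      [/\ (m < p.1)%N, B p.2 & d < `|v p.1 (p.2 \_ (U n p.1 `\` U n m))|].
    move=> m; have [nlm|] := boolP (n <= m)%N; last by exists (0%N, fun=> 0).
    apply: contrapT => np; apply: nm; exists m; split => // m' mm' H BH.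
    rewrite leNgt; apply/negP => h; apply: np; exists (m', H) => _; split => //=.
    rewrite ltn_neqAle mm' andbT; apply/eqP => E; move: h; rewrite -E setDv.
    by rewrite restrict_set0 fadd0// normr0 ltNge ltW.
  pose s := fix s k := if k is k'.+1 then (nx (s k')).1 else n.
  have ns k : (n <= s k)%N.
    elim: k => // k IH; have [h _ _] := Hnx _ IH.
    by apply: leq_trans IH _; exact: ltnW.
  have si : incr s by apply: incr_ltn => k; have [] := Hnx _ (ns k).
  have si' : incr (fun k => s k.+1) by move=> i j ij; apply: si.
  pose E k := U n (s k.+1) `\` U n (s k).
  have [||||||k] := @phillips (fun k => v (s k.+1)) E (fun k => (nx (s k)).2) d.
  - by move=> k; exact: fv.
  - by move=> H BH; exact: (cvg_incr si' (v0 _ BH)).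
  - by move=> k; exact: AAD.
  - have sub i j : (i < j)%N -> E i `&` E j = set0.
      move=> ij; apply/seteqP; split => x // [[Ui _] [_]]; apply.
      apply: US Ui; case: j ij => // j; rewrite ltnS => ij.
      have [->//|ij'] := eqVneq i j; apply: ltnW; apply: si.
      by rewrite ltnS ltn_neqAle ij'.
    move=> i j _ _ [x [Ei Ej]]; case: (ltngtP i j) => // h.
      by exfalso; have := sub _ _ h; rewrite -subset0 => /(_ x); apply.
    by exfalso; have := sub _ _ h; rewrite -subset0 => /(_ x); apply.
  - by move=> k; have [] := Hnx _ (ns k).
  - exact: d0.
  by have [_ _ h] := Hnx _ (ns k); rewrite ltNge ltW.
have /choice[M HM] := fun n => step1 n (eps / 6 * 2^-1 ^+ n)
  (mulr_gt0 (divr_gt0 e0 (ltr0Sn _ 5)) (p0 n)).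
pose C n := U n (M n).
pose D n := \bigcap_(l in [set l | (l <= n)%N]) C l.
have AAD' n : AA (D n).
  elim: n => [|n IH].
    rewrite (_ : D 0%N = C 0%N)//; first exact: AAUn.
    apply/seteqP; split => x; first by apply.
    by move=> Cx l /=; rewrite leqn0 => /eqP ->.
  rewrite (_ : D n.+1 = D n `&` C n.+1); first exact: AAI IH (AAUn _ _).
  apply/seteqP; split => x.
    by move=> Dx; split; [move=> l /= ln; apply: Dx => /=; exact: leqW|by apply: Dx => /=].
  move=> [Dx Cx] l /=; rewrite leq_eqVlt => /predU1P[->//|]; rewrite ltnS.
  exact: Dx.
have DC n : D n `<=` C n by move=> x; apply => /=.
have DS m n : (m <= n)%N -> D n `<=` D m.
  by move=> mn x Dx l /= lm; apply: Dx => /=; exact: leq_trans lm mn.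
have smC j n : (j < n)%N -> small (v j) (C n) (2 * 2^-1 ^+ n).
  move=> jn; apply: (smallW (sum_half_le n (M n).+1)).
  have -> : \sum_(n <= l < (M n).+1) (2^-1 ^+ l : R) =
      \sum_(0 <= l < (M n).+1) (if (n <= l)%N then 2^-1 ^+ l else 0).
    rewrite (@big_cat_nat _ _ _ n 0 (M n).+1)//=; last by have [h _] := HM n; exact: leqW.
    rewrite [X in _ = X + _]big_nat [X in _ = X + _]big1 ?add0r; last first.
      by move=> l /andP[_ ln]; rewrite leqNgt ln.
    by rewrite big_nat [RHS]big_nat; apply: eq_bigr => l /andP[-> _].
  pose E l := if (n <= l)%N then A l else set0.
  apply: (@smallS _ _ (\bigcup_(l in [set l | (l < (M n).+1)%N]) E l)).
  - exact: AAUn.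
  - move=> x [l /= /andP[nl lM] Ax]; exists l => //=.
    by rewrite /E nl.
  apply: small_bigcup => //.
    by move=> l; rewrite /E; case: ifP.
  move=> l _; rewrite /E; case: ifPn => [nl|_]; last by apply: small0.
  by apply: sA; exact: leq_trans nl.
(* Otherwise pass to every K-th index: v (s k) is large on D (s k) but small on D (s k.+1), hence
   large on the difference, and the differences are disjoint. *)
have [n sn] : exists n, small (v n) (D n) (eps / 3).
  apply: contrapT => nD.
  have /choice[H HH] : forall n, exists H, B H /\ eps / 3 < `|v n (H \_ (D n))|.
    move=> n; apply: contrapT => nH; apply: nD; exists n => H BH.
    by rewrite leNgt; apply/negP => h; apply: nH; exists H.
  have [K K0] : exists K, (0 < K)%N /\ 2 * 2^-1 ^+ K <= eps / 6.
    have := @cvg_expr R 2^-1; rewrite ger0_norm// => /(_ ltac:(lra)).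
    move=> /cvgr_le/(_ (eps / 12))[|N _ HN]; first by lra.
    exists N.+1; split => //; have /= := HN N.+1 (leqnSn N); lra.
  case: K0 => K0 HK.
  pose s k := (k * K)%N.
  have si : incr s by move=> i j ij; rewrite /s ltn_mul2r K0.
  pose E k := D (s k) `\` D (s k.+1).
  have [||||||k] := @phillips (fun k => v (s k)) E (fun k => H (s k)) (eps / 6).
  - by move=> k; exact: fv.
  - by move=> F BF; exact: (cvg_incr si (v0 _ BF)).
  - by move=> k; exact: AAD.
  - have sub i j : (i < j)%N -> E i `&` E j = set0.
      move=> ij; apply/seteqP; split => x // [[_ nD'] [Dj _]]; apply: nD'.
      by apply: DS Dj; rewrite /s leq_mul2r ij orbT.
    move=> i j _ _ [x [Ei Ej]]; case: (ltngtP i j) => // h.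
      by exfalso; have := sub _ _ h; rewrite -subset0 => /(_ x); apply.
    by exfalso; have := sub _ _ h; rewrite -subset0 => /(_ x); apply.
  - by move=> k; have [] := HH (s k).
  - by lra.
  have [BH h] := HH (s k).
  have DE : D (s k) = E k `|` D (s k.+1).
    apply/seteqP; split => x; last by move=> [[]//|]; apply: DS; rewrite /s leq_mul2r leqnSn orbT.
    by move=> Dx; have [?|?] := pselect (D (s k.+1) x); [right|left].
  move: h; rewrite DE fadd_restrU//; last 2 first.
  - exact: AAD.
  - by apply/seteqP; split => x // [[]].
  have : `|v (s k) (H (s k) \_ (D (s k.+1)))| <= eps / 6.
    have := @smallS (v (s k)) (D (s k.+1)) (C (s k.+1)) (eps / 6) (AAD' _) (@DC _).
    apply => //; apply: smallW (smC _ _ (si _ _ (ltnSn k))).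
    apply: le_trans HK; rewrite ler_pM2l// ler_wiXn2l//; try lra.
    by rewrite /s leq_pmull.
  have := ler_normD (v (s k) (H (s k) \_ (E k))) (v (s k) (H (s k) \_ (D (s k.+1)))).
  lra.
apply: nn; exists n.
(* A n leaves C l only if n > M l, and then the part outside lies in U l n minus U l (M l), where v
   n is small by the choice of M. *)
pose E l := if (l <= n)%N then A n `\` C l else set0.
have AE l : AA (E l).
  by rewrite /E; case: ifP => // _; exact: AAD (HA n) (AAUn l (M l)).
have sE l : (l < n.+1)%N -> small (v n) (E l) (eps / 6 * 2^-1 ^+ l).
  move=> ln; rewrite /E -ltnS ln.
  have dl : 0 <= eps / 6 * 2^-1 ^+ l by rewrite mulr_ge0// ?(ltW (p0 _))//; lra.
  have [nM|Mn] := leqP n (M l).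
    rewrite (_ : _ `\` _ = set0); first exact: small0.
    apply/seteqP; split => x // [Ax]; apply; exists n => //=.
    by rewrite -ltnS ln.
  have [_ H] := HM l; have := H n (ltnW Mn).
  apply: smallS; first exact: AAD (HA n) (AAUn l (M l)).
  apply: setSD => x Ax; exists n => //=; by rewrite leqnn -ltnS ln.
apply: (@smallS _ _ (D n `|` \bigcup_(l in [set l | (l < n.+1)%N]) E l)) => //.
  move=> x Ax; have [Dx|nDx] := pselect (D n x); [by left|right].
  apply: contrapT => nE; apply: nDx => l /= ln; apply: contrapT => nC; apply: nE.
  by exists l => //=; rewrite /E ln.
have := smallU (fv n) (AAD' n) (AA_bigcup [set l | (l < n.+1)%N] AE) sn
  (small_bigcup (fv n) AE sE).
apply: smallW; rewrite -mulr_sumr.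
have := sum_half_le 0 n.+1; rewrite expr0 mulr1 => h.
have : eps / 6 * \sum_(0 <= l < n.+1) 2^-1 ^+ l <= eps / 6 * 2.
  by rewrite ler_pM2l//; lra.
lra.
Qed.

(** The indices violating the conclusion would form a subsequence contradicting
    [brooks_jewett_ex]. *)
Lemma brooks_jewett (v : nat -> (X -> R) -> R) (A : nat -> set X) (eps : R) :
  (forall n, fadd (v n)) -> (forall H, B H -> v n H @[n --> \oo] --> 0) ->
  (forall k, AA (A k)) ->
  (forall m n, (m < n)%N -> small (v m) (A n) (2^-1 ^+ n)) -> 0 < eps ->
  \forall n \near \oo, small (v n) (A n) eps.
Proof.
move=> fv v0 HA sA e0; apply: contrapT => nn.
have /infinitely_incr[s si Hs] : forall N, exists2 n, (N <= n)%N & ~ small (v n) (A n) eps.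
  move=> N; apply: contrapT => nN; apply: nn; exists N => // n /= Nn.
  by apply: contrapT => ns; apply: nN; exists n.
have [|||||n] := @brooks_jewett_ex (fun k => v (s k)) (fun k => A (s k)) eps.
- by move=> n; exact: fv.
- by move=> H BH; exact: (cvg_incr si (v0 _ BH)).
- by move=> k; exact: HA.
- move=> m n mn; apply: smallW (sA _ _ (si _ _ mn)).
  by rewrite ler_wiXn2l//; try lra; exact: incr_ge.
- exact: e0.
exact: Hs.
Qed.

End BrooksJewett.

(** * Uniform boundedness on the sum space *)

Section UniformBound.
Variables (R : realType) (gamma : \bar R) (tau : nat -> \bar R).
Hypothesis tau0 : forall n, (0 <= tau n)%E.
Local Notation mu := (@lebesgue_measure R).
Local Notation I := (Ioo0 gamma).
Local Notation B := (Bset gamma tau).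
Local Notation X := (nat * R)%type.
Implicit Types (F H : X -> R).

(** Linearity is required on the balls B c c, whose union is the span of B 1 1; for a functional
    composed with [Qs] this is the range where the series is known to converge almost everywhere. *)
Definition blinear (u : (X -> R) -> R) :=
  (forall c a F H, 0 <= c -> B c c F -> B c c H -> u (a *: F + H) = a * u F + u H) /\
  exists M, forall F, B 1 1 F -> `|u F| <= M.

Lemma Bset0 c : 0 <= c -> B c c (fun=> 0).
Proof.
move=> c0 n; split => //.
- by move=> x _; rewrite normr0.
- by rewrite normr0 integral0 mule_ge0// lee_fin.
Qed.

Lemma blinear0 u : blinear u -> u (fun=> 0) = 0.
Proof.
move=> [ul _]; have := ul 0 1 _ _ (lexx 0) (Bset0 (lexx 0)) (Bset0 (lexx 0)).
have -> : 1 *: (fun=> 0) + (fun=> 0) = (fun=> 0) :> (X -> R).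
  by apply/funext => x; change (1 * 0 + 0 = 0 :> R); rewrite mulr0 addr0.
by rewrite mul1r => /eqP; rewrite -subr_eq subrr eq_sym => /eqP.
Qed.

Lemma blinearZ u a c F : blinear u -> 0 <= c -> B c c F -> u (a *: F) = a * u F.
Proof.
move=> ul c0 BF; have [l _] := ul; have := l c a _ _ c0 BF (Bset0 c0).
by rewrite blinear0// !addr0.
Qed.

Lemma blinearD u c F H : blinear u -> 0 <= c -> B c c F -> B c c H ->
  u (F + H) = u F + u H.
Proof.
by move=> [l _] c0 BF BH; have := l c 1 _ _ c0 BF BH; rewrite scale1r mul1r.
Qed.

Lemma BsetN e c F : B e c F -> B e c (- F).
Proof. by move=> /(BsetZ (-1)); rewrite normrN1 !mul1r scaleN1r. Qed.

Lemma blinearN u c F : blinear u -> 0 <= c -> B c c F -> u (- F) = - u F.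
Proof. by move=> ul c0 BF; rewrite -scaleN1r (blinearZ _ ul c0 BF) mulN1r. Qed.

Lemma blinearB u c F H : blinear u -> 0 <= c -> B c c F -> B c c H ->
  u (F - H) = u F - u H.
Proof.
move=> ul c0 BF BH; rewrite (blinearD ul c0 BF (BsetN BH)).
by rewrite (blinearN ul c0 BH).
Qed.

Lemma Bset_scale c F : 0 < c -> B c c F -> B 1 1 (c^-1 *: F).
Proof.
move=> c0 /(BsetZ c^-1); rewrite gtr0_norm ?invr_gt0// mulVf//.
by rewrite gt_eqF.
Qed.

Lemma blinear_le u M c F : blinear u -> (forall F, B 1 1 F -> `|u F| <= M) ->
  0 < c -> B c c F -> `|u F| <= c * M.
Proof.
move=> ul uM c0 BF.
have -> : F = c *: (c^-1 *: F) by rewrite scalerA divff ?gt_eqF// scale1r.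
rewrite (blinearZ _ ul ler01 (Bset_scale c0 BF)) normrM gtr0_norm//.
by rewrite ler_pM2l// uM//; exact: Bset_scale.
Qed.

Lemma sum_third_le (n M : nat) :
  \sum_(0 <= k < M) (if (k < n)%N then 0 else (3^-1 ^+ k : R)) <= 3 / 2 * 3^-1 ^+ n.
Proof.
have p0 k : 0 < (3^-1 ^+ k : R) by rewrite exprn_gt0.
have [Mn|nM] := leqP M n.
  rewrite big_nat big1; first by rewrite mulr_ge0 ?(ltW (p0 _)).
  by move=> k /andP[_ kM]; rewrite (leq_trans kM Mn).
suff : \sum_(0 <= k < M) (if (k < n)%N then 0 else (3^-1 ^+ k : R)) <=
    3 / 2 * 3^-1 ^+ n - 3 / 2 * 3^-1 ^+ M.
  by have := p0 M; lra.
elim: M nM => // M IH; rewrite ltnS leq_eqVlt => /predU1P[<-|/[dup] nM /IH H].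
  rewrite big_nat_recr//= ltnn big_nat big1 ?add0r ?exprS; first by lra.
  by move=> k /andP[_ ->].
by rewrite big_nat_recr//= ltnNge (ltnW nM)/= exprS; lra.
Qed.

(** Completeness of the space with unit ball B 1 1, for one geometric series; 3/2 3^-n is the sum of
    3^-k over k >= n. *)
Lemma Bset_series (y : nat -> X -> R) : (forall k, B 1 1 (y k)) ->
  exists x : X -> R, forall n, B (3 / 2 * 3^-1 ^+ n) (3 / 2 * 3^-1 ^+ n)
    (x - \sum_(0 <= k < n) 3^-1 ^+ k *: y k).
Proof.
move=> By.
(* In each component the series over k is again of the form [Qs], with geometric weights cut off
   below n, so measurability and convergence are already available. *)
pose r n k : R := if (k < n)%N then 0 else 3^-1 ^+ k.
have p0 k : 0 < (3^-1 ^+ k : R) by rewrite exprn_gt0.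
have r0 n k : 0 <= r n k by rewrite /r; case: ifP => // _; rewrite ltW.
pose Y i (p : X) : R := y p.1 (i, p.2).
have mY i k : measurable_fun I (fun x => Y i (k, x)) by have [] := By k i.
have absr n i x : I x -> (absum (r n) (Y i) x <= (3 / 2 * 3^-1 ^+ n)%:E)%E.
  move=> Ix; apply: nneseries_le => [k|M]; first by rewrite lee_fin mulr_ge0.
  rewrite sumEFin lee_fin; apply: le_trans (sum_third_le n M).
  apply: ler_sum => k _; rewrite -[leRHS]/(r n k) ler_piMr//.
  by have [_ + _] := By k i; apply.
pose x (p : X) : R := Qs (r 0%N) (Y p.1) p.2.
exists x => n i.
set S := \sum_(0 <= k < n) _.
have SE z : S (i, z) = \sum_(0 <= k < n) 3^-1 ^+ k * y k (i, z).
  rewrite /S; elim: {S} n => [|n IH]; first by rewrite !big_geq.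
  by rewrite !big_nat_recr//= -IH.
have xE z : I z -> (x - S) (i, z) = Qs (r n) (Y i) z.
  move=> Iz; change (x (i, z) - S (i, z) = Qs (r n) (Y i) z).
  have fin m : (absum (r m) (Y i) z < +oo)%E.
    exact: le_lt_trans (absr m i z Iz) (ltry _).
  rewrite /x /Qs/= !fin SE; have [c1 _] := absum_cvg (r0 0%N) (fin 0%N).
  apply/esym/cvg_lim => //.
  set C := \sum_(0 <= k < n) _.
  have Hc : (fun N => series (fun k => r 0%N k * Y i (k, z)) N - C) @ \oo -->
      limn (series (fun k => r 0%N k * Y i (k, z))) - C.
    by apply: cvgB => //; exact: cvg_cst.
  apply: cvg_trans Hc; apply: near_eq_cvg; near=> N.
  have nN : (n <= N)%N by near: N; exact: nbhs_infty_ge.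
  rewrite /C.
  rewrite /series/= !(@big_cat_nat _ _ _ n 0 N)//=.
  have -> : \sum_(0 <= k < n) r n k * Y i (k, z) = 0.
    by rewrite big_nat big1// => k /andP[_ kn]; rewrite /r kn mul0r.
  rewrite add0r addrAC -[X in X + _]/(_ - _) (_ : _ - _ = 0) ?add0r.
    rewrite big_nat [RHS]big_nat; apply: eq_bigr => k /andP[nk _].
    by rewrite /r [(k < n)%N]ltnNge nk.
  by apply/eqP; rewrite subr_eq0; apply/eqP; apply: eq_bigr => k _.
split.
- rewrite (_ : (fun z => _) = (fun z => Qs (r 0%N) (Y i) z - S (i, z)))//.
  apply: measurable_funB; first exact: measurable_Qs.
  rewrite (_ : (fun z => _) = (fun z => \sum_(0 <= k < n) 3^-1 ^+ k * y k (i, z))).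
    by apply: measurable_sum => k; apply: measurable_funM => //; exact: mY.
  by apply/funext.
- move=> z Iz; rewrite xE// -lee_fin.
  exact: le_trans (Qs_le (r0 n) _ _) (absr _ _ _ Iz).
- apply: (@le_trans _ _ (\int[mu]_(z in I) absum (r n) (Y i) z)%E).
    apply: ge0_le_integral => //; first exact: measurable_Ioo0.
    + apply/measurable_EFinP; apply: measurableT_comp => //.
      rewrite (_ : (fun z => _) = (fun z => Qs (r 0%N) (Y i) z - S (i, z)))//.
      apply: measurable_funB; first exact: measurable_Qs.
      rewrite (_ : (fun z => _) = (fun z => \sum_(0 <= k < n) 3^-1 ^+ k * y k (i, z))).
        by apply: measurable_sum => k; apply: measurable_funM => //; exact: mY.
      by apply/funext.
    + exact: (measurable_absum (r0 n) predT (mY i)).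
    + by move=> z Iz; rewrite xE//; exact: Qs_le.
  rewrite /absum integral_nneseries.
  + apply: nneseries_le => [k|M].
      by apply: integral_ge0 => z _; rewrite lee_fin mulr_ge0.
    apply: (@le_trans _ _ (\sum_(0 <= k < M) (r n k)%:E * tau i)%E).
      apply: lee_sum => k _; rewrite integral_weight//.
      apply: lee_wpmul2l; first by rewrite lee_fin.
      by have [_ _] := By k i; rewrite mul1e.
    rewrite -ge0_sume_distrl; last by move=> k _; rewrite lee_fin.
    by rewrite lee_wpmul2r// sumEFin lee_fin sum_third_le.
  + exact: measurable_Ioo0.
  + move=> k; apply/measurable_EFinP; apply: measurable_funM => //.
    exact: (measurable_abs (F := Y i)).
  + by move=> k z _; rewrite lee_fin mulr_ge0.
Unshelve. all: by end_near. Qed.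

(* Sokal's gliding hump: signs are chosen so that each functional stays large on
   the partial sums. *)
Lemma uniform_bound (v : nat -> (X -> R) -> R) : (forall j, blinear (v j)) ->
  (forall F, B 1 1 F -> v n F @[n --> \oo] --> 0) ->
  exists2 M, 0 < M & forall j F, B 1 1 F -> `|v j F| <= M.
Proof.
move=> vl v0.
have p0 k : 0 < (3^-1 ^+ k : R) by rewrite exprn_gt0.
apply: contrapT => nM.
(* The point nearly attains the norm of the functional: the supremum is at most 3/2 of the value
   there, a ratio that beats the geometric tail below. *)
have /choice[q Hq] : forall n : nat, exists p : nat * (X -> R),
    [/\ B 1 1 p.2, 4 ^+ n < `|v p.1 p.2| &
        forall F, B 1 1 F -> `|v p.1 F| <= 3 / 2 * `|v p.1 p.2|].
  move=> n; have [j [F [BF jF]]] : exists j F, B 1 1 F /\ 3 / 2 * 4 ^+ n < `|v j F|.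
    apply: contrapT => nj; apply: nM; exists (3 / 2 * 4 ^+ n).
      by rewrite mulr_gt0// exprn_gt0.
    move=> j F BF; rewrite leNgt; apply/negP => h; apply: nj.
    by exists j, F.
  have [_ [M vM]] := vl j.
  pose S := [set `|v j H| | H in B 1 1].
  have hS : has_sup S.
    by split; [exists `|v j F|, F|exists M => _ [H BH <-]; exact: vM].
  have SF : 3 / 2 * 4 ^+ n < sup S.
    by apply: lt_le_trans jF _; apply: sup_upper_bound => //; exists F.
  have n0 : 0 < 4 ^+ n :> R by rewrite exprn_gt0.
  have e0 : 0 < sup S / 3 by lra.
  have [_ [H BH <-] hH] := sup_adherent e0 hS.
  exists (j, H); split => //=; first by lra.
  move=> F' BF'; have : `|v j F'| <= sup S by apply: sup_upper_bound => //; exists F'.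
  by lra.
pose T n := v (q n).1; pose y n := (q n).2.
have By n : B 1 1 (y n) by have [] := Hq n.
have Tl n : blinear (T n) by exact: vl.
(* One of the two values of T n at S +- 3^-n y n has modulus at least 3^-n |T n (y n)|, as their
   difference has twice that modulus. *)
pose sg n (S : X -> R) : R :=
  if 3^-1 ^+ n * `|T n (y n)| <= `|T n (S + 3^-1 ^+ n *: y n)| then 1 else -1.
pose S := fix S n : X -> R := if n is k.+1 then
  S k + 3^-1 ^+ k *: (sg k (S k) *: y k) else (fun=> 0).
pose y' n := sg n (S n) *: y n.
have sg1 n (H : X -> R) : `|sg n H| = 1 by rewrite /sg; case: ifP; rewrite ?normrN1 ?normr1.
have By' n : B 1 1 (y' n).
  by have := BsetZ (sg n (S n)) (By n); rewrite sg1 !mul1r.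
have SE n : S n = \sum_(0 <= k < n) 3^-1 ^+ k *: y' k.
  by elim: n => [|n IH]; [rewrite big_geq|rewrite big_nat_recr//= -IH].
have [x Bx] := Bset_series By'.
have BS n : exists2 c, 0 <= c & B c c (S n).
  elim: n => [|n [c c0 IH]]; first by exists 0 => //; exact: Bset0.
  exists (c + 3^-1 ^+ n); first by rewrite addr_ge0// ltW.
  have := BsetZ (3^-1 ^+ n) (By' n); rewrite gtr0_norm// mulr1 => H.
  exact: BsetD c0 (ltW (p0 n)) IH H.
have Bx0 : B (3 / 2) (3 / 2) x.
  by have := Bx 0%N; rewrite expr0 mulr1 big_geq// subr0.
(* The terms after n contribute at most (3/2) 3^-(n+1) (3/2)|T n (y n)|, three quarters of 3^-n |T n
   (y n)|; a quarter remains. *)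
have Tx n : 3^-1 ^+ n * `|T n (y n)| / 4 <= `|T n x|.
  have [c c0 BSn] := BS n; have [_ _ Ty] := Hq n.
  have [c' c'0 BSn1] := BS n.+1.
  set b := 3^-1 ^+ n * T n (y n).
  have bE : 3^-1 ^+ n * `|T n (y n)| = `|b| by rewrite /b normrM (gtr0_norm (p0 n)).
  pose d := c + 1.
  have d0 : 0 <= d by rewrite /d; lra.
  have BSd : B d d (S n) by apply: BsetW BSn => //; rewrite /d; lra.
  have Byd : B d d (y n) by apply: BsetW (By n) => //; rewrite /d; lra.
  have TS a : T n (S n + a *: y n) = T n (S n) + a * T n (y n).
    by rewrite addrC (proj1 (Tl n) d a _ _ d0 Byd BSd) addrC.
  have h1 : `|b| <= `|T n (S n.+1)|.
    rewrite /= scalerA TS; rewrite /sg TS -/b bE; case: (leP `|b| `|T n (S n) + b|) => h.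
      by rewrite mulr1 -/b.
    rewrite mulrN1 mulNr -/b.
    have := ler_normB (T n (S n) + b) (T n (S n) - b).
    have -> : T n (S n) + b - (T n (S n) - b) = b + b by lra.
    have -> : `|b + b| = 2 * `|b| by rewrite -mulr2n normrMn mulr_natl.
    by lra.
  have BR := Bx n.+1; rewrite -SE in BR.
  have r0 : 0 < 3 / 2 * 3^-1 ^+ n.+1 :> R by rewrite mulr_gt0.
  have h2 := blinear_le (Tl n) Ty r0 BR.
  have xE : x = S n.+1 + (x - S n.+1) by rewrite addrC subrK.
  pose e := c' + 3 / 2 * 3^-1 ^+ n.+1.
  have e0 : 0 <= e by rewrite addr_ge0// ltW.
  have TxE : T n x = T n (S n.+1) + T n (x - S n.+1).
    rewrite {1}xE (blinearD (Tl n) e0)//.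
      by apply: BsetW BSn1 => //; rewrite /e lerDl ltW.
    by apply: BsetW BR => //; rewrite /e lerDr.
  rewrite bE TxE.
  have := ler_normB (T n (S n.+1) + T n (x - S n.+1)) (T n (x - S n.+1)).
  rewrite addrK; move: h2; rewrite exprS.
  have -> : 3 / 2 * (3^-1 * 3^-1 ^+ n) * (3 / 2 * `|T n (y n)|) =
    3 / 4 * (3^-1 ^+ n * `|T n (y n)|) by lra.
  by rewrite bE; lra.
have [M' HM'] : exists M', forall j, `|v j x| <= M'.
  have x1 : B 1 1 ((3 / 2)^-1 *: x) by apply: Bset_scale => //; lra.
  have [M' [_ HM']] := cvg_seq_bounded (cvgP _ (v0 _ x1)).
  exists (3 / 2 * (M' + 1)) => j.
  have := HM' (M' + 1) ltac:(lra) j Logic.I.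
  have c32 : 0 <= 3 / 2 :> R by lra.
  rewrite /= (blinearZ _ (vl j) c32 Bx0).
  rewrite normrM ger0_norm ?invr_ge0//; lra.
have [n Hn] : exists n, 4 * M' < (4 / 3) ^+ n.
  have e0 : 0 < (4 * `|M'| + 1)^-1 by rewrite invr_gt0; have := normr_ge0 M'; lra.
  have := @cvg_expr R (3 / 4); rewrite ger0_norm => [/(_ ltac:(lra))|]; last by lra.
  move=> /cvgr_lt/(_ _ e0)[n _ /(_ n (leqnn n)) /= h]; exists n.
  have P0 : 0 < (4 / 3) ^+ n :> R by rewrite exprn_gt0//; lra.
  have PQ : (4 / 3) ^+ n * (3 / 4) ^+ n = 1 :> R.
    by rewrite -exprMn (_ : 4 / 3 * (3 / 4) = 1) ?expr1n//; lra.
  have : 1 < (4 / 3) ^+ n / (4 * `|M'| + 1) by rewrite -[X in X < _]PQ ltr_pM2l.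
  rewrite ltr_pdivlMr; first by have := ler_norm M'; lra.
  by have := normr_ge0 M'; lra.
have := Tx n; have := HM' (q n).1; rewrite -/(T n); have [_ h _] := Hq n.
rewrite -/(T n) -/(y n) in h.
have : 3^-1 ^+ n * 4 ^+ n < 3^-1 ^+ n * `|T n (y n)| by rewrite ltr_pM2l.
rewrite -exprMn (_ : 3^-1 * 4 = 4 / 3 :> R); last by lra.
by lra.
Qed.

End UniformBound.

(** * Quadratic functionals *)

Section Quadratic.
Variables (R : realType) (gamma : \bar R) (tau : nat -> \bar R).
Hypothesis tau0 : forall n, (0 <= tau n)%E.
Local Notation mu := (@lebesgue_measure R).
Local Notation I := (Ioo0 gamma).
Local Notation B := (Bset gamma tau).
Local Notation X := (nat * R)%type.
Local Notation blin := (blinear gamma tau).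
Implicit Types (F H : X -> R) (K : set (X -> R)) (u : (X -> R) -> R).

Definition msec (A : set X) := forall i, measurable (I `&` [set x | A (i, x)]).

Lemma Bset_dom e c F H : B e c F -> (forall i, measurable_fun I (fun x => H (i, x))) ->
  (forall i x, I x -> `|H (i, x)| <= `|F (i, x)|) -> B e c H.
Proof.
move=> BF mH HF i; have [mF Fe Fc] := BF i; split => //.
  by move=> x Ix; apply: le_trans (HF _ _ Ix) (Fe _ Ix).
apply: le_trans Fc; apply: ge0_le_integral => //; first exact: measurable_Ioo0.
- by apply/measurable_EFinP; exact: (measurable_abs (F := H)).
- by apply/measurable_EFinP; exact: (measurable_abs (F := F)).
- by move=> x Ix; rewrite lee_fin HF.
Qed.

Lemma measurable_restr_sec F (A : set X) i : msec A -> measurable_fun I (fun x => F (i, x)) ->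
  measurable_fun I (fun x => (F \_ A) (i, x)).
Proof.
move=> mA mF.
have E : {in I, (fun x => (F \_ A) (i, x)) =1
    (fun x => F (i, x)) \_ (I `&` [set x | A (i, x)])}.
  move=> x /set_mem Ix; rewrite !patchE.
  have [Ax|nAx] := pselect (A (i, x)); first by rewrite !mem_set.
  by rewrite !memNset// => -[].
apply: (eq_measurable_fun ((fun x => F (i, x)) \_ (I `&` [set x | A (i, x)]))).
  by move=> x xI; rewrite E.
apply: measurable_funTS; apply/(measurable_restrictT _ (mA i)).
by apply: measurable_funS mF; [exact: measurable_Ioo0|exact: subIsetl].
Qed.

Lemma Bset_restr e c F (A : set X) : msec A -> B e c F -> B e c (F \_ A).
Proof.
move=> mA BF; apply: (Bset_dom BF).
  by move=> i; apply: measurable_restr_sec => //; have [] := BF i.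
by move=> i x _; rewrite patchE; case: ifP => // _; rewrite normr0.
Qed.

Definition sup_on u K := sup [set u H | H in K].

Lemma sup_on_has u c K : blin u -> 0 < c -> K `<=` B c c -> K !=set0 ->
  has_sup [set u H | H in K].
Proof.
move=> ul c0 KB [H KH]; split; first by exists (u H), H.
have [_ [M uM]] := ul; exists (c * M) => _ [H' KH' <-].
apply: le_trans (ler_norm _) _; apply: (blinear_le tau0 ul uM) => //.
exact: KB.
Qed.

Lemma sup_on_ub u c K H : blin u -> 0 < c -> K `<=` B c c -> K H -> u H <= sup_on u K.
Proof.
move=> ul c0 KB KH; apply: sup_upper_bound; last by exists H.
by apply: sup_on_has ul c0 KB _; exists H.
Qed.

Lemma sup_on_le u K b : K !=set0 -> (forall H, K H -> u H <= b) -> sup_on u K <= b.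
Proof.
move=> [H KH] ub; apply: ge_sup; first by exists (u H), H.
by move=> _ [H' KH' <-]; exact: ub.
Qed.

(** The last two hypotheses say that K12 is the Minkowski sum of K1 and K2, and the supremum of a
    linear functional is additive in the set. *)
Lemma sup_on_add u c K1 K2 K12 : blin u -> 0 < c ->
  K1 `<=` B c c -> K2 `<=` B c c -> K1 !=set0 -> K2 !=set0 ->
  (forall H1 H2, K1 H1 -> K2 H2 -> K12 (H1 + H2)) ->
  (forall H, K12 H -> exists H1 H2, [/\ K1 H1, K2 H2 & H = H1 + H2]) ->
  sup_on u K12 = sup_on u K1 + sup_on u K2.
Proof.
move=> ul c0 KB1 KB2 K10 K20 Kadd Kdec.
have h1 := sup_on_has ul c0 KB1 K10; have h2 := sup_on_has ul c0 KB2 K20.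
rewrite /sup_on -sup_sumE//; congr sup; apply/seteqP; split => z.
  move=> [H /Kdec[H1 [H2 [k1 k2 ->]]] <-]; exists (u H1); first by exists H1.
  exists (u H2); first by exists H2.
  by rewrite (blinearD ul (ltW c0) (KB1 _ k1) (KB2 _ k2)).
move=> [_ [H1 k1 <-] [_ [H2 k2 <-] <-]]; exists (H1 + H2); first exact: Kadd.
by rewrite (blinearD ul (ltW c0) (KB1 _ k1) (KB2 _ k2)).
Qed.

Definition dominated (r : X -> R) : set (X -> R) := [set H : X -> R | forall i : nat,
  measurable_fun I (fun x => H (i, x)) /\ forall x, I x -> `|H (i, x)| <= r (i, x)].

Lemma dom_B e c r : B e c r -> dominated r `<=` B e c.
Proof.
move=> Br H Hr; apply: (Bset_dom Br) => i; first by have [] := Hr i.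
by move=> x Ix; have [_ /(_ x Ix)/le_trans] := Hr i; apply; exact: ler_norm.
Qed.

Lemma dom0 r : (forall p, 0 <= r p) -> dominated r (fun=> 0).
Proof. by move=> r0 i; split => // x _; rewrite normr0. Qed.

(** Riesz decomposition: truncating H to values between -r1 and r1 leaves a remainder bounded by
    r2. *)
Lemma sup_on_domD u c r1 r2 : blin u -> 0 < c -> B c c r1 -> B c c r2 ->
  (forall p, 0 <= r1 p) -> (forall p, 0 <= r2 p) ->
  sup_on u (dominated (r1 + r2)) = sup_on u (dominated r1) + sup_on u (dominated r2).
Proof.
move=> ul c0 B1 B2 p1 p2; apply: (sup_on_add ul c0 (dom_B B1) (dom_B B2)).
- by exists (fun=> 0); exact: dom0.
- by exists (fun=> 0); exact: dom0.
- move=> H1 H2 d1 d2 i; have [m1 h1] := d1 i; have [m2 h2] := d2 i; split.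
    exact: measurable_funD.
  move=> x Ix; apply: le_trans (ler_normD _ _) _.
  by apply: lerD; [exact: h1|exact: h2].
move=> H d.
pose H1 (p : X) := Num.max (- r1 p) (Num.min (H p) (r1 p)).
exists H1, (H - H1).
have mr1 i : measurable_fun I (fun x => r1 (i, x)) by have [] := B1 i.
have mH1 i : measurable_fun I (fun x => H1 (i, x)).
  have [mH _] := d i; apply: measurable_maxr.
    exact: measurableT_comp.
  exact: measurable_minr.
split; last by rewrite addrC subrK.
  move=> i; split; first exact: mH1.
  move=> x _; rewrite /H1 ler_norml le_max lexx/= ge_max ge_min lexx orbT andbT.
  by have := p1 (i, x); lra.
move=> i; have [mH h] := d i; split; first exact: measurable_funB.
move=> x Ix; have := h x Ix; have := p1 (i, x); have := p2 (i, x).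
change (0 <= r2 (i, x) -> 0 <= r1 (i, x) -> `|H (i, x)| <= r1 (i, x) + r2 (i, x) ->
  `|H (i, x) - H1 (i, x)| <= r2 (i, x)).
rewrite /H1 => a1 a2; rewrite !ler_norml => /andP[a3 a4].
have [?|?] := ltP (H (i, x)) (r1 (i, x)).
  by have [?|?] := ltP (- r1 (i, x)) (H (i, x)); apply/andP; split; lra.
by have [?|?] := ltP (- r1 (i, x)) (r1 (i, x)); apply/andP; split; lra.
Qed.

Definition index_scale (th : nat -> R) F : X -> R := fun p => th p.1 * F p.
Definition mulK th : set (X -> R) := [set index_scale th F | F in B 1 1].

Lemma Bset_index_scale th c F : (forall n, 0 <= th n <= c) -> B 1 1 F -> B c c (index_scale th F).
Proof.
move=> oc BF i; have [mF F1 Ft] := BF i; have /andP[w0 w1] := oc i; split.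
- exact: (@measurable_funM _ _ _ _ (cst (th i))).
- move=> x Ix; rewrite /index_scale/= normrM ger0_norm//.
  by rewrite -[leRHS]mulr1 ler_pM// F1.
- rewrite /index_scale/=; under eq_integral do rewrite normrM EFinM.
  rewrite ge0_integralZl//; first last.
  + by apply/measurable_EFinP; exact: (measurable_abs (F := F)).
  + exact: measurable_Ioo0.
  rewrite ger0_norm//; apply: lee_pmul => //.
  + exact: integral_ge0.
  + by move: Ft; rewrite mul1e.
Qed.

Lemma mulK_B th c : (forall n, 0 <= th n <= c) -> mulK th `<=` B c c.
Proof. by move=> oc _ [F BF <-]; exact: Bset_index_scale. Qed.

Lemma mulK0 th : mulK th !=set0.
Proof. by exists (index_scale th (fun=> 0)); exists (fun=> 0) => //; exact: Bset0. Qed.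

(** Convexity of the ball in each component makes [mulK] additive in the scaling sequence. *)
Lemma sup_on_mulD u c o1 o2 : blin u -> 0 < c ->
  (forall n, 0 <= o1 n <= c) -> (forall n, 0 <= o2 n <= c) ->
  sup_on u (mulK (fun n => o1 n + o2 n)) = sup_on u (mulK o1) + sup_on u (mulK o2).
Proof.
move=> ul c0 h1 h2; apply: (sup_on_add ul c0 (mulK_B h1) (mulK_B h2)).
- exact: mulK0.
- exact: mulK0.
- move=> _ _ [F1 B1 <-] [F2 B2 <-].
  (* Where o1 n + o2 n = 0 the convention 1/0 = 0 makes both weights 0, and both scalings vanish
     there. *)
  pose a n := o1 n / (o1 n + o2 n); pose b n := o2 n / (o1 n + o2 n).
  have ab n : [/\ 0 <= a n, 0 <= b n & a n + b n <= 1].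
    have /andP[p1 _] := h1 n; have /andP[p2 _] := h2 n.
    rewrite /a /b; have [E|nE] := eqVneq (o1 n + o2 n) 0.
      by rewrite E invr0 !mulr0; split => //; lra.
    have p : 0 < o1 n + o2 n by rewrite lt_def nE; lra.
    by split; rewrite ?divr_ge0 ?(ltW p)// -mulrDl divff.
  exists (index_scale a F1 + index_scale b F2).
    move=> i; have [m1 f1 t1] := B1 i; have [m2 f2 t2] := B2 i.
    have [a0 b0 ab1] := ab i.
    have ai : B (a i) (a i) (index_scale (fun=> a i) F1) by apply: Bset_index_scale => // n; rewrite a0 lexx.
    have bi : B (b i) (b i) (index_scale (fun=> b i) F2) by apply: Bset_index_scale => // n; rewrite b0 lexx.
    have [m f t] := BsetW tau0 ab1 ab1 (BsetD a0 b0 ai bi) i.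
    by split.
  apply/funext => p; change ((o1 p.1 + o2 p.1) * (a p.1 * F1 p + b p.1 * F2 p) =
    o1 p.1 * F1 p + o2 p.1 * F2 p).
  have /andP[p1 _] := h1 p.1; have /andP[p2 _] := h2 p.1.
  rewrite /a /b; have [E|nE] := eqVneq (o1 p.1 + o2 p.1) 0.
    have -> : o1 p.1 = 0 by lra.
    have -> : o2 p.1 = 0 by lra.
    by rewrite addr0 !mul0r addr0.
  by field.
move=> _ [F BF <-]; exists (index_scale o1 F), (index_scale o2 F); split; [by exists F|by exists F|].
apply/funext => p; change ((o1 p.1 + o2 p.1) * F p = o1 p.1 * F p + o2 p.1 * F p).
by rewrite mulrDl.
Qed.

Definition sq F : X -> R := fun p => F p ^+ 2.
(** Dividing by [tau n] compares with the L^1-radius of component n. If [tau n] is 0 or infinite,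
    [fine] and 1/0 = 0 make the value 0. *)
Definition msq F (n : nat) : R :=
  (\int[mu]_(x in I) (F (n, x) ^+ 2))%R / fine (tau n).

Lemma Bset_sq c F : 0 <= c -> B c c F -> B (c ^+ 2) (c ^+ 2) (sq F).
Proof.
move=> c0 BF; have := BsetZ c BF; rewrite ger0_norm// -expr2 => BcF.
apply: (Bset_dom BcF) => i; have [mF Fc _] := BF i.
  exact: (@measurable_funM _ _ _ _ (fun x => F (i, x)) (fun x => F (i, x))).
move=> x Ix; change (`|F (i, x) ^+ 2| <= `|c * F (i, x)|).
by rewrite expr2 !normrM (ger0_norm c0) ler_wpM2r// Fc.
Qed.

Lemma integral_sq_le c F n : 0 <= c -> B c c F ->
  (\int[mu]_(x in I) (F (n, x) ^+ 2)%:E <= (c ^+ 2)%:E * tau n)%E.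
Proof.
move=> c0 BF; have [_ _] := Bset_sq c0 BF n.
by under eq_integral do rewrite /sq ger0_norm ?sqr_ge0//.
Qed.

Lemma msq_ge0 F n : 0 <= msq F n.
Proof.
rewrite divr_ge0//; last by rewrite fine_ge0.
by apply: fine_ge0; apply: integral_ge0 => x _; rewrite lee_fin sqr_ge0.
Qed.

Lemma msq_le c F n : 0 <= c -> B c c F -> 0 <= msq F n <= c ^+ 2.
Proof.
move=> c0 BF; rewrite msq_ge0/=; have := integral_sq_le n c0 BF.
rewrite /msq; have := tau0 n; case: (tau n) => [r||//]; last first.
  by rewrite /= invr0 mulr0 sqr_ge0.
rewrite lee_fin le_eqVlt => /predU1P[<-|r0]; first by rewrite /= invr0 mulr0 sqr_ge0.
rewrite /= ler_pdivrMr// /Rintegral => H; rewrite -lee_fin fineK//.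
rewrite ge0_fin_numE; first by apply: le_lt_trans H _; rewrite -EFinM ltry.
by apply: integral_ge0 => x _; rewrite lee_fin sqr_ge0.
Qed.

Lemma msq_par c F H n : 0 <= c -> B c c F -> B c c H ->
  msq (F + H) n + msq (F - H) n = (msq F n + msq F n) + (msq H n + msq H n).
Proof.
move=> c0 BF BH; rewrite /msq.
have [E|nE] := eqVneq (fine (tau n)) 0; first by rewrite E invr0 !mulr0 !addr0.
have ty : (tau n < +oo)%E by move: (tau0 n) nE; case: (tau n) => [r||]//=; rewrite ?eqxx// ltry.
have int G d : 0 <= d -> B d d G -> mu.-integrable I (EFin \o (fun x => G (n, x) ^+ 2)).
  move=> d0 BG; apply/integrableP; split.
    by apply/measurable_EFinP; have [] := Bset_sq d0 BG n.
  apply: le_lt_trans (_ : ((d ^+ 2)%:E * tau n < +oo)%E).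
    by have [_ _] := Bset_sq d0 BG n; rewrite /sq.
  by rewrite lte_mul_pinfty// lee_fin sqr_ge0.
rewrite -!mulrDl; congr (_ / _).
have c2 : 0 <= c + c by lra.
have iD := int _ _ c2 (BsetD c0 c0 BF BH).
have iB := int _ _ c2 (BsetD c0 c0 BF (BsetN BH)).
have iF := int _ _ c0 BF; have iH := int _ _ c0 BH.
have mI := measurable_Ioo0 gamma.
have iFF : mu.-integrable I (EFin \o (fun x => F (n, x) ^+ 2 + F (n, x) ^+ 2)).
  rewrite (_ : _ \o _ = (fun x => (EFin \o (fun x => F (n, x) ^+ 2)%R) x +
    (EFin \o (fun x => F (n, x) ^+ 2)%R) x)%E); first exact: integrableD.
  by apply/funext => x /=; rewrite EFinD.
have iHH : mu.-integrable I (EFin \o (fun x => H (n, x) ^+ 2 + H (n, x) ^+ 2)).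
  rewrite (_ : _ \o _ = (fun x => (EFin \o (fun x => H (n, x) ^+ 2)%R) x +
    (EFin \o (fun x => H (n, x) ^+ 2)%R) x)%E); first exact: integrableD.
  by apply/funext => x /=; rewrite EFinD.
rewrite -(@RintegralD _ _ _ mu I _ _ mI iD iB) -(@RintegralD _ _ _ mu I _ _ mI iF iF).
rewrite -(@RintegralD _ _ _ mu I _ _ mI iH iH) -(@RintegralD _ _ _ mu I _ _ mI iFF iHH).
apply: eq_Rintegral => x _.
change ((F (n, x) + H (n, x)) ^+ 2 + (F (n, x) - H (n, x)) ^+ 2 =
  F (n, x) ^+ 2 + F (n, x) ^+ 2 + (H (n, x) ^+ 2 + H (n, x) ^+ 2)).
by ring.
Qed.

(** The first supremum tests u on functions below F^2, the second on whole components weighted by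
    their mean squares. *)
Definition quad u F := sup_on u (dominated (sq F)) + sup_on u (mulK (msq F)).

(** F^2 and [msq F] satisfy the parallelogram identity, pointwise and by integration, and the two
    suprema are additive in these data. *)
Lemma quad_par u c F H : blin u -> 0 < c -> B c c F -> B c c H ->
  quad u (F + H) + quad u (F - H) = 2 * quad u F + 2 * quad u H.
Proof.
move=> ul c0 BF BH; rewrite /quad.
have c0' := ltW c0.
pose d := (c + c) ^+ 2.
have cc : 0 <= c + c by lra.
have d0 : 0 < d by rewrite exprn_gt0//; lra.
have sq0 G p : 0 <= sq G p by rewrite /sq sqr_ge0.
have cd : c ^+ 2 <= d by rewrite ler_sqr ?nnegrE//; lra.
have BsF : B d d (sq F) by exact: (BsetW tau0 cd cd) (Bset_sq c0' BF).
have BsH : B d d (sq H) by exact: (BsetW tau0 cd cd) (Bset_sq c0' BH).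
have BsD : B d d (sq (F + H)) by exact: Bset_sq cc (BsetD c0' c0' BF BH).
have BsB : B d d (sq (F - H)) by exact: Bset_sq cc (BsetD c0' c0' BF (BsetN BH)).
have add0 G G' p : 0 <= (sq G + sq G') p.
  by change (0 <= sq G p + sq G' p); rewrite addr_ge0.
have E1 : sup_on u (dominated (sq (F + H))) + sup_on u (dominated (sq (F - H))) =
    2 * sup_on u (dominated (sq F)) + 2 * sup_on u (dominated (sq H)).
  rewrite -(sup_on_domD ul d0)// (_ : sq (F + H) + sq (F - H) = (sq F + sq F) + (sq H + sq H)).
    rewrite (@sup_on_domD u (d + d)) ?(sup_on_domD ul d0) ?addr_gt0//; first by lra.
    - exact: (BsetD (ltW d0) (ltW d0) BsF BsF).
    - exact: (BsetD (ltW d0) (ltW d0) BsH BsH).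
  apply/funext => p; change ((F p + H p) ^+ 2 + (F p - H p) ^+ 2 =
    F p ^+ 2 + F p ^+ 2 + (H p ^+ 2 + H p ^+ 2)).
  by ring.
have oF n : 0 <= msq F n <= d.
  by have /andP[-> /le_trans] := msq_le n c0' BF; apply.
have oH n : 0 <= msq H n <= d.
  by have /andP[-> /le_trans] := msq_le n c0' BH; apply.
have oD n : 0 <= msq (F + H) n <= d by exact: msq_le cc (BsetD c0' c0' BF BH).
have oB n : 0 <= msq (F - H) n <= d by exact: msq_le cc (BsetD c0' c0' BF (BsetN BH)).
have E2 : sup_on u (mulK (msq (F + H))) + sup_on u (mulK (msq (F - H))) =
    2 * sup_on u (mulK (msq F)) + 2 * sup_on u (mulK (msq H)).
  rewrite -(sup_on_mulD ul d0)//.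
  rewrite (_ : (fun n => _) = (fun n => (msq F n + msq F n) + (msq H n + msq H n))).
    have dd : 0 < d + d by lra.
    rewrite (sup_on_mulD (o1 := fun n => msq F n + msq F n) (o2 := fun n => msq H n + msq H n) ul dd).
    + by rewrite !(sup_on_mulD ul d0)//; lra.
    + by move=> n; have := oF n; lra.
    + by move=> n; have := oH n; lra.
  by apply/funext => n; exact: (msq_par n c0' BF BH).
lra.
Qed.

Lemma sup_on_ge0 u c K : blin u -> 0 < c -> K `<=` B c c -> K (fun=> 0) -> 0 <= sup_on u K.
Proof.
by move=> ul c0 KB K0; rewrite -(blinear0 tau0 ul); exact: (sup_on_ub ul c0 KB).
Qed.

Lemma mulK_0 o : mulK o (fun=> 0).
Proof.
exists (fun=> 0); first exact: Bset0.
by apply/funext => p; rewrite /index_scale mulr0.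
Qed.

Lemma sup_on_mul_ge0 u c F : blin u -> 0 < c -> B c c F -> 0 <= sup_on u (mulK (msq F)).
Proof.
move=> ul c0 BF; apply: (@sup_on_ge0 u (c ^+ 2)) (mulK_0 _) => //; first by rewrite exprn_gt0.
by apply: mulK_B => n; exact: msq_le (ltW c0) BF.
Qed.

Lemma sup_on_dom_ge0 u c F : blin u -> 0 < c -> B c c F -> 0 <= sup_on u (dominated (sq F)).
Proof.
move=> ul c0 BF; apply: (@sup_on_ge0 u (c ^+ 2)) => //; first by rewrite exprn_gt0.
  by apply: dom_B; exact: Bset_sq (ltW c0) BF.
by apply: dom0 => p; rewrite /sq sqr_ge0.
Qed.

Lemma quad_ge0 u c F : blin u -> 0 < c -> B c c F -> 0 <= quad u F.
Proof.
by move=> ul c0 BF; rewrite addr_ge0 ?(sup_on_mul_ge0 ul c0 BF) ?(sup_on_dom_ge0 ul c0 BF).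
Qed.

Lemma quad_le u c : blin u -> 0 < c -> exists b, forall F, B c c F -> quad u F <= b.
Proof.
move=> ul c0; have [_ [M uM]] := ul; exists (c ^+ 2 * M + c ^+ 2 * M) => F BF.
have d0 : 0 < c ^+ 2 by rewrite exprn_gt0.
apply: lerD; apply: sup_on_le.
- by exists (fun=> 0); apply: dom0 => p; rewrite /sq sqr_ge0.
- move=> H /(dom_B (Bset_sq (ltW c0) BF)) BH; apply: le_trans (ler_norm _) _.
  exact: (blinear_le tau0 ul uM).
- by exists (fun=> 0); exact: mulK_0.
- move=> H /(mulK_B (fun n => msq_le n (ltW c0) BF)) BH; apply: le_trans (ler_norm _) _.
  exact: (blinear_le tau0 ul uM).
Qed.

Lemma quad2 u c F : blin u -> 0 < c -> B c c F -> quad u (F + F) = 4 * quad u F.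
Proof.
move=> ul c0 BF.
have B0 := Bset0 gamma tau0 (ltW c0).
have := quad_par ul c0 BF BF; have := quad_par ul c0 B0 B0.
have -> : (fun=> 0) + (fun=> 0) = (fun=> 0) :> (X -> R) by rewrite addr0.
rewrite !subrr; lra.
Qed.

Lemma quad_dom u c F H a : blin u -> 0 < c -> B c c F -> 0 < a -> dominated (sq F) (a *: H) ->
  B c c H -> `|u H| <= quad u F / a.
Proof.
move=> ul c0 BF a0 dH BH.
have d0 : 0 < c ^+ 2 by rewrite exprn_gt0.
have dB := dom_B (Bset_sq (ltW c0) BF).
have m0 := sup_on_mul_ge0 ul c0 BF.
have h1 := sup_on_ub ul d0 dB dH.
have h2 : u (- (a *: H)) <= sup_on u (dominated (sq F)).
  apply: (sup_on_ub ul d0 dB) => i; have [m b] := dH i; split.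
    by have [] := BsetN (dB _ dH) i.
  by move=> x Ix; rewrite normrN; exact: b.
rewrite (blinearN tau0 ul (ltW d0) (dB _ dH)) in h2.
rewrite (blinearZ tau0 a ul (ltW c0) BH) in h1 h2.
rewrite ler_pdivlMr//.
have -> : `|u H| * a = `|a * u H| by rewrite normrM (gtr0_norm a0) mulrC.
rewrite ler_norml /quad; lra.
Qed.

End Quadratic.

(** * Uniform control by finitely many quadratic functionals *)

Section Core.
Variables (R : realType) (gamma : \bar R) (tau : nat -> \bar R).
Hypothesis tau0 : forall n, (0 <= tau n)%E.
Local Notation mu := (@lebesgue_measure R).
Local Notation I := (Ioo0 gamma).
Local Notation B := (Bset gamma tau).
Local Notation X := (nat * R)%type.
Local Notation blin := (blinear gamma tau).
Local Notation quadf := (quad gamma tau).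
Local Notation msqf := (msq gamma tau).
Local Notation msec := (msec gamma).
Implicit Types (F H : X -> R).

Lemma msecU (A : nat -> set X) : (forall n, msec (A n)) -> msec (\bigcup_n A n).
Proof.
move=> mA i; rewrite (_ : _ `&` _ = \bigcup_n (I `&` [set x | A n (i, x)])).
  by apply: bigcupT_measurable => n; exact: mA.
apply/seteqP; split => x; first by move=> [Ix [n _ Ax]]; exists n.
by move=> [n _ [Ix Ax]]; split => //; exists n.
Qed.

Lemma msecD (A A' : set X) : msec A -> msec A' -> msec (A `\` A').
Proof.
move=> mA mA' i; rewrite (_ : _ `&` _ =
  (I `&` [set x | A (i, x)]) `\` (I `&` [set x | A' (i, x)])).
  by apply: measurableD; [exact: mA|exact: mA'].
apply/seteqP; split => x; first by move=> [Ix [Ax nAx]]; split => // -[].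
by move=> [[Ix Ax] nA]; split => //; split => // A'x; apply: nA.
Qed.

Lemma msec0 : msec set0.
Proof. by move=> i; rewrite (_ : _ `&` _ = set0)//; apply/seteqP; split => x // []. Qed.

Lemma measurable_glue (A : nat -> set X) (F : nat -> X -> R) H i :
  (forall k, msec (A k)) -> (forall k, measurable_fun I (fun x => F k (i, x))) ->
  (forall k p, A k p -> H p = F k p) -> (forall p, (forall k, ~ A k p) -> H p = 0) ->
  measurable_fun I (fun x => H (i, x)).
Proof.
move=> mA mF HF H0.
pose E k := if k is k'.+1 then I `&` [set x | A k' (i, x)]
  else I `\` (I `&` [set x | (\bigcup_k A k) (i, x)]).
have mE k : measurable (E k).
  case: k => [|k]; last exact: mA.
  by apply: measurableD; [exact: measurable_Ioo0|exact: msecU].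
have -> : I = \bigcup_k E k.
  apply/seteqP; split => x.
    move=> Ix; have [[k _ Ak]|nA] := pselect ((\bigcup_k A k) (i, x)).
      by exists k.+1.
    by exists 0%N => //; split => // -[_].
  by move=> [[|k] _ []].
apply/measurable_fun_bigcup => //; case=> [|k].
  apply: (eq_measurable_fun (fun _ : R => 0 : R)); last exact: measurable_cst.
  move=> x /set_mem [Ix nA].
  by rewrite H0// => k Ak; apply: nA; split => //; exists k.
apply: (eq_measurable_fun (fun x => F k (i, x))).
  by move=> x /set_mem [Ix Ak]; rewrite (HF k).
by apply: measurable_funS (mF k); [exact: measurable_Ioo0|exact: subIsetl].
Qed.

Section Uniform.
Variables (v : nat -> (X -> R) -> R).
Hypothesis vl : forall j, blin (v j).
Hypothesis v0 : forall F, B 1 1 F -> v n F @[n --> \oo] --> 0.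
Hypothesis vsm : forall c e, 0 < c -> 0 < e -> exists2 eta, 0 < eta &
  forall j F, B eta c F -> `|v j F| <= e.

Lemma v0c c F : 0 < c -> B c c F -> v n F @[n --> \oo] --> 0.
Proof.
move=> c0 BF; have h := v0 (Bset_scale c0 BF).
rewrite (_ : (fun n => v n F) = (fun n => c * v n (c^-1 *: F))).
  by rewrite -(mulr0 c); exact: cvgMl_tmp.
apply/funext => n; rewrite (blinearZ tau0 _ (vl n) (ltW c0) BF) mulrA divff ?mul1r//.
by rewrite gt_eqF.
Qed.

Lemma blinear_fadd (B' : set (X -> R)) c u : blin u -> 0 < c -> B' `<=` B c c ->
  (forall F, B' F -> B' (- F)) -> fadd B' u.
Proof.
move=> ul c0 BB BN; split.
- by move=> F H /BB BF /BB BH; exact: (blinearD ul (ltW c0)).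
- move=> F BF; split; first exact: BN.
  exact: (blinearN tau0 ul (ltW c0) (BB _ BF)).
- have [_ [M uM]] := ul; exists (c * M) => F /BB BF.
  exact: (blinear_le tau0 ul uM).
Qed.

(* On a bounded set, control by finitely many of the quadratic functionals is
   uniform in j. Otherwise a gliding hump produces F_n whose large values split
   into a part carried by few indices and a part carried by a set of small
   measure, and Brooks-Jewett applies to each. *)
Lemma uniform_quad e c : 0 < e -> 0 < c -> exists J : nat, exists2 d, 0 < d &
  forall F, B c c F -> (forall i, (i < J)%N -> quadf (v i) F <= d) ->
  forall j, `|v j F| <= e.
Proof.
move=> e0 c0; have c0' := ltW c0.
(* Values of modulus at most eta cost only e/4; from here on the part of F above eta matters. *)
have [eta eta0 Heta] := @vsm c (e / 4) c0 ltac:(lra).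
pose big F := [set p : X | eta < `|F p|].
have mbig F : B c c F -> msec (big F).
  move=> BF i; have [mF _ _] := BF i.
  exact: (measurable_level (f := fun x => F (i, x))).
have mT : msec setT.
  move=> i; rewrite (_ : _ `&` _ = I); first exact: measurable_Ioo0.
  by apply/seteqP; split => x //; case.
have mC A : msec A -> msec (~` A) by move=> mA; rewrite -setTD; exact: msecD.
have Bbig F A : msec A -> B c c F -> B c c (F \_ A) by move=> mA; exact: Bset_restr.
have splitF F A : F = F \_ A + F \_ (~` A).
  rewrite -restrU ?setICr// setUv; apply/funext => p.
  by rewrite patchE mem_set.
have vsplit j F A : msec A -> B c c F -> v j F = v j (F \_ A) + v j (F \_ (~` A)).
  move=> mA BF; rewrite {1}(splitF F A); apply: (blinearD (vl j) c0').
    exact: Bbig.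
  by apply: Bbig => //; exact: mC.
have vs j F : B c c F -> `|v j (F \_ (~` big F))| <= e / 4.
  move=> BF; apply: Heta => i; have [mF _ Fc] := Bbig _ _ (mC _ (mbig _ BF)) BF i.
  split => // x _; rewrite patchE; case: ifPn => [/set_mem/negP|_].
    by rewrite -leNgt.
  by rewrite normr0 ltW.
have vb j F : B c c F -> `|v j (F \_ (big F))| <= quadf (v j) F / eta.
  move=> BF; apply: (quad_dom tau0 (vl j) c0 BF eta0); last exact: Bbig (mbig _ BF) BF.
  have Bb := Bbig _ _ (mbig _ BF) BF; have BbZ := BsetZ eta Bb.
  move=> i; have [mF _ _] := BbZ i; split => // x Ix.
  change (`|eta * (F \_ (big F)) (i, x)| <= F (i, x) ^+ 2).
  rewrite patchE; case: ifPn => [/set_mem h|_]; last by rewrite mulr0 normr0 sqr_ge0.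
  rewrite normrM (gtr0_norm eta0) -real_normK ?num_real// expr2.
  by rewrite ler_wpM2r// ltW.
apply: contrapT => nU.
(* The entry eta e/4 makes quad <= kap imply |v| <= e/4 on large values; eta^2 here and 1 in [kap']
   serve the two applications of [brooks_jewett]. Of the two factors 2^-k in [del], one pays for the
   threshold 2^-n in [S]. *)
pose kap := Num.min (eta * e / 4) (eta ^+ 2).
have kap0 : 0 < kap by rewrite lt_min exprn_gt0// andbT divr_gt0// mulr_gt0.
have p0 k : 0 < (2^-1 ^+ k : R) by rewrite exprn_gt0.
pose kap' := Num.min kap 1.
have kap'0 : 0 < kap' by rewrite lt_min kap0 ltr01.
pose del k : R := kap' * (2^-1 ^+ k * 2^-1 ^+ k).
have del0 k : 0 < del k by rewrite !mulr_gt0.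
have /choice[q Hq] : forall J, exists p : (X -> R) * nat,
    [/\ B c c p.1, (forall i, (i < J)%N -> quadf (v i) p.1 <= del J) & e < `|v p.2 p.1|].
  move=> J; apply: contrapT => nq; apply: nU; exists J; exists (del J) => // F BF qF j.
  by rewrite leNgt; apply/negP => h; apply: nq; exists (F, j).
have half1 k : (2^-1 ^+ k : R) <= 1 by rewrite exprn_ile1//; lra.
have del_kap k : del k <= kap.
  apply: (@le_trans _ _ kap'); last by rewrite ge_min lexx.
  by rewrite /del ler_piMr ?(ltW kap'0)// -[leRHS]mulr1 ler_pM ?(ltW (p0 _)).
(* A functional of index below J is controlled by its own quad at q J, so the one that exceeds e has
   index at least J. *)
have qge J : (J <= (q J).2)%N.
  rewrite leqNgt; apply/negP => h; have [BF qF] := Hq J; apply/negP; rewrite -leNgt.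
  rewrite (vsplit _ _ _ (mbig _ BF) BF); apply: le_trans (ler_normD _ _) _.
  have h1 := vs (q J).2 _ BF; have h2 := vb (q J).2 _ BF.
  have : quadf (v (q J).2) (q J).1 / eta <= e / 4.
    rewrite ler_pdivrMr//; apply: (le_trans (qF _ h)); apply: (le_trans (del_kap J)).
    by rewrite ge_min (_ : e / 4 * eta = eta * e / 4) ?lexx//; lra.
  by lra.
pose Jn := fix Jn n := if n is k.+1 then (q (Jn k)).2.+1 else 0%N.
have Ji : incr Jn by apply: incr_ltn => n /=; rewrite ltnS.
pose jn n := (q (Jn n)).2; pose Fn n := (q (Jn n)).1.
have jJ m n : (m < n)%N -> (jn m < Jn n)%N.
  case: n => // n; rewrite ltnS => mn; rewrite /= ltnS.
  have [->//|mn'] := eqVneq m n.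
  have /Ji h : (m < n)%N by rewrite ltn_neqAle mn'.
  have : (Jn m.+1 <= Jn n)%N.
    have [->//|nm] := eqVneq m.+1 n; apply/ltnW/Ji.
    by rewrite ltn_neqAle nm ltn_neqAle mn'.
  by move=> /= /ltnW /leq_trans; apply; exact: qge.
have ji : incr jn.
  by move=> m n /jJ h; exact: leq_trans h (qge _).
have BF n : B c c (Fn n) by have [] := Hq (Jn n).
have qF m n : (m < n)%N -> quadf (v (jn m)) (Fn n) <= del n.
  move=> /jJ h; have [_ qF _] := Hq (Jn n); apply: (le_trans (qF _ h)).
  have hJ : (2^-1 ^+ Jn n : R) <= 2^-1 ^+ n.
    by rewrite ler_wiXn2l//; try lra; exact: incr_ge.
  by rewrite /del ler_pM2l// ler_pM// ltW.
have vF n : e < `|v (jn n) (Fn n)| by have [] := Hq (Jn n).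
pose Vn n := v (jn n).
have V0 c' F : 0 < c' -> B c' c' F -> Vn n F @[n --> \oo] --> 0.
  by move=> c'0 BF'; exact: (cvg_incr ji (v0c c'0 BF')).
(* Components where F_n has a large mean square; elsewhere Chebyshev's inequality makes the set of
   large values small. *)
pose S n : set nat := [set i | 2^-1 ^+ n < msqf (Fn n) i].
pose Aa n : set X := [set p | S n p.1].
pose AAa : set (set X) := [set A | exists T : set nat, A = [set p | T p.1]].
have AAam A : AAa A -> msec A.
  move=> [T ->] i; have [Ti|nTi] := pselect (T i).
    rewrite (_ : _ `&` _ = I); first exact: measurable_Ioo0.
    by apply/seteqP; split => x //; case.
  by rewrite (_ : _ `&` _ = set0)//; apply/seteqP; split => x // [].
(* First application: the sets are unions of whole components, along which functions of B 1 1 can be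
   glued. *)
have neara : \forall n \near \oo, small (B 1 1) (Vn n) (Aa n) (e / (8 * c)).
  apply: (@brooks_jewett R X AAa (B 1 1)).
  - by exists set0.
  - move=> A HA; have /choice[T HT] := HA; exists (\bigcup_n T n).
    apply/seteqP; split => p; first by move=> [n _]; rewrite HT => Tp; exists n.
    by move=> [n _ Tp]; exists n => //; rewrite HT.
  - by move=> A A' [T ->] [T' ->]; exists (T `\` T').
  - exact: Bset0.
  - move=> A F H HA tA BFk HF H0 i.
    have mH : measurable_fun I (fun x => H (i, x)).
      apply: (measurable_glue (A := A) (F := F)) => //.
        by move=> k; exact: AAam.
      by move=> k; have [] := BFk k i.
    have /choice[T HT] := HA.
    have [[k Tk]|nT] := pselect (exists k, T k i).
      have E x : H (i, x) = F k (i, x) by apply: HF; rewrite HT.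
      have [_ h1 h2] := BFk k i; split => // [x Ix|]; first by rewrite E h1.
      by under eq_integral do rewrite E.
    have E x : H (i, x) = 0 by apply: H0 => k; rewrite HT => Tk; apply: nT; exists k.
    split => // [x Ix|]; first by rewrite E normr0.
    by under eq_integral do rewrite E normr0; rewrite integral0 mul1e.
  - move=> n; apply: (@blinear_fadd (B 1 1) 1) => //; first exact: vl.
    by move=> F; exact: BsetN.
  - by move=> H BH; exact: (V0 1).
  - by move=> n; exists (S n).
  - move=> m n mn H BH.
    pose th : R := 2^-1 ^+ n.
    have th0 : 0 < th by exact: p0.
    have oF i : 0 <= msqf (Fn n) i <= c ^+ 2 by exact: msq_le c0' (BF n).
    have d0 : 0 < c ^+ 2 by rewrite exprn_gt0.
    have key G : B 1 1 G -> Vn m (G \_ (Aa n)) <= th.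
      move=> BG.
      (* On these components th G equals [msq (Fn n)] times the function a G of the unit ball, so
         the second supremum in quad bounds it; dividing by th uses one factor 2^-n of [del n]. *)
      pose a i : R := if 2^-1 ^+ n < msqf (Fn n) i then th / msqf (Fn n) i else 0.
      have a01 i : 0 <= a i <= 1.
        rewrite /a; case: ifPn => [h|_]; last by rewrite lexx ler01.
        have o0 : 0 < msqf (Fn n) i by exact: lt_trans (p0 n) h.
        by rewrite divr_ge0 ?(ltW th0) ?(ltW o0)//= ler_pdivrMr// mul1r ltW.
      have BaG := Bset_index_scale a01 BG.
      have E : th *: (G \_ (Aa n)) = index_scale (msqf (Fn n)) (index_scale a G).
        apply/funext => p; change (th * (G \_ (Aa n)) p = msqf (Fn n) p.1 * (a p.1 * G p)).
        rewrite patchE /a; case: ifPn => [/set_mem|/negP nS].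
          rewrite /Aa/= /S/= => h; rewrite h mulrA mulrCA divff ?mulr1//.
          by rewrite gt_eqF//; exact: lt_trans (p0 n) h.
        rewrite ifF ?mul0r ?mulr0//; apply/negP => h; apply: nS; exact/mem_set.
      have mulE : mulK gamma tau (msqf (Fn n)) (th *: (G \_ (Aa n))).
        by rewrite E; exists (index_scale a G).
      have h1 := sup_on_ub tau0 (vl (jn m)) d0 (mulK_B oF) mulE.
      have BGA : B 1 1 (G \_ (Aa n)) by apply: Bset_restr BG; apply: AAam; exists (S n).
      rewrite (blinearZ tau0 _ (vl (jn m)) ler01 BGA) in h1.
      have h2 := sup_on_dom_ge0 tau0 (vl (jn m)) c0 (BF n).
      have h3 := qF _ _ mn; rewrite /quad in h3.
      rewrite -(ler_pM2l th0); apply: (le_trans h1).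
      have h4 : del n <= th * th.
        rewrite /del -[leRHS]mul1r ler_wpM2r ?mulr_ge0 ?(ltW th0)//.
        by rewrite ge_min lexx orbT.
      by lra.
    rewrite ler_norml; apply/andP; split; last exact: key.
    have BHA : B 1 1 (H \_ (Aa n)) by apply: Bset_restr BH; apply: AAam; exists (S n).
    rewrite lerNl -(blinearN tau0 (vl (jn m)) ler01 BHA).
    have -> : - (H \_ (Aa n)) = (- H) \_ (Aa n).
      apply/funext => p; change (- (H \_ (Aa n)) p = ((- H) \_ (Aa n)) p).
      by rewrite !patchE; case: ifP => // _; rewrite oppr0.
    by apply: key; exact: BsetN.
  - by rewrite divr_gt0// mulr_gt0.
pose Db n : set X := ~` Aa n `&` big (Fn n).
have mAa n : msec (Aa n) by apply: AAam; exists (S n).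
have mDb n : msec (Db n).
  by rewrite /Db setIC -[X in _ `&` X]setCK -setDE; apply: msecD; [exact: mbig|rewrite setCK].
(* By Chebyshev, the i-th section of Db n has measure at most 2^-n tau_i / eta^2, so that of the
   union is at most C tau_i. Functions bounded by 1 and supported in [Ds] thus lie in one ball, and
   they can be glued along any measurable sets. *)
pose Ds := \bigcup_n Db n.
have mDs : msec Ds by exact: msecU.
pose C := 2 / eta ^+ 2.
have C0 : 0 < C by rewrite divr_gt0// exprn_gt0.
have Dbm n i : (mu (I `&` [set x | Db n (i, x)]) <= (2^-1 ^+ n / eta ^+ 2)%:E * tau i)%E.
  have [Si|nSi] := pselect (S n i).
    rewrite (_ : _ `&` _ = set0); first by rewrite measure0 mule_ge0// lee_fin divr_ge0 ?sqr_ge0// ltW.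
    by apply/seteqP; split => x // [_ [+ _]].
  have e2 : 0 < eta ^+ 2 by rewrite exprn_gt0.
  have [mF _ _] := BF n i.
  have cheb : ((eta ^+ 2)%:E * mu (I `&` [set x | Db n (i, x)]) <=
      \int[mu]_(x in I) (Fn n (i, x) ^+ 2)%:E)%E.
    have -> : ((eta ^+ 2)%:E * mu (I `&` [set x | Db n (i, x)]) =
        \int[mu]_(x in I `&` [set x | Db n (i, x)]) cst (eta ^+ 2)%:E x)%E.
      by rewrite integral_cst//; exact: mDb.
    have mFI : measurable_fun I (fun x => (Fn n (i, x) ^+ 2)%:E).
      by apply/measurable_EFinP; have [] := Bset_sq c0' (BF n) i.
    apply: (@le_trans _ _ (\int[mu]_(x in I `&` [set x | Db n (i, x)]) (Fn n (i, x) ^+ 2)%:E)%E).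
      apply: ge0_le_integral => //.
      - exact: mDb.
      - by move=> x _; rewrite lee_fin ltW.
      - by apply: measurable_funS mFI; [exact: measurable_Ioo0|exact: subIsetl].
      - move=> x [Ix [_ h]]; rewrite lee_fin -[leRHS]real_normK ?num_real//.
        by rewrite ler_sqr ?nnegrE// ltW.
    apply: ge0_subset_integral => //; [exact: mDb|exact: measurable_Ioo0|].
    by move=> x _; rewrite lee_fin sqr_ge0.
  rewrite -lee_pdivlMl// in cheb; apply: (le_trans cheb).
  rewrite [X in (X%:E * tau i)%E]mulrC EFinM -muleA lee_pmul2l ?lte_fin ?invr_gt0//.
  have := integral_sq_le i c0' (BF n).
  move: nSi; rewrite /S/= /msq /Rintegral => /negP; rewrite -leNgt.
  have := tau0 i; case: (tau i) => [r||//].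
    rewrite lee_fin le_eqVlt => /predU1P[<-|r0].
      by rewrite mule0 => _ /le_trans; apply; rewrite mule0.
    rewrite /= ler_pdivrMr// => h hf; rewrite -EFinM.
    rewrite -[X in (X <= _)%E]fineK ?lee_fin//.
    rewrite ge0_fin_numE; first by apply: le_lt_trans hf _; rewrite -EFinM ltry.
    by apply: integral_ge0 => x _; rewrite lee_fin sqr_ge0.
  by move=> _ _ _; rewrite gt0_muley ?lte_fin// leey.
have Dsm i : (mu (I `&` [set x | Ds (i, x)]) <= C%:E * tau i)%E.
  have -> : I `&` [set x | Ds (i, x)] = \bigcup_n (I `&` [set x | Db n (i, x)]).
    apply/seteqP; split => x; first by move=> [Ix [n _ Dx]]; exists n.
    by move=> [n _ [Ix Dx]]; split => //; exists n.
  apply: (@le_trans _ _ (\sum_(0 <= n <oo) mu (I `&` [set x | Db n (i, x)]))%E).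
    apply: measure_sigma_subadditive => //; first by move=> n; exact: mDb.
    by apply: bigcupT_measurable => n; exact: mDb.
  apply: nneseries_le => // M.
  apply: (@le_trans _ _ (\sum_(0 <= n < M) (2^-1 ^+ n / eta ^+ 2)%:E * tau i)%E).
    by apply: lee_sum => n _; exact: Dbm.
  rewrite -ge0_sume_distrl; last first.
    by move=> n _; rewrite lee_fin divr_ge0 ?sqr_ge0// ltW.
  rewrite lee_wpmul2r// sumEFin lee_fin -mulr_suml /C ler_wpM2r ?invr_ge0 ?sqr_ge0//.
  by have := sum_half_le R 0 M; rewrite expr0 mulr1.
pose Bb : set (X -> R) := [set H : X -> R | forall i : nat,
  [/\ measurable_fun I (fun x => H (i, x)), (forall x, I x -> `|H (i, x)| <= 1) &
      forall x, ~ Ds (i, x) -> H (i, x) = 0]].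
pose c1 : R := 1 + C.
have c10 : 0 < c1 by rewrite /c1; lra.
have BbB : Bb `<=` B c1 c1.
  move=> H BH i; have [mH h1 hD] := BH i; split => //.
    by move=> x Ix; apply: le_trans (h1 _ Ix) _; rewrite /c1; lra.
  apply: (@le_trans _ _ (\int[mu]_(x in I) (\1_(I `&` [set x | Ds (i, x)]) x)%:E)%E).
    apply: ge0_le_integral => //; first exact: measurable_Ioo0.
    - by apply/measurable_EFinP; exact: (measurable_abs (F := H)).
    - by apply/measurable_EFinP; apply: measurable_indic; exact: mDs.
    - move=> x Ix; rewrite lee_fin indicE.
      have [Dx|nDx] := pselect (Ds (i, x)); first by rewrite mem_set//; exact: h1.
      by rewrite hD// normr0.
  rewrite integral_indic; [|exact: measurable_Ioo0|exact: mDs].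
  rewrite setIAC setIid; apply: le_trans (Dsm i) _.
  by apply: lee_wpmul2r => //; rewrite lee_fin /c1; lra.
(* Second application, to functions supported in [Ds]: on Db n the function eta^2 H is below F_n^2,
   so the first supremum in quad bounds the earlier functionals. *)
have nearb : \forall n \near \oo, small Bb (Vn n) (Db n) (e / (8 * c)).
  apply: (@brooks_jewett R X msec Bb).
  - exact: msec0.
  - exact: msecU.
  - exact: msecD.
  - by move=> i; split => // x _; rewrite normr0.
  - move=> A F H HA tA BFk HF H0 i; split.
    + apply: (measurable_glue (A := A) (F := F)) => //.
      by move=> k; have [] := BFk k i.
    + move=> x Ix; have [[k Ak]|nA] := pselect (exists k, A k (i, x)).
        by rewrite (HF _ _ Ak); have [_ + _] := BFk k i; apply.
      by rewrite H0 ?normr0// => k Ak; apply: nA; exists k.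
    + move=> x nD; have [[k Ak]|nA] := pselect (exists k, A k (i, x)).
        by rewrite (HF _ _ Ak); have [_ _] := BFk k i; apply.
      by rewrite H0// => k Ak; apply: nA; exists k.
  - move=> n; apply: (blinear_fadd (vl _) c10 BbB).
    move=> F BFb i; have [m h1 h2] := BFb i; split.
    + by have [] := BsetN (BbB _ BFb) i.
    + by move=> x Ix; rewrite normrN; exact: h1.
    + by move=> x nD; change (- F (i, x) = 0); rewrite h2// oppr0.
  - by move=> H /BbB BH; exact: (V0 c1).
  - exact: mDb.
  - move=> m n mn H BH.
    have e2 : 0 < eta ^+ 2 by rewrite exprn_gt0.
    have BHD : B (c1 + c) (c1 + c) (H \_ (Db n)).
      by apply: (@BsetW _ _ _ tau0 c1 c1) => //; try lra; exact: Bset_restr (mDb n) (BbB _ BH).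
    have BFc : B (c1 + c) (c1 + c) (Fn n) by apply: (@BsetW _ _ _ tau0 c c) => //; lra.
    have cc : 0 < c1 + c by lra.
    apply: le_trans (quad_dom tau0 (vl (jn m)) cc BFc e2 _ BHD) _.
      move=> i; have [mH' _ _] := BsetZ (eta ^+ 2) BHD i; split => // x Ix.
      change (`|eta ^+ 2 * (H \_ (Db n)) (i, x)| <= Fn n (i, x) ^+ 2).
      rewrite patchE; case: ifPn => [/set_mem [_ h]|_]; last by rewrite mulr0 normr0 sqr_ge0.
      rewrite normrM (gtr0_norm e2) -[leRHS]real_normK ?num_real//.
      have [_ h1 _] := BH i; apply: (@le_trans _ _ (eta ^+ 2)).
        by rewrite ler_piMr ?(ltW e2)// h1.
      by rewrite ler_sqr ?nnegrE// ltW.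
    rewrite ler_pdivrMr//; apply: (le_trans (qF _ _ mn)).
    rewrite /del mulrC ler_pM ?mulr_ge0 ?(ltW (p0 _)) ?(ltW kap'0)//.
      by rewrite ler_piMr// ltW.
    by rewrite 2!ge_min lexx !orbT.
  - by rewrite divr_gt0// mulr_gt0.
have [n [sa sb]] : exists n, small (B 1 1) (Vn n) (Aa n) (e / (8 * c)) /\
    small Bb (Vn n) (Db n) (e / (8 * c)).
  have := filterI neara nearb; case=> N _ /(_ N (leqnn N)) /= [h1 h2].
  by exists N.
have BFb := Bbig _ _ (mbig _ (BF n)) (BF n).
(* F_n is the sum of its small values (e/4), its large values on [Aa n] (e/8) and those on [Db n]
   (e/8), which contradicts the lower bound e. *)
have := vF n; apply/negP; rewrite -leNgt -/(Vn n).
rewrite /Vn (vsplit _ _ _ (mbig _ (BF n)) (BF n)).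
rewrite (vsplit _ _ _ (mAa n) BFb).
have h1 := vs (jn n) _ (BF n).
have E8 : c * (e / (8 * c)) = e / 8.
  by field; rewrite gt_eqF.
have scaleE G A : B c c G -> msec A ->
    `|v (jn n) ((c^-1 *: G) \_ A)| <= e / (8 * c) -> `|v (jn n) (G \_ A)| <= e / 8.
  move=> BG mA; have -> : (c^-1 *: G) \_ A = c^-1 *: (G \_ A).
    apply/funext => p; change (((c^-1 *: G) \_ A) p = c^-1 * (G \_ A) p).
    by rewrite !patchE; case: ifP => // _; rewrite mulr0.
  rewrite (blinearZ tau0 _ (vl _) c0' (Bbig _ _ mA BG)) normrM gtr0_norm ?invr_gt0//.
  by rewrite ler_pdivrMl// E8.
have h2 : `|v (jn n) ((Fn n \_ (big (Fn n))) \_ (Aa n))| <= e / 8.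
  by apply: scaleE => //; apply: sa; exact: Bset_scale.
have h3 : `|v (jn n) ((Fn n \_ (big (Fn n))) \_ (~` Aa n))| <= e / 8.
  have -> : (Fn n \_ (big (Fn n))) \_ (~` Aa n) = Fn n \_ (Db n).
    apply/funext => p; rewrite !patchE /Db.
    have [h|h] := pselect (Aa n p).
      by rewrite memNset; [rewrite memNset// => -[]|move=> /(_ h)].
    rewrite mem_set//; have [h'|h'] := pselect (big (Fn n) p).
      by rewrite !mem_set.
    by rewrite !memNset// => -[].
  apply: scaleE => //.
  have -> : (c^-1 *: Fn n) \_ (Db n) = ((c^-1 *: Fn n) \_ Ds) \_ (Db n).
    apply/funext => p; rewrite !patchE; case: ifPn => // /set_mem h.
    by rewrite mem_set//; exists n.
  apply: sb => i; have [m1 m2 _] := Bset_restr mDs (Bset_scale c0 (BF n)) i.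
  split => // x nD; by rewrite patchE memNset.
apply: le_trans (ler_normD _ _) _.
have := ler_normD (v (jn n) ((Fn n \_ (big (Fn n))) \_ (Aa n)))
  (v (jn n) ((Fn n \_ (big (Fn n))) \_ (~` Aa n))).
lra.
Qed.

(** The argument of the projection theorem, for nested convex sets: the infima D k increase to a
    finite supremum, so near-minimizers far out are close in the sense of Q. *)
Lemma weak_null_contradiction C e : 0 < C -> 0 < e ->
  ~ (forall k, exists2 F, B C C F & forall i, (i < k)%N -> e <= v i F).
Proof.
move=> C0 e0 HK; have C0' := ltW C0.
have [J [d d0 HU]] := @uniform_quad (e / 2) (C + C) ltac:(lra) ltac:(lra).
pose Q F := \sum_(0 <= i < J) quadf (v i) F.
have Q_ge0 c F : 0 < c -> B c c F -> 0 <= Q F.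
  by move=> c0 BF; apply: sumr_ge0 => i _; exact: (quad_ge0 tau0 (vl i) c0).
have [b Qb] : exists b, forall F, B C C F -> Q F <= b.
  have /choice[b Hb] := fun i => quad_le tau0 (vl i) C0.
  exists (\sum_(0 <= i < J) b i) => F BF; apply: ler_sum => i _; exact: Hb.
pose K k := [set F | B C C F /\ forall i, (i < k)%N -> e <= v i F].
have K0 k : K k !=set0 by have [F BF vF] := HK k; exists F.
have KS k l : (k <= l)%N -> K l `<=` K k.
  by move=> kl F [BF vF]; split => // i ik; apply: vF; exact: leq_trans kl.
pose D k := inf [set Q F | F in K k].
have hD k : has_inf [set Q F | F in K k].
  have [F KF] := K0 k; split; first by exists (Q F), F.
  by exists 0 => _ [H [BH _] <-]; exact: (Q_ge0 C).
have hs : has_sup (range D).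
  split; first by exists (D 0%N), 0%N.
  exists b => _ [k _ <-]; have [F KF] := K0 k; have [BF _] := KF.
  by apply: le_trans (Qb F BF); apply: inf_lbound; [exact: (hD k).2|exists F].
have d8 : 0 < d / 8 by lra.
have [_ [k _ <-] hk] := sup_adherent d8 hs.
have Dle l : D l <= sup (range D) by apply: sup_upper_bound => //; exists l.
have near l : exists2 F, K l F & Q F < D l + d / 8.
  by have [_ [F KF <-] h] := inf_adherent d8 (hD l); exists F.
have [g Kg Qg] := near k; have [Bg vg] := Kg.
(* j is chosen after g, and h after j: v j is already small at g, whereas membership of h in a later
   set forces v j h >= e. *)
have [j vj] : exists j, `|v j g| < e / 2.
  have /cvgr0_norm_lt/(_ (e / 2)) [|N _ /(_ N (leqnn N)) h] := v0c C0 Bg; first by lra.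
  by exists N.
have [h Kh Qh] := near (maxn k j.+1); have [Bh vh] := Kh.
have kl : (k <= maxn k j.+1)%N by rewrite leq_maxl.
pose m := 2^-1 *: (g + h).
have BD : B (C + C) (C + C) (g + h) := BsetD C0' C0' Bg Bh.
have Bm : B C C m.
  have := BsetZ 2^-1 BD; rewrite ger0_norm//.
  by rewrite (_ : 2^-1 * (C + C) = C)//; lra.
have Km : K k m.
  split => // i ik; rewrite (blinearZ tau0 _ (vl i) _ BD); last by lra.
  rewrite (blinearD (vl i) C0' Bg Bh).
  have := vg i ik; have := vh i (leq_trans ik kl); lra.
have mE : m + m = g + h.
  by rewrite -scalerDl (_ : 2^-1 + 2^-1 = 1) ?scale1r//; lra.
have Qm : D k <= Q m by apply: inf_lbound; [exact: (hD k).2|exists m].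
(* The midpoint m lies in K k, so Q m >= D k; with l = maxn k j.+1 the identity bounds Q (g - h) by
   2 (D l - D k) + d/2 <= d. *)
have par : Q (g - h) = 2 * Q g + 2 * Q h - 4 * Q m.
  rewrite /Q !mulr_sumr -big_split/= -sumrB; apply: eq_bigr => i _.
  have := quad_par tau0 (vl i) C0 Bg Bh; rewrite -mE (quad2 tau0 (vl i) C0 Bm).
  by lra.
have Bgh : B (C + C) (C + C) (g - h) := BsetD C0' C0' Bg (BsetN Bh).
have CC : 0 < C + C by lra.
have Qd : Q (g - h) <= d by have := Dle (maxn k j.+1); lra.
have : `|v j (g - h)| <= e / 2.
  apply: HU => // i iJ; apply: le_trans Qd; rewrite /Q (bigD1_seq i)/=.
  - by rewrite lerDl; apply: sumr_ge0 => l _; exact: (quad_ge0 tau0 (vl l) CC).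
  - by rewrite mem_index_iota.
  - exact: iota_uniq.
rewrite (blinearB tau0 (vl j) C0' Bg Bh).
have := vh j (leq_maxr _ _); move: vj.
rewrite ltr_norml ler_norml => /andP[h1 h2] h3 /andP[h4 h5]; lra.
Qed.

End Uniform.
End Core.

(** * Level decomposition *)

Section Weights.
Variables (R : realType) (gamma : \bar R) (psi : R -> R) (A : R).
Local Notation mu := (@lebesgue_measure R).
Local Notation I := (Ioo0 gamma).
Local Notation V := (Mpsi gamma psi).
Local Notation nrm := (Mnorm gamma psi).
Hypothesis cw : concave_weight gamma psi.
Let psi_mono := cw_mono cw.
Hypothesis gamma0 : (0 < gamma)%E.
Hypothesis A2 : 2 <= A.
Hypothesis dil : forall t, 0 < t -> ((A * t)%:E < gamma)%E -> 2 * psi t <= psi (A * t).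

Let psi_gt0 := psi_gt0 cw.

Let psi_star := psi_star cw.

Let A0 : 0 < A. Proof. exact: lt_le_trans A2. Qed.

Definition level_set (s : R) : set R :=
  [set r | [/\ 0 <= r, (r%:E < gamma)%E & s * r <= psi r]].

(** Generalized inverse of psi(r)/r. It bounds the measure of {|f| > s} for f in the unit ball,
    since s t <= psi(t) whenever f^* >= s on (0,t). *)
Definition level_tau (s : R) : \bar R := ereal_sup [set r%:E | r in level_set s].

Lemma level_tau_ge0 s : (0 <= level_tau s)%E.
Proof. by apply: ereal_sup_ubound; exists 0 => //; split => //; rewrite mulr0 (cw_0 cw). Qed.

Lemma level_set_le s r : level_set s r -> (r%:E <= level_tau s)%E.
Proof. by move=> Lr; apply: ereal_sup_ubound; exists r. Qed.

(** If A s r <= psi(r), then dilation gives s (2Ar) <= 2 psi(r) <= psi(Ar) <= psi(2Ar): r in the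
    level set at A s puts 2Ar into the level set at s. The hypothesis on t excludes that these
    points run past gamma. *)
Lemma level_tau_lt s t : 0 < s -> I t -> (level_tau s < t%:E)%E ->
  ((2 * A)%:E * level_tau (A * s)%R <= level_tau s)%E.
Proof.
move=> s0 [t0 tg] tau_t.
have notin z : level_set s z -> t <= z -> False.
  move=> /level_set_le zt tz; have := lt_le_trans tau_t (_ : t%:E <= z%:E)%E.
  by rewrite lee_fin => /(_ tz) /(le_lt_trans zt); rewrite ltxx.
suff H r : level_set (A * s) r -> ((2 * A * r)%:E <= level_tau s)%E.
  have A20 : 0 < 2 * A by rewrite mulr_gt0.
  rewrite -lee_pdivlMl//; apply: ge_ereal_sup => _ [r Lr <-].
  by rewrite lee_pdivlMl// -EFinM; exact: H.
move=> [r0 rg rs]; move: r0; rewrite le_eqVlt => /predU1P[<-|r0].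
  by rewrite mulr0 level_tau_ge0.
have Ar0 : 0 < A * r by exact: mulr_gt0.
have [Arg|gAr] := ltP (A * r)%:E gamma; last first.
  (* If A r passes gamma, every z < gamma with z >= r satisfies s z <= A s r <= psi(r) <= psi(z); z
     = max(t, r) contradicts that the level set stays below t. *)
  exfalso; pose z := Num.max t r.
  have zg : (z%:E < gamma)%E by rewrite /z; case: (leP t r).
  have zA : z <= A * r by rewrite -lee_fin ltW// (lt_le_trans zg).
  apply: (notin z); last by rewrite le_max lexx.
  split => //; first by rewrite le_max (ltW t0).
  apply: (@le_trans _ _ (psi r)); last first.
    by apply: psi_mono (ltW r0) _ zg; rewrite le_max lexx orbT.
  apply: le_trans rs; rewrite [A * s]mulrC -mulrA; by rewrite ler_pM2l.
have pA : s * (2 * A * r) <= psi (A * r).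
  apply: le_trans (dil r0 Arg); apply: (@le_trans _ _ (2 * (A * s * r))).
    by rewrite le_eqVlt; apply/orP; left; apply/eqP; ring.
  by rewrite ler_pM2l.
have [A2g|gA2] := ltP (2 * A * r)%:E gamma.
  apply: level_set_le; split => //; first by rewrite mulr_ge0 ?mulr_ge0 ?(ltW r0) ?(ltW A0).
  apply: (le_trans pA); apply: psi_mono => //; first exact: ltW.
  by rewrite -mulrA ler_peMl ?(ltW Ar0)//; lra.
exfalso; have [At|tA] := leP (A * r) t.
  apply: (notin t) => //; split => //; first exact: ltW.
  apply: (@le_trans _ _ (psi (A * r))); last by apply: psi_mono => //; exact: ltW.
  apply: le_trans pA; rewrite ler_pM2l//.
  by rewrite -lee_fin ltW// (lt_le_trans tg).
apply: (notin (A * r)); last exact: ltW.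
split => //; first exact: ltW.
apply: le_trans pA; rewrite ler_pM2l//.
by rewrite -mulrA ler_peMl ?(ltW Ar0)//; lra.
Qed.

Definition level_y (t s : R) : R := s * fine (Order.min t%:E (level_tau s)).

Lemma level_min_fin t s : 0 < t -> Order.min t%:E (level_tau s) \is a fin_num.
Proof.
move=> t0; rewrite ge0_fin_numE; first by rewrite gt_min ltry.
by rewrite le_min level_tau_ge0 lee_fin ltW.
Qed.

Lemma level_y_ge0 t s : 0 < t -> 0 < s -> 0 <= level_y t s.
Proof.
move=> t0 s0; rewrite mulr_ge0 ?(ltW s0)// fine_ge0// le_min level_tau_ge0.
by rewrite lee_fin ltW.
Qed.

(** The summand at level r is r t until [level_tau r] drops below t, and from there on it halves by
    [level_tau_lt]; [lacunary_sum] applies with P = psi(t). *)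
Lemma level_sum t s M : 0 < s -> I t ->
  \sum_(0 <= k < M) level_y t (A ^+ k * s) <= 4 * psi t.
Proof.
move=> s0 It; have [t0 tg] := It.
have As0 k : 0 < A ^+ k * s by rewrite mulr_gt0// exprn_gt0.
have min_le r : fine (Order.min t%:E (level_tau r)) <= t.
  by rewrite -lee_fin fineK ?level_min_fin// ge_min lexx.
apply: (@lacunary_sum _ _ _ (fun k => A ^+ k * s * t)).
- by move=> k; exact: level_y_ge0.
- by move=> k; rewrite /level_y ler_pM2l.
- move=> k; set r := A ^+ k * s; have r0 : 0 < r by exact: As0.
  have [rt|tr] := leP (r * t) (psi t).
    by apply: le_trans rt; rewrite /level_y ler_pM2l.
  rewrite /level_y -ler_pdivlMl// -lee_fin fineK ?level_min_fin// ge_min; apply/orP; right.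
  apply: ge_ereal_sup => _ [x [x0 xg xr] <-]; rewrite lee_fin ler_pdivlMl//.
  apply: (le_trans xr); apply: psi_mono => //; rewrite leNgt; apply/negP => tx.
  have x1 : 0 < x by exact: lt_trans tx.
  have h := psi_star t0 (ltW tx) (conj x1 xg).
  have h2 : t * (r * x) <= t * psi x by rewrite ler_pM2l.
  have h3 : x * psi t < x * (r * t) by rewrite ltr_pM2l.
  have E : t * (r * x) = x * (r * t) by ring.
  lra.
- move=> k; rewrite exprS.
  have : 0 < A ^+ k * s * t by rewrite mulr_gt0.
  have -> : A * A ^+ k * s * t = A * (A ^+ k * s * t) by ring.
  by move=> h; rewrite ler_wpM2r// ltW.
- move=> k; set r := A ^+ k * s; have r0 : 0 < r by exact: As0.
  have -> : A ^+ k.+1 * s = A * r by rewrite exprS mulrA.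
  rewrite /level_y ltr_pM2l// => h.
  have tau_t : (level_tau r < t%:E)%E.
    move: h; rewrite -lte_fin fineK ?level_min_fin// gt_min => /orP[|//].
    by rewrite ltxx.
  have H := level_tau_lt r0 It tau_t.
  have -> : Order.min t%:E (level_tau r) = level_tau r by apply/min_idPr; exact: ltW.
  have fr : level_tau r \is a fin_num.
    by rewrite ge0_fin_numE ?level_tau_ge0// (lt_trans tau_t)// ltry.
  have h1 : (2 * A) * fine (Order.min t%:E (level_tau (A * r))) <= fine (level_tau r).
    rewrite -lee_fin EFinM fineK ?level_min_fin// fineK//; apply: le_trans H.
    apply: lee_wpmul2l; first by rewrite lee_fin mulr_ge0// ltW.
    by rewrite ge_min lexx orbT.
  have -> : 2 * (A * r * fine (Order.min t%:E (level_tau (A * r)))) =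
    r * ((2 * A) * fine (Order.min t%:E (level_tau (A * r)))) by ring.
  by rewrite ler_pM2l.
Qed.

(* The even indices enumerate the powers A^k, k >= 0, the odd ones the negative powers. *)
Definition level (n : nat) : R :=
  if odd n then A^-1 ^+ n./2.+1 else A ^+ n./2.

(** The factor A brings the layer level n < |f| <= A level n into the unit ball after division. *)
Definition lweight n := A * level n.
Definition ltau n := level_tau (level n).

Lemma level_gt0 n : 0 < level n.
Proof. by rewrite /level; case: ifP => _; rewrite exprn_gt0// invr_gt0. Qed.

(** The first 2M levels are A^-M, ..., A^(M-1) in another order, one geometric progression to which
    [level_sum] applies. *)
Lemma level_reindex (f : R -> R) (M : nat) :
  \sum_(0 <= n < M.*2) f (level n) = \sum_(0 <= k < M.*2) f (A ^+ k * A^-1 ^+ M).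
Proof.
elim: M => [|M IH]; first by rewrite !big_geq.
rewrite doubleS [LHS]big_nat_recr//= [X in X + _ = _]big_nat_recr//= IH.
rewrite [RHS]big_nat_recl//= expr0 mul1r [X in _ = _ + X]big_nat_recr//=.
have -> : level M.*2 = A ^+ M by rewrite /level odd_double doubleK.
have -> : level M.*2.+1 = A^-1 ^+ M.+1.
  by rewrite /level /= odd_double /= uphalf_double.
have E k : A ^+ k.+1 * A^-1 ^+ M.+1 = A ^+ k * A^-1 ^+ M.
  by rewrite exprSr exprS mulrA mulrK// unitfE gt_eqF.
rewrite E -addnn exprD -mulrA -exprMn mulrV ?unitfE ?gt_eqF// expr1n mulr1.
rewrite [LHS]addrC; congr (_ + (_ + _)).
by apply: eq_bigr => k _; rewrite E.
Qed.

Lemma level_wsum t : I t -> (wsum lweight ltau 1 1 t <= (4 * A * psi t)%:E)%E.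
Proof.
move=> It; have [t0 _] := It.
apply: nneseries_le => [n|N].
  rewrite mule_ge0 ?lee_fin ?mulr_ge0 ?(ltW A0) ?(ltW (level_gt0 _))//.
  by rewrite le_min lee_fin mul1r mul1e level_tau_ge0 ltW.
rewrite (eq_bigr (fun n => (A * level_y t (level n))%:E)); last first.
  move=> n _; rewrite mul1r mul1e /lweight /level_y mulrA [RHS]EFinM fineK//.
  exact: level_min_fin.
rewrite sumEFin lee_fin -mulr_sumr [4 * A]mulrC -mulrA ler_pM2l//.
apply: (@le_trans _ _ (\sum_(0 <= n < N.*2) level_y t (level n))).
  rewrite [leRHS](@big_cat_nat _ _ _ N)//=; last by rewrite -addnn leq_addr.
  rewrite lerDl; apply: sumr_ge0 => n _; apply: level_y_ge0 => //.
  exact: level_gt0.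
rewrite level_reindex; apply: level_sum => //.
by rewrite exprn_gt0// invr_gt0.
Qed.

Lemma level_sep m n : m != n -> A * level m <= level n \/ A * level n <= level m.
Proof.
have A1 : 1 <= A by apply: le_trans A2; lra.
have AV : A^-1 <= 1 by rewrite invf_le1.
have AV0 : 0 <= A^-1 by rewrite invr_ge0 ltW.
have up i j : (i < j)%N -> A * A ^+ i <= A ^+ j by move=> ij; rewrite -exprS ler_weXn2l.
have VE j : A * A^-1 ^+ j.+1 = A^-1 ^+ j by rewrite exprS mulrA divff ?mul1r// gt_eqF.
have dn i j : (i < j)%N -> A * A^-1 ^+ j.+1 <= A^-1 ^+ i.+1.
  by move=> ij; rewrite VE ler_wiXn2l.
have mx i j : A * A^-1 ^+ j.+1 <= A ^+ i.
  by rewrite VE (@le_trans _ _ 1)// ?exprn_ile1// exprn_ege1.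
rewrite /level => mn.
have : m./2 != n./2 \/ odd m != odd n.
  have [E|] := eqVneq m./2 n./2; last by left.
  right; apply: contra_neq mn => E'.
  by rewrite -(odd_double_half m) -(odd_double_half n) E E'.
case: (odd m); case: (odd n) => -[]// h.
- by move: h; rewrite neq_ltn => /orP[h|h]; [right|left]; exact: dn.
- by left; exact: mx.
- by left; exact: mx.
- by right; exact: mx.
- by right; exact: mx.
- by move: h; rewrite neq_ltn => /orP[h|h]; [left|right]; exact: up.
Qed.

Lemma level_ex (y : R) : 0 < y -> exists n, level n < y <= A * level n.
Proof.
move=> y0.
have A1 : 1 <= A by apply: le_trans A2; lra.
have VV : `|A^-1| < 1.
  rewrite ger0_norm ?invr_ge0 ?(ltW A0)// invf_lt1//.
  by apply: lt_le_trans A2; lra.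
have cV := cvg_expr VV.
have [y1|y1] := leP y 1.
  have ex : exists k, A^-1 ^+ k < y.
    have /cvgr_lt/(_ _ y0)[k _ /(_ k (leqnn k)) h] := cV.
    by exists k.
  case: (ex_minnP ex) => -[|k] kP kmin; first by move: kP; rewrite expr0 ltNge y1.
  exists k.*2.+1; rewrite /level /= odd_double /= uphalf_double kP/=.
  rewrite exprS mulrA divff ?mul1r ?gt_eqF// leNgt; apply/negP => /kmin.
  by rewrite ltnn.
have ex : exists k, y <= A ^+ k.
  have yV : 0 < y^-1 by rewrite invr_gt0.
  have /cvgr_lt/(_ _ yV)[k _ /(_ k (leqnn k)) h] := cV.
  exists k; move: h; rewrite /= exprVn ltf_pV2 ?posrE ?exprn_gt0//.
  exact: ltW.
case: (ex_minnP ex) => -[|k] kP kmin; first by move: kP; rewrite expr0 leNgt y1.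
exists k.*2; rewrite /level odd_double doubleK -exprS kP andbT ltNge.
by apply/negP => /kmin; rewrite ltnn.
Qed.

(** For t > 0 below the measure on the left, f^* >= s on (0,t), so s t <= psi(t) and t belongs to
    the level set. *)
Lemma level_measure f s : V f -> nrm f <= 1 -> 0 < s ->
  (mu (I `&` [set x | s < `|f x|]%R) <= level_tau s)%E.
Proof.
move=> Vf f1 s0; have [mf _] := Vf.
have I0 := Ioo0_neq0 cw.
set m := mu _.
have mg : (m <= gamma)%E.
  apply: (@le_trans _ _ (mu I)).
    apply: le_measure; rewrite ?inE; [exact: measurable_level mf|exact: measurable_Ioo0|].
    exact: subIsetl.
  case: gamma gamma0 => [r r0||//]; last by rewrite leey.
  rewrite (_ : Ioo0 r%:E = `]0, r[%classic).
    by rewrite lebesgue_measure_itvoo ?subr0// ltW// -lte_fin.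
  by apply/seteqP; split => x; rewrite /Ioo0/= in_itv/= lte_fin;
    [move=> [-> ->]|move=> /andP[]].
have key (t : R) : (t%:E < m)%E -> (t%:E <= level_tau s)%E.
  move=> tm; have [t0|t0] := leP t 0.
    by apply: (@le_trans _ _ 0%E); [rewrite lee_fin|exact: level_tau_ge0].
  have It : I t by split => //; exact: lt_le_trans mg.
  apply: level_set_le; split; [exact: ltW|by case: It|].
  have h : (int_drearr gamma f t <= (psi t)%:E)%E.
    apply: le_trans (int_drearr_le_Mnorm psi_gt0 I0 Vf It) _.
    by rewrite lee_fin ler_piMl// ltW// psi_gt0.
  rewrite -lee_fin; apply: le_trans h.
  have -> : (s * t)%:E = (\int[mu]_(x in `]0%R, t[%classic) cst s%:E x)%E.
    by rewrite integral_cst//= lebesgue_measure_itvoo ?(ltW t0)// subr0.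
  apply: ge0_le_integral => //.
  - by move=> x _; rewrite lee_fin ltW.
  - apply: (measurable_funS _ _ (measurable_drearr mf)) => //.
    by move=> x /=; rewrite !in_itv/= andbT => /andP[].
  - move=> r /=; rewrite in_itv/= => /andP[r0 rt].
    apply: le_ereal_inf_tmp => _ [z [z0 dz] <-]; rewrite lee_fin leNgt; apply/negP => zs.
    have : (m <= r%:E)%E by apply: le_trans dz; exact: distr_fun_le (ltW zs).
    by move=> /(lt_le_trans tm); rewrite lte_fin ltNge (ltW rt).
have : (0 <= m)%E by exact: measure_ge0.
case: m mg key => [r||//] _ key r0.
  apply/lee_addgt0Pr => e e0.
  have := key (r - e); rewrite lte_fin => /(_ _)/leeD2r-/(_ e%:E).
  by rewrite -EFinD subrK; apply; rewrite ltrBlDr ltrDl.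
have : forall t : R, (t%:E <= level_tau s)%E by move=> t; apply: key; rewrite ltry.
case: (level_tau s) => [r|//|] H; last by have := H 0.
by have := H (r + 1); rewrite lee_fin leNgt ltrDl ltr01.
Qed.

(** Each nonzero value of f falls into exactly one layer between consecutive levels, so the series
    has at most one nonzero term at each point. The image of B 1 1 thus contains the unit ball. *)
Lemma level_decomposition f : V f -> nrm f <= 1 ->
  exists2 F, Bset gamma ltau 1 1 F & Qs lweight F = f.
Proof.
move=> Vf f1; have [mf _] := Vf.
have maf : measurable_fun I (fun x => `|f x|) by exact: measurableT_comp.
pose F (p : nat * R) : R :=
  if (level p.1 < `|f p.2|) && (`|f p.2| <= A * level p.1) then f p.2 / lweight p.1 else 0.
have w0 n : 0 < lweight n by rewrite mulr_gt0// level_gt0.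
exists F; last first.
  apply/funext => x; have [fx|fx] := eqVneq (f x) 0.
    rewrite (@Qs_single _ _ _ 0%N) /F/= ?fx ?mul0r ?if_same ?mulr0// => k _.
    by rewrite ?mul0r ?if_same.
  have fx0 : 0 < `|f x| by rewrite normr_gt0.
  have [n Hn] := level_ex fx0.
  rewrite (@Qs_single _ _ _ n) /F/=.
    by rewrite Hn mulrCA divff ?mulr1// gt_eqF.
  move=> k kn; case: ifPn => // /andP[k1 k2]; move/andP: Hn => [n1 n2].
  have [h|h] := level_sep kn.
    by have := lt_le_trans n1 (le_trans k2 h); rewrite ltxx.
  by have := lt_le_trans k1 (le_trans n2 h); rewrite ltxx.
move=> n.
have mF : measurable_fun I (fun x => F (n, x)).
  pose S := (I `&` [set x | level n < `|f x|]) `\` (I `&` [set x | A * level n < `|f x|]).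
  have mS : measurable S by apply: measurableD; exact: measurable_level.
  apply: (eq_measurable_fun ((fun x => f x / lweight n) \_ S)).
    move=> x /set_mem Ix; rewrite /F/= patchE.
    have [h1|h1] := ltP (level n) `|f x|; last first.
      by rewrite memNset// => -[[_ /=]]; rewrite ltNge h1.
    have [h2|h2] := leP `|f x| (A * level n).
      by rewrite mem_set//; split => // -[_ /=]; rewrite ltNge h2.
    by rewrite memNset// => -[_]; apply.
  apply: measurable_funTS; apply/(measurable_restrictT _ mS).
  apply: measurable_funM => //; apply: measurable_funS mf; first exact: measurable_Ioo0.
  by move=> x [[]].
have F1 x : `|F (n, x)| <= 1.
  rewrite /F/=; case: ifPn => [/andP[_ h]|_]; last by rewrite normr0.
  by rewrite normrM normfV (gtr0_norm (w0 n)) ler_pdivrMr// mul1r.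
split => //.
rewrite mul1e; apply: le_trans (level_measure Vf f1 (level_gt0 n)).
have mL := measurable_level (level n) mf.
apply: (@le_trans _ _ (\int[mu]_(x in I) (\1_(I `&` [set x | level n < `|f x|]) x)%:E)%E).
  apply: ge0_le_integral => //; first exact: measurable_Ioo0.
  - by apply/measurable_EFinP; exact: (measurable_abs (F := F)).
  - by apply/measurable_EFinP; exact: measurable_indic.
  - move=> x Ix; rewrite lee_fin indicE.
    have [h|h] := ltP (level n) `|f x|; first by rewrite mem_set.
    by rewrite /F/= ltNge h/= normr0.
rewrite integral_indic//; last exact: measurable_Ioo0.
by rewrite setIAC setIid.
Qed.

End Weights.

Lemma sqr_lower_bound (R : realType) (a b e : R) : 0 < e -> e <= a ->
  (a - b) ^+ 2 <= (e / 2) ^+ 2 -> e / 2 <= b.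
Proof.
move=> e0 ea h2; suff : a - b <= e / 2 by lra.
rewrite leNgt; apply/negP => h; move: h2; apply/negP; rewrite -ltNge.
by rewrite ltr_sqr// ?nnegrE; lra.
Qed.

Lemma near_min_absurd (R : realType) (i p q a b x y : R) : i <= q -> p < i + x ->
  q = p - b + a -> a <= x -> y = x + x -> y < b -> False.
Proof. by lra. Qed.

Lemma sub_le_of_halves (R : realType) (x y a b d : R) : y - d / 2 <= a ->
  x <= d / 2 -> x = a - b -> y - b <= d.
Proof. by lra. Qed.

(** * Sufficiency of the conditions *)

Section Helly.
Variables (R : realType) (T : lmodType R) (V : set T) (nrm : T -> R).
Hypothesis nrm0 : forall f, 0 <= nrm f.
Implicit Types (u : T -> R).

Lemma dual_elem_lin a u1 u2 : dual_elem V nrm u1 -> dual_elem V nrm u2 ->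
  dual_elem V nrm (a *: u1 + u2).
Proof.
move=> [l1 [C1 b1]] [l2 [C2 b2]]; split.
  move=> b f g Vf Vg.
  change (a * u1 (b *: f + g) + u2 (b *: f + g) =
    b * (a * u1 f + u2 f) + (a * u1 g + u2 g)).
  by rewrite l1// l2//; ring.
exists (`|a| * C1 + C2) => f Vf; change (`|a * u1 f + u2 f| <= (`|a| * C1 + C2) * nrm f).
apply: le_trans (ler_normD _ _) _; rewrite mulrDl lerD ?b2// normrM -mulrA.
by rewrite ler_wpM2l// b1.
Qed.

Lemma dual_norm_has u f0 : dual_elem V nrm u -> V f0 -> nrm f0 <= 1 ->
  has_sup [set `|u f| | f in [set f | V f /\ nrm f <= 1]].
Proof.
move=> [_ [D uD]] V0 f01; split; first by exists `|u f0|, f0.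
exists `|D| => _ [f [Vf f1] <-]; apply: le_trans (uD _ Vf) _.
apply: (@le_trans _ _ (`|D| * nrm f)); first by rewrite ler_wpM2r// ler_norm.
by rewrite ler_piMr.
Qed.

Lemma dual_sum (N : nat) (r : nat -> R) (z : nat -> T -> R) (Phi : (T -> R) -> R) :
  (forall i, dual_elem V nrm (z i)) ->
  dual_elem (dual_set V nrm) (dual_norm V nrm) Phi ->
  dual_elem V nrm (fun f => \sum_(0 <= i < N) r i * z i f) /\
  Phi (fun f => \sum_(0 <= i < N) r i * z i f) = \sum_(0 <= i < N) r i * Phi (z i).
Proof.
move=> dz [Pl [D PD]].
have E0 : (fun f => \sum_(0 <= i < 0) r i * z i f) = 0 *: z 0%N + 0 *: z 0%N.
  apply/funext => f; rewrite big_geq//.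
  by change (0 = 0 * z 0%N f + 0 * z 0%N f); rewrite mul0r addr0.
elim: N => [|N [IH1 IH2]].
  have d0 : dual_elem V nrm (0 *: z 0%N).
    split=> [a f g _ _|]; first by change (0 * z 0%N (a *: f + g) =
      a * (0 * z 0%N f) + 0 * z 0%N g); rewrite !mul0r mulr0 addr0.
    by exists 0 => f _; change (`|0 * z 0%N f| <= 0 * nrm f); rewrite !mul0r normr0.
  have P0 : Phi (0 *: z 0%N) = 0.
    have := Pl 1 _ _ d0 d0; rewrite scale1r mul1r.
    have -> : 0 *: z 0%N + 0 *: z 0%N = 0 *: z 0%N by rewrite !scale0r addr0.
    by move/eqP; rewrite -subr_eq subrr eq_sym => /eqP.
  rewrite E0 [\sum_(0 <= i < 0) _ * Phi _]big_geq//; split.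
    exact: dual_elem_lin (dz 0%N) d0.
  by rewrite (Pl 0 _ _ (dz 0%N) d0) mul0r add0r; exact: P0.
have ES : (fun f => \sum_(0 <= i < N.+1) r i * z i f) =
    r N *: z N + (fun f => \sum_(0 <= i < N) r i * z i f).
  apply/funext => f; rewrite big_nat_recr//= addrC.
  by change (r N * z N f + \sum_(0 <= i < N) r i * z i f =
    r N * z N f + \sum_(0 <= i < N) r i * z i f).
rewrite ES; split; first exact: dual_elem_lin (dz N) IH1.
by rewrite (Pl _ _ _ (dz N) IH1) IH2 [RHS]big_nat_recr//= addrC.
Qed.

End Helly.

Section Sufficiency.
Variables (R : realType) (gamma : \bar R) (psi : R -> R) (A : R).
Local Notation mu := (@lebesgue_measure R).
Local Notation I := (Ioo0 gamma).
Local Notation V := (Mpsi gamma psi).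
Local Notation nrm := (Mnorm gamma psi).
Hypothesis cw : concave_weight gamma psi.
Let psi_mono := cw_mono cw.
Hypothesis gamma0 : (0 < gamma)%E.
Hypothesis A2 : 2 <= A.
Hypothesis dil : forall t, 0 < t -> ((A * t)%:E < gamma)%E -> 2 * psi t <= psi (A * t).

Let psi_gt0 := psi_gt0 cw.

Let I0 := Ioo0_neq0 cw.

Let A0 : 0 < A. Proof. exact: lt_le_trans A2. Qed.

Local Notation w := (lweight A).
Local Notation tau := (ltau gamma psi A).
Local Notation B := (Bset gamma tau).
Local Notation Q := (Qs w).
Local Notation X := (nat * R)%type.
Let K : R := 4 * A.

Let w0 n : 0 <= w n.
Proof. by rewrite mulr_ge0 ?(ltW A0)// ltW// level_gt0. Qed.

Let tau0 n : (0 <= tau n)%E.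
Proof. exact: level_tau_ge0. Qed.

Let HW t : I t -> (wsum w tau 1 1 t <= (K * psi t)%:E)%E.
Proof. exact: level_wsum. Qed.

Let K0 : 0 < K. Proof. by rewrite mulr_gt0. Qed.

(** Iterating the dilation k times bounds psi(A^-k t) by 2^-k psi(t). *)
Lemma psi_dilate d : 0 < d -> exists2 eta, 0 < eta <= 1 &
  forall t, I t -> psi (eta * t) <= d * psi t.
Proof.
move=> d0.
have iter k t : 0 < t -> ((A ^+ k * t)%:E < gamma)%E -> 2 ^+ k * psi t <= psi (A ^+ k * t).
  elim: k t => [|k IH] t t0; first by rewrite !expr0 !mul1r.
  rewrite exprS -mulrA => h.
  have Ak0 : 0 < A ^+ k * t by rewrite mulr_gt0// exprn_gt0.
  have h' : ((A ^+ k * t)%:E < gamma)%E.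
    apply: le_lt_trans h; rewrite lee_fin ler_peMl ?(ltW Ak0)//.
    by apply: le_trans A2; lra.
  apply: le_trans (dil Ak0 h); rewrite exprS -mulrA ler_pM2l//.
  exact: IH.
have [k Hk] : exists k, (2^-1 : R) ^+ k <= d.
  have h : `|2^-1 : R| < 1 by rewrite ger0_norm//; lra.
  have /cvgr_le/(_ _ d0)[k _ /(_ k (leqnn k)) hk] := cvg_expr h.
  by exists k.
have Ak : 0 < A ^+ k by rewrite exprn_gt0.
exists (A ^+ k)^-1.
  rewrite invr_gt0 Ak/= invf_le1//; apply: exprn_ege1.
  by apply: le_trans A2; lra.
move=> t [t0 tg].
have E : A ^+ k * ((A ^+ k)^-1 * t) = t by rewrite mulrA divff ?mul1r// gt_eqF.
have := iter k ((A ^+ k)^-1 * t); rewrite E mulr_gt0 ?invr_gt0// => /(_ isT tg) h.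
have pt : 0 < psi t by apply: psi_gt0.
apply: (@le_trans _ _ (2^-1 ^+ k * psi t)); last by rewrite ler_pM2r.
by rewrite exprVn ler_pdivlMl// exprn_gt0.
Qed.

Section NullSequence.
Variables (z : nat -> (R -> R) -> R).
Hypothesis dz : forall k, dual_elem V nrm (z k).
Hypothesis z0 : forall f, V f -> z k f @[k --> \oo] --> 0.

Let v k (F : X -> R) : R := z k (Q F).

Let vl k : blinear gamma tau (v k).
Proof.
split.
  move=> c a F H c0 BF BH; exact: (dual_Qs psi_gt0 I0 w0 tau0 HW a (dz k) c0 BF BH).
have [_ [D zD]] := dz k; exists (`|D| * K) => F BF.
have [VF nF] := Qs_mem psi_gt0 I0 w0 tau0 HW BF ler01; rewrite mul1r in nF.
apply: (le_trans (zD _ VF)); apply: (@le_trans _ _ (`|D| * nrm (Q F))).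
  by rewrite ler_wpM2r ?ler_norm// Mnorm_ge0.
by rewrite ler_wpM2l.
Qed.

Let v0 F : B 1 1 F -> v n F @[n --> \oo] --> 0.
Proof.
by move=> BF; have [VF _] := Qs_mem psi_gt0 I0 w0 tau0 HW BF ler01; exact: z0.
Qed.

Let dec f : V f -> nrm f <= 1 -> exists2 F, B 1 1 F & Q F = f.
Proof. exact: level_decomposition. Qed.

(** The image of F has norm at most r = c K d. Divided by r, it has a second preimage, in B 1 1,
    where [uniform_bound] applies; d is chosen so that r M = e. *)
Let vsm c e : 0 < c -> 0 < e -> exists2 eta, 0 < eta &
  forall j F, B eta c F -> `|v j F| <= e.
Proof.
move=> c0 e0.
have [M M0 vM] := uniform_bound tau0 vl v0.
pose d := e / (c * K * M).
have d0 : 0 < d by rewrite divr_gt0// !mulr_gt0.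
have [eta eta01 He] := psi_dilate d0; have /andP[eta0 eta1] := eta01.
exists (c * eta); first exact: mulr_gt0.
move=> j F BF.
pose r := c * K * d.
have r0 : 0 < r by rewrite /r mulr_gt0// mulr_gt0.
have rV : 0 < r^-1 by rewrite invr_gt0.
have BrF : B (r^-1 * c * eta) (r^-1 * c) (r^-1 *: F).
  by have := BsetZ r^-1 BF; rewrite gtr0_norm// mulrA.
have cr0 : 0 <= r^-1 * c by rewrite mulr_ge0// ltW.
have [Vr nr] := Qs_small psi_gt0 I0 w0 tau0 HW BrF cr0 eta01 (ltW K0) He.
have nr1 : nrm (Q (r^-1 *: F)) <= 1.
  apply: (le_trans nr).
  have -> : r^-1 * c * K * d = r^-1 * r by rewrite /r !mulrA.
  by rewrite mulVf ?gt_eqF.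
have [F' BF' QF'] := dec Vr nr1.
have BcF : B c c F by apply: (BsetW tau0 _ _ BF) => //; rewrite ler_piMr// ltW.
have h : `|v j (r^-1 *: F)| <= M by rewrite /v -QF'; exact: vM.
rewrite (blinearZ tau0 _ (vl j) (ltW c0) BcF) normrM (gtr0_norm rV) in h.
rewrite ler_pdivrMl// in h; apply: (le_trans h).
rewrite le_eqVlt; apply/orP; left; apply/eqP.
rewrite /r /d; field.
by rewrite !gt_eqF.
Qed.

(** Helly's theorem by least squares. At a near-minimizer F of the squared distance, moving towards
    any G of the ball gains almost nothing; testing with a G that nearly norms the combination Z of
    the z i, with the residuals as coefficients, bounds the squared distance itself. *)
Lemma helly_ball (Phi : ((R -> R) -> R) -> R) (C : R) : 0 < C ->
  dual_elem (dual_set V nrm) (dual_norm V nrm) Phi ->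
  (forall u, dual_elem V nrm u -> `|Phi u| <= C * dual_norm V nrm u) ->
  forall N d, 0 < d -> exists2 F, B C C F &
    \sum_(0 <= i < N) (Phi (z i) - v i F) ^+ 2 <= d.
Proof.
move=> C0 dP PC N d d0; have C0' := ltW C0.
pose phi F := \sum_(0 <= i < N) (Phi (z i) - v i F) ^+ 2.
have phi0 F : 0 <= phi F by apply: sumr_ge0 => i _; rewrite sqr_ge0.
have hphi : has_inf [set phi F | F in B C C].
  split; last by exists 0 => _ [F _ <-].
  by exists (phi (fun=> 0)), (fun=> 0) => //; exact: Bset0.
have [M M0 vM] := uniform_bound tau0 vl v0.
have vC i F : B C C F -> `|v i F| <= C * M by exact: (blinear_le tau0 (vl i) (vM i)).
pose G0 := N%:R * (2 * (C * M)) ^+ 2 + 1.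
have G00 : 0 < G0.
  have : 0 <= N%:R * (2 * (C * M)) ^+ 2 by rewrite mulr_ge0// sqr_ge0.
  by rewrite /G0; lra.
(* G0 bounds the quadratic coefficient below: at step length s the quadratic term costs at most s
   d/2, and F is within s d/2 of the infimum, so the linear gain is at most s d. *)
pose s := Num.min 1 (d / (2 * G0)).
have s0 : 0 < s by rewrite lt_min ltr01 divr_gt0// mulr_gt0.
have s1 : s <= 1 by rewrite ge_min lexx.
have sG : s * G0 <= d / 2.
  have : s <= d / (2 * G0) by rewrite ge_min lexx orbT.
  rewrite ler_pdivlMr ?mulr_gt0// => h; lra.
have [_ [F BF <-] hF] := inf_adherent (mulr_gt0 s0 (divr_gt0 d0 (ltr0Sn R 1))) hphi.
exists F => //.
pose r i := Phi (z i) - v i F.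
have [dZ PZ] := dual_sum N r dz dP.
set Z := (fun f => _) in dZ PZ.
have V0 : V (Q (fun=> 0)) /\ nrm (Q (fun=> 0)) <= 1.
  have [? h] := Qs_mem psi_gt0 I0 w0 tau0 HW (Bset0 gamma tau0 (lexx 0)) (lexx 0).
  by split => //; apply: (le_trans h); rewrite mul0r.
have hs := dual_norm_has (Mnorm_ge0 psi_gt0 I0) dZ V0.1 V0.2.
have dC : 0 < d / 2 / C by rewrite !divr_gt0.
have [_ [f [Vf f1] <-] hf] := sup_adherent dC hs.
have [G' BG' QG'] := dec Vf f1.
(* G nearly attains C times the norm of Z inside the ball of radius C; the sign makes the value
   nonnegative. *)
pose G := (C * Num.sg (Z f)) *: G'.
have BG : B C C G.
  have := BsetZ (C * Num.sg (Z f)) BG'; rewrite !mulr1; apply: (BsetW tau0);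
  rewrite normrM (gtr0_norm C0) ler_piMr// normr_sg; case: (_ != _) => //.
have vG i : v i G = C * Num.sg (Z f) * z i f.
  by rewrite (blinearZ tau0 _ (vl i) ler01 BG') /v QG'.
have rG : \sum_(0 <= i < N) r i * Phi (z i) - d / 2 <= \sum_(0 <= i < N) r i * v i G.
  have -> : \sum_(0 <= i < N) r i * v i G = C * `|Z f|.
    rewrite normrEsg mulrA /Z mulr_sumr; apply: eq_bigr => i _.
    by rewrite vG; ring.
  rewrite -PZ; have := PC _ dZ; have := ler_norm (Phi Z).
  have : C * (dual_norm V nrm Z - d / 2 / C) < C * `|Z f| by rewrite ltr_pM2l.
  have -> : C * (dual_norm V nrm Z - d / 2 / C) = C * dual_norm V nrm Z - d / 2.
    by field; rewrite gt_eqF.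
  move=> h1 h2 h3; apply: le_trans (ltW h1); rewrite lerD2r.
  exact: le_trans h2 h3.
pose g i := v i G - v i F.
pose H := s *: (G - F) + F.
have BH : B C C H.
  have -> : H = s *: G + (1 - s) *: F.
    by rewrite /H scalerBr scalerBl scale1r -addrA; congr (_ + _); exact: addrC.
  have := BsetD _ _ (BsetZ s BG) (BsetZ (1 - s) BF).
  rewrite (gtr0_norm s0) ger0_norm ?subr_ge0//.
  have -> : s * C + (1 - s) * C = C by ring.
  by apply; rewrite mulr_ge0 ?subr_ge0// ltW.
have vH i : v i H = s * g i + v i F.
  have CC : 0 <= C + C by rewrite addr_ge0.
  have BGF : B (C + C) (C + C) (G - F) := BsetD C0' C0' BG (BsetN BF).
  have BF' : B (C + C) (C + C) F by apply: (BsetW tau0 _ _ BF); rewrite lerDl.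
  rewrite (proj1 (vl i) _ s _ _ CC BGF BF').
  by rewrite (blinearB tau0 (vl i) C0' BG BF).
have phiH : phi H = phi F - 2 * s * \sum_(0 <= i < N) r i * g i +
    s ^+ 2 * \sum_(0 <= i < N) g i ^+ 2.
  rewrite /phi !mulr_sumr -sumrB -big_split/=; apply: eq_bigr => i _.
  by rewrite vH /r; ring.
have gG : \sum_(0 <= i < N) g i ^+ 2 <= G0.
  apply: (@le_trans _ _ (\sum_(0 <= i < N) (2 * (C * M)) ^+ 2)).
    apply: ler_sum => i _; rewrite -[leLHS]real_normK ?num_real//.
    rewrite ler_sqr ?nnegrE ?mulr_ge0 ?(ltW M0)//.
    apply: le_trans (ler_normB _ _) _; rewrite mulr_natl mulr2n.
    by apply: lerD; exact: vC.
  by rewrite sumr_const_nat subn0 -[_ *+ _]mulr_natl /G0 lerDl.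
have infH : inf [set phi F | F in B C C] <= phi H by apply: inf_lbound; [exact: hphi.2|exists H].
have rg : \sum_(0 <= i < N) r i * g i <= d / 2.
  rewrite leNgt; apply/negP => h.
  have h1 : 2 * s * (d / 2) < 2 * s * \sum_(0 <= i < N) r i * g i.
    by rewrite ltr_pM2l// mulr_gt0.
  have h2 : s ^+ 2 * \sum_(0 <= i < N) g i ^+ 2 <= s * (d / 2).
    apply: (@le_trans _ _ (s * (s * G0))); last by rewrite ler_pM2l.
    by rewrite expr2 -mulrA !ler_pM2l.
  apply: (near_min_absurd infH hF phiH h2 _ h1).
  by ring.
have -> : \sum_(0 <= i < N) (Phi (z i) - v i F) ^+ 2 =
    \sum_(0 <= i < N) r i * Phi (z i) - \sum_(0 <= i < N) r i * v i F.
  by rewrite -sumrB; apply: eq_bigr => i _; rewrite /r; ring.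
have : \sum_(0 <= i < N) r i * g i =
    \sum_(0 <= i < N) r i * v i G - \sum_(0 <= i < N) r i * v i F.
  by rewrite -sumrB; apply: eq_bigr => i _; rewrite /g mulrBr.
exact: sub_le_of_halves rG rg.
Qed.

Lemma no_weak_lower_bound (Phi : ((R -> R) -> R) -> R) (e : R) :
  dual_elem (dual_set V nrm) (dual_norm V nrm) Phi -> 0 < e ->
  ~ (forall k, e <= Phi (z k)).
Proof.
move=> dP e0 HP; have [_ [D PD]] := dP.
pose C := `|D| + 1.
have C0 : 0 < C by rewrite /C; have := normr_ge0 D; lra.
have dn0 u : dual_elem V nrm u -> 0 <= dual_norm V nrm u.
  move=> du.
  have [V0 h] := Qs_mem psi_gt0 I0 w0 tau0 HW (Bset0 gamma tau0 (lexx 0)) (lexx 0).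
  have h1 : nrm (Q (fun=> 0)) <= 1 by apply: (le_trans h); rewrite mul0r.
  apply: (@le_trans _ _ `|u (Q (fun=> 0))|) => //.
  apply: sup_upper_bound; first exact: (dual_norm_has (Mnorm_ge0 psi_gt0 I0) du V0 h1).
  by exists (Q (fun=> 0)).
have PC u : dual_elem V nrm u -> `|Phi u| <= C * dual_norm V nrm u.
  move=> du; apply: (le_trans (PD _ du)); rewrite ler_wpM2r ?dn0//.
  by rewrite /C; have := ler_norm D; lra.
apply: (@weak_null_contradiction _ gamma tau tau0 v vl v0 vsm C (e / 2)) => //; first by lra.
move=> k; have e2 : 0 < (e / 2) ^+ 2 by rewrite exprn_gt0//; lra.
have [F BF hF] := helly_ball C0 dP PC k e2.
exists F => // i ik.
have : (Phi (z i) - v i F) ^+ 2 <= (e / 2) ^+ 2.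
  apply: le_trans hF; rewrite (bigD1_seq i)/= ?mem_index_iota ?iota_uniq//.
  by rewrite lerDl; apply: sumr_ge0 => j _; rewrite sqr_ge0.
exact: sqr_lower_bound e0 (HP i).
Qed.

End NullSequence.

Lemma dilation_Grothendieck : Grothendieck V nrm.
Proof.
move=> u u0 du du0 cu Phi dP.
apply: contrapT => ncvg.
have [e e0 He] : exists2 e, 0 < e & forall N, exists2 n, (N <= n)%N &
    e <= `|Phi (u n) - Phi u0|.
  apply: contrapT => ne; apply: ncvg; apply/cvgrPdist_lt => e e0.
  apply: contrapT => nn; apply: ne; exists e => // N.
  apply: contrapT => nN; apply: nn; exists N => // n /= Nn.
  rewrite distrC ltNge; apply/negP => h; apply: nN.
  by exists n.
have [s si Hs] := infinitely_incr He.
pose x n := -1 *: u0 + u n.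
have dx n : dual_elem V nrm (x n) by exact: dual_elem_lin du0 (du n).
have Px n : Phi (x n) = Phi (u n) - Phi u0.
  by have [Pl _] := dP; rewrite /x (Pl (-1) u0 (u n) du0 (du n)) mulN1r addrC.
(* The sign makes Phi (z k) equal to |Phi (u n) - Phi u0| at n = s k; the zero multiple gives the
   form a *: u1 + u2 in which linearity over the dual is stated. *)
pose z k := Num.sg (Phi (x (s k))) *: x (s k) + 0 *: x (s k).
have zE k f : z k f = Num.sg (Phi (x (s k))) * x (s k) f.
  change (Num.sg (Phi (x (s k))) * x (s k) f + 0 * x (s k) f =
    Num.sg (Phi (x (s k))) * x (s k) f).
  by rewrite mul0r addr0.
have dx0 n : dual_elem V nrm (0 *: x n).
  split=> [a f g _ _|]; first by change (0 * x n (a *: f + g) =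
    a * (0 * x n f) + 0 * x n g); rewrite !mul0r mulr0 addr0.
  by exists 0 => f _; change (`|0 * x n f| <= 0 * nrm f); rewrite !mul0r normr0.
have dz k : dual_elem V nrm (z k) by exact: dual_elem_lin (dx _) (dx0 _).
have P0 n : Phi (0 *: x n) = 0.
  have [Pl _] := dP; have := Pl 1 _ _ (dx0 n) (dx0 n); rewrite scale1r mul1r.
  have -> : 0 *: x n + 0 *: x n = 0 *: x n by rewrite !scale0r addr0.
  by move/eqP; rewrite -subr_eq subrr eq_sym => /eqP.
have z0 f : V f -> z k f @[k --> \oo] --> 0.
  move=> Vf.
  have h1 : (fun k => `|x (s k) f|) @ \oo --> 0.
    have : (fun n => x n f) @ \oo --> 0.
      rewrite -(subrr (u0 f)) (_ : (fun n => x n f) = (fun n => u n f - u0 f)).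
        by apply: cvgB (cu f Vf) _; exact: cvg_cst.
      apply/funext => n; change (-1 * u0 f + u n f = u n f - u0 f).
      by rewrite mulN1r addrC.
    move=> /(cvg_incr si) h; rewrite -(@normr0 _ R); exact: cvg_norm.
  apply/cvgr0Pnorm_lt => d d0; near=> k; rewrite zE normrM.
  apply: (@le_lt_trans _ _ `|x (s k) f|).
    by rewrite ler_piMl// normr_sg; case: (_ != _).
  near: k; have /cvgr0Pnorm_lt/(_ d d0) := h1.
  by apply: filterS => k; rewrite normr_id.
apply: (@no_weak_lower_bound z dz z0 Phi e dP e0) => k.
have [Pl _] := dP; rewrite /z Pl; [|exact: dx|exact: dx0].
by rewrite P0 addr0 -normrEsg Px.
Unshelve. all: by end_near. Qed.

End Sufficiency.

(** * From the liminf conditions to a dilation constant *)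

Section Dilation.
Variables (R : realType) (gamma : \bar R) (psi : R -> R).
Local Notation I := (Ioo0 gamma).
Hypothesis cw : concave_weight gamma psi.
Let psi_mono := cw_mono cw.

Let psi_gt0 := psi_gt0 cw.

Lemma psi_doubling_iter (c t : R) (k : nat) : 0 <= c ->
  (forall j, (j < k)%N -> c * psi (2 ^+ j * t) <= psi (2 * (2 ^+ j * t))) ->
  c ^+ k * psi t <= psi (2 ^+ k * t).
Proof.
move=> c0; elim: k => [|k IH] H; first by rewrite !expr0 !mul1r.
rewrite !exprS -!mulrA; apply: le_trans (H k (ltnSn k)).
by rewrite ler_wpM2l// IH// => j jk; apply: H; exact: ltnW.
Qed.

Lemma exists_expr_ge2 (c : R) : 1 < c -> exists k, 2 <= c ^+ k.
Proof.
move=> c1; have cV : `|c^-1| < 1.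
  by rewrite ger0_norm ?invr_ge0 ?invf_lt1//; lra.
have h2 : 0 < (2^-1 : R) by [].
have /cvgr_le/(_ _ h2)[k _ /(_ k (leqnn k)) h] := cvg_expr cV.
exists k; move: h; rewrite /= exprVn lef_pV2// posrE ?exprn_gt0//; lra.
Qed.

Definition dilation := exists2 A, 2 <= A &
  forall t, 0 < t -> ((A * t)%:E < gamma)%E -> 2 * psi t <= psi (A * t).

Lemma near0_doubling :
  (1 < limf_einf (fun t : R => (psi (2 * t) / psi t)%:E) ((0:R)^'+))%E ->
  exists2 c, 1 < c & exists2 d, 0 < d &
    forall t, 0 < t -> t < d -> I t -> c * psi t <= psi (2 * t).
Proof.
move=> /limf_einf_gt1P[c c1 /= [d /= d0 Hd]]; exists c => //; exists d => //.
move=> t t0 td It; rewrite -ler_pdivlMr ?psi_gt0//.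
by apply: Hd => //=; rewrite sub0r normrN gtr0_norm.
Qed.

Lemma finite_dilation : (0 < gamma)%E -> (gamma < +oo)%E ->
  (1 < limf_einf (fun t : R => (psi (2 * t) / psi t)%:E) ((0:R)^'+))%E -> dilation.
Proof.
move=> g0 gy /near0_doubling[c c1 [d d0 Hd]].
have [k Hk] := exists_expr_ge2 c1.
have [g gE] : exists g, gamma = g%:E by case: gamma g0 gy => [g||]// _ _; exists g.
have g0' : 0 < g by rewrite -lte_fin -gE.
have [n Hn] : exists n, 2^-1 ^+ n * g <= d.
  have h : `|2^-1 : R| < 1 by rewrite ger0_norm//; lra.
  have dg : 0 < d / g by exact: divr_gt0.
  have /cvgr_le/(_ _ dg)[n _ /(_ n (leqnn n)) hn] := cvg_expr h.
  by exists n; rewrite -ler_pdivlMr.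
(* As 2^-n g <= d, the bound A t < g forces 2^k t < d: all k doublings take place where the
   condition at 0 holds. *)
pose A : R := 2 ^+ (n + k).+1.
exists A; first by rewrite /A exprS ler_peMr// exprn_ege1//; lra.
move=> t t0; rewrite gE lte_fin => Atg.
have p2 j : 0 < (2 : R) ^+ j by rewrite exprn_gt0.
have k_le : 2 ^+ k * t < d.
  apply: lt_le_trans Hn; rewrite exprVn ltr_pdivlMl//.
  apply: le_lt_trans Atg; rewrite mulrA ler_pM2r// -exprD /A ler_weXn2l//; lra.
have jd j : (j <= k)%N -> 2 ^+ j * t < d.
  move=> jk; apply: le_lt_trans k_le; rewrite ler_pM2r// ler_weXn2l//; lra.
have jA j : (j <= k)%N -> 2 ^+ j * t <= A * t.
  move=> jk; rewrite ler_pM2r// ler_weXn2l//; first by lra.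
  by apply: leqW; apply: leq_trans jk (leq_addl _ _).
apply: (@le_trans _ _ (psi (2 ^+ k * t))).
  apply: (@le_trans _ _ (c ^+ k * psi t)).
    rewrite ler_wpM2r// (cw_ge0 cw) ?(ltW t0)// gE lte_fin.
    by apply: le_lt_trans Atg; have := jA 0%N (leq0n _); rewrite expr0 mul1r.
  apply: psi_doubling_iter; first by lra.
  move=> j jk; apply: Hd; [by rewrite mulr_gt0|exact/jd/ltnW|].
  split; first by rewrite mulr_gt0.
  by rewrite gE lte_fin; apply: le_lt_trans Atg; apply: jA; exact: ltnW.
apply: psi_mono; [by rewrite mulr_ge0// ltW|exact: jA|by rewrite gE lte_fin].
Qed.

(** Between the ranges of the two conditions concavity helps: for d <= t < b already psi(mt) >= c2
    psi(t) with m = 2b/a, and [psi_mult] turns this into doubling at t by the factor c0. *)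
Lemma infinite_dilation : gamma = +oo%E ->
  (1 < limf_einf (fun t : R => (psi (2 * t) / psi t)%:E) ((0:R)^'+))%E ->
  (1 < limf_einf (fun t : R => (psi (2 * t) / psi t)%:E) (pinfty_nbhs R))%E ->
  dilation.
Proof.
move=> gy h0 /limf_einf_gt1P[c2 c21 /= [T [_ HT]]].
have ty (t : R) : (t%:E < gamma)%E by rewrite gy ltry.
have [c1 c11 [d d0 Hd]] := near0_doubling h0.
have Ip t : 0 < t -> I t by [].
pose a := d / 2; pose b := Num.max (Num.max T a) 0 + 1.
have a0 : 0 < a by rewrite /a; lra.
have b0 : 0 < b by rewrite /b ltr_wpDl// le_max lexx orbT.
have Tb : T < b by rewrite /b ltr_pwDr// !le_max lexx.
have ab : a <= b by rewrite /b ler_wpDr// !le_max lexx orbT.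
pose m := 2 * b / a.
have m2 : 2 <= m by rewrite /m ler_pdivlMr// ler_pM2l.
pose c0 := 1 + (c2 - 1) / (m - 1).
have m1 : 0 < m - 1 by lra.
have c01 : 1 < c0 by rewrite /c0 ltrDl divr_gt0//; lra.
pose c := Num.min c0 (Num.min c1 c2).
have cc1 : 1 < c by rewrite /c !lt_min c01 c11.
have HTb t : b <= t -> c2 * psi t <= psi (2 * t).
  move=> bt; have t0 : 0 < t by exact: lt_le_trans bt.
  rewrite -ler_pdivlMr ?(psi_gt0 (Ip _ t0))//.
  by apply: HT; exact: lt_le_trans bt.
have Hc t : 0 < t -> c * psi t <= psi (2 * t).
  move=> t0; have pt : 0 < psi t by apply/psi_gt0/Ip.
  have [td|dt] := ltP t d.
    apply: le_trans (Hd t t0 td (Ip t t0)); rewrite ler_pM2r//.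
    by rewrite /c !ge_min lexx !orbT.
  have [bt|tb] := leP b t.
    apply: le_trans (HTb t bt); rewrite ler_pM2r//.
    by rewrite /c !ge_min lexx !orbT.
  apply: (@le_trans _ _ (c0 * psi t)); first by rewrite ler_pM2r// /c ge_min lexx.
  have ma : 2 * b <= m * t.
    have -> : 2 * b = m * a by rewrite /m divfK// gt_eqF.
    rewrite ler_wpM2l//; first by lra.
    by apply: le_trans dt; rewrite /a; lra.
  have h1 := psi_mult cw m2 t0 (ty _).
  have h2 : c2 * psi t <= psi (m * t).
    apply: (@le_trans _ _ (psi (2 * b))).
      apply: le_trans (HTb b (lexx b)); rewrite ler_pM2l; last by lra.
      by apply: psi_mono (ty _); exact: ltW.
    by apply: psi_mono (ty _) => //; lra.
  have h3 : (c2 - 1) * psi t / (m - 1) <= psi (2 * t) - psi t.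
    rewrite ler_pdivrMr// mulrC -/(m - 1); lra.
  have E : c0 * psi t = psi t + (c2 - 1) * psi t / (m - 1) by rewrite /c0; ring.
  by rewrite E; lra.
have [k Hk] := exists_expr_ge2 cc1.
exists (2 ^+ k.+1); first by rewrite exprS ler_peMr// exprn_ege1//; lra.
move=> t t0 _; have p2 j : 0 < (2 : R) ^+ j by rewrite exprn_gt0.
apply: (@le_trans _ _ (psi (2 ^+ k * t))).
  apply: (@le_trans _ _ (c ^+ k * psi t)).
    by rewrite ler_wpM2r// (cw_ge0 cw) ?(ltW t0).
  apply: psi_doubling_iter; first by lra.
  by move=> j _; apply: Hc; rewrite mulr_gt0.
apply: psi_mono (ty _); first by rewrite mulr_ge0// ltW.
by rewrite ler_pM2r// ler_weXn2l//; lra.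
Qed.

End Dilation.

Theorem theorem5p6 (R : realType) (gamma : \bar R) (psi : R -> R) :
  (0 < gamma)%E ->
  (* psi : [0,gamma) -> [0,oo) *)
  (forall t, 0 <= t -> (t%:E < gamma)%E -> 0 <= psi t) ->
  (* non-zero *)
  (exists t, 0 <= t /\ (t%:E < gamma)%E /\ psi t != 0) ->
  (* increasing *)
  (forall s t, 0 <= s -> s <= t -> (t%:E < gamma)%E -> psi s <= psi t) ->
  (* concave on [0,gamma) *)
  (forall (l s t : R), 0 <= l <= 1 -> 0 <= s -> (s%:E < gamma)%E ->
     0 <= t -> (t%:E < gamma)%E ->
     l * psi s + (1 - l) * psi t <= psi (l * s + (1 - l) * t)) ->
  (* continuous on (0,gamma) *)
  (forall t, Ioo0 gamma t -> {for t, continuous psi}) ->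
  psi 0 = 0 ->
  Grothendieck (Mpsi gamma psi) (Mnorm gamma psi) <->
  ( (* condition (A) *)
    (gamma = +oo%E /\
     (1 < limf_einf (fun t : R => (psi (2 * t) / psi t)%:E) ((0:R)^'+))%E /\
     (1 < limf_einf (fun t : R => (psi (2 * t) / psi t)%:E) (pinfty_nbhs R))%E)
  \/ (* condition (B) *)
    ((gamma < +oo)%E /\
     (1 < limf_einf (fun t : R => (psi (2 * t) / psi t)%:E) ((0:R)^'+))%E)).
Proof.
move=> g0 pge0 pnz pmono pconc _ p0.
have cw := ConcaveWeight pge0 pnz pmono pconc p0; split.
  move=> G.
  have h0 : (1 < limf_einf (fun t : R => (psi (2 * t) / psi t)%:E) ((0:R)^'+))%E.
    apply: contrapT => nh.
    exact: (near0_not_Grothendieck cw nh G).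
  have [gy|] := ltP gamma +oo%E; first by right; split.
  rewrite leye_eq => /eqP gy; left; split => //; split => //.
  apply: contrapT => nh.
  exact: (infty_not_Grothendieck cw gy nh G).
move=> H; suff [A A2 dil] : dilation gamma psi.
  exact: (dilation_Grothendieck cw g0 A2 dil).
case: H => [[gy [h0 hy]]|[gy h0]].
  exact: (infinite_dilation cw gy h0 hy).
exact: (finite_dilation cw g0 gy h0).
Qed.
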